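(* Let $n\geq 2$, let $X\subset\mathbb P^{n+1}$ be a smooth hypersurface of degree $d\geq 4$ over $\mathbb C$, and let $g\in\mathrm{Aut}(X)$ be a linear automorphism of order $d$. Then $\mathrm{Fix}(g)$ has codimension $1$ in $X$ if and only if $X$ has an outer Galois point $p$ such that $g$ is an automorphism belonging to the Galois point $p$.
   Context: We work over $\mathbb C$; $\mathbb C(Y)$ denotes the function field of an irreducible variety $Y$. For a smooth hypersurface $X\subset\mathbb P^{n+1}$ and a point $p\in\mathbb P^{n+1}$, let $\pi_p:X\dashrightarrow H$ be the projection with center $p$ onto a hyperplane $H\cong\mathbb P^n$ not containing $p$. It induces a field extension $\pi_p^*:\mathbb C(H)\hookrightarrow\mathbb C(X)$; write $K_p$ for the image of $\mathbb C(H)$ (it does not depend on the choice of $H$). One has $[\mathbb C(X):K_p]=d-1$ if $p\in X$ and $d$ if $p\notin X$. The point $p$ is called a Galois point for $X$ if $\mathbb C(X)/K_p$ is a Galois extension; it is an inner Galois point if moreover $p\in X$, and an outer Galois point if moreover $p\notin X$. An automorphism $g$ of $X$ is linear if there is an automorphism $h$ of $\mathbb P^{n+1}$ with $h(X)=X$ and $h|_X=g$. If $p$ is a Galois point of $X$, an automorphism $g$ of $X$ is called an automorphism belonging to the Galois point $p$ if $g$ (through its induced action on $\mathbb C(X)$) generates the Galois group of $\mathbb C(X)/K_p$. For an automorphism $g$ of $X$, $\mathrm{Fix}(g)=\{x\in X\mid g(x)=x\}$. *)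

(* Defs.v *)
From HB Require Import structures.
From mathcomp Require Import all_boot all_order all_algebra all_solvable all_field.
From mathcomp Require Import boolp classical_sets reals complex.
From mathcomp Require Import mpoly.

Set Implicit Arguments.
Unset Strict Implicit.
Unset Printing Implicit Defensive.

Import GRing.Theory.

Local Open Scope classical_set_scope.
Local Open Scope ring_scope.

Lemma tofrac_div1 (A : idomainType) : tofrac 1 / tofrac 1 = 1 :> {fraction A}.
Proof. by rewrite tofrac1 divr1. Qed.

Lemma tofrac_div0 (A : idomainType) : tofrac 0 / tofrac 1 = 0 :> {fraction A}.
Proof. by rewrite tofrac0 mul0r. Qed.

Lemma tofrac_divB (A : idomainType) (a b c d : A) : b != 0 -> d != 0 ->
  tofrac a / tofrac b - tofrac c / tofrac d =
  tofrac (a * d - c * b) / tofrac (b * d).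
Proof.
by move=> b0 d0; rewrite tofracB !tofracM -!mulNr addf_div ?tofrac_eq0.
Qed.

Lemma tofrac_divM (A : idomainType) (a b c d : A) :
  (tofrac a / tofrac b) * (tofrac c / tofrac d) =
  tofrac (a * c) / tofrac (b * d).
Proof. by rewrite !tofracM mulf_div. Qed.

Lemma tofrac_div_eq1 (A : idomainType) (a b : A) : b != 0 ->
  1 = tofrac a / tofrac b -> a = b.
Proof.
move=> b0 /(congr1 ( *%R^~ (tofrac b))).
by rewrite mul1r divfK ?tofrac_eq0 // => /esym/eqP; rewrite tofrac_eq => /eqP.
Qed.

(* Varieties are treated classically, as sets of points of a projective space
   over an algebraically closed field; a point of P^N is a line through the
   origin of K^(N+1). *)

Record pspace (K : closedFieldType) (N : nat) := PSpace {
  line :> {vspace 'rV[K]_N.+1};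
  _ : \dim line == 1%N }.
HB.instance Definition _ K N := [isSub for @line K N].
HB.instance Definition _ K N := [Choice of pspace K N by <:].

Section Geometry.
Variable K : closedFieldType.

Section OneSpace.
Variable N : nat.
Local Notation P := (pspace K N).
Local Notation poly := {mpoly K[N.+1]}.
Implicit Types (X Y Z : set P) (A B G : poly).

(* A choice of homogeneous coordinates of x; it is only used where the choice
   is immaterial (zeros, or quotients, of forms). *)
Definition hcoord (x : P) : 'I_N.+1 -> K := vpick x 0.

Definition zclosed Z : Prop :=
  exists S : set poly, (forall G, S G -> exists e, G \is e.-homog) /\
    Z = [set x | forall G, S G -> G.@[hcoord x] = 0].

Definition irreducible_closed Z : Prop :=
  [/\ zclosed Z, Z !=set0 &
      forall Z1 Z2, zclosed Z1 -> zclosed Z2 -> Z `<=` Z1 `|` Z2 ->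
        Z `<=` Z1 \/ Z `<=` Z2].

Definition irreducible_chain Z X (k : nat) : Prop :=
  exists c : nat -> set P,
    [/\ c 0%N = Z,
        forall i, (i <= k)%N -> irreducible_closed (c i) /\ c i `<=` X &
        forall i, (i < k)%N -> c i `<` c i.+1].

(* codim(Y, X) is the infimum, over the irreducible closed subsets Z of Y, of
   the supremum of the lengths of the chains of irreducible closed subsets of X
   starting at Z. *)
Definition codim_ge Y X (k : nat) : Prop :=
  forall Z, irreducible_closed Z -> Z `<=` Y -> irreducible_chain Z X k.

Definition has_codim Y X (k : nat) : Prop :=
  codim_ge Y X k /\ ~ codim_ge Y X k.+1.

Definition smooth_hypersurface (d : nat) X : Prop :=
  exists F : poly,
    [/\ F \is d.-homog, X = [set x | F.@[hcoord x] = 0] &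
        forall x, X x -> exists i, (F^`M(i)).@[hcoord x] != 0].

(* The ring of rational functions on X is the degree 0 part of the total ring of
   fractions of the homogeneous coordinate ring K[x]/I(X), I(X) being the ideal
   of the affine cone over X; for X irreducible it is the function field. It is
   built as the ring of the fractions A/B of two forms of the same degree, with B
   regular modulo I(X), modulo those with A in I(X). *)

Definition affine_cone X : set 'rV[K]_N.+1 :=
  [set v | v = 0 \/ exists2 x, X x & v \in line x].

Definition vanishing_ideal X : set poly :=
  [set G | forall v, affine_cone X v -> G.@[v 0] = 0].

Definition regular_mod X B : Prop :=
  forall G, vanishing_ideal X (B * G) -> vanishing_ideal X G.

Definition is_fraction_on X (f : {fraction poly}) A B : Prop :=
  [/\ exists e, A \is e.-homog /\ B \is e.-homog, regular_mod X B &
      f = tofrac A / tofrac B].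

Definition fraction_on X : {pred {fraction poly}} :=
  fun f => `[< exists A B, is_fraction_on X f A B >].

Lemma vanishing_ideal_not1 X : ~ vanishing_ideal X 1.
Proof.
by move=> /(_ 0 (or_introl erefl)); rewrite rmorph1 => /eqP; rewrite oner_eq0.
Qed.

Lemma regular_mod_neq0 X B : regular_mod X B -> B != 0.
Proof.
move=> rB; apply/eqP => B0.
apply: (@vanishing_ideal_not1 X); apply: rB => v _.
by rewrite B0 mul0r rmorph0.
Qed.

Lemma regular_modM X B B' :
  regular_mod X B -> regular_mod X B' -> regular_mod X (B * B').
Proof. by move=> rB rB' G; rewrite -mulrA => /rB /rB'. Qed.

Lemma fraction_on_subring X : subring_closed (fraction_on X).
Proof.
split.
- apply/asboolP; exists 1, 1; split; last by rewrite tofrac_div1.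
    by exists 0%N; rewrite dhomog1.
  by move=> G; rewrite mul1r.
- move=> f f' /asboolP[A [B [[e [hA hB]] rB ->]]].
  move=> /asboolP[A' [B' [[e' [hA' hB']] rB' ->]]].
  apply/asboolP; exists (A * B' - A' * B), (B * B'); split.
  + exists (e + e')%N; rewrite (dhomogM hB hB'); split=> //.
    by rewrite rpredB ?(dhomogM hA hB') // addnC (dhomogM hA' hB).
  + exact: regular_modM.
  + have B0 := regular_mod_neq0 rB; have B'0 := regular_mod_neq0 rB'.
    by rewrite tofrac_divB.
- move=> f f' /asboolP[A [B [[e [hA hB]] rB ->]]].
  move=> /asboolP[A' [B' [[e' [hA' hB']] rB' ->]]].
  apply/asboolP; exists (A * A'), (B * B'); split.
  + by exists (e + e')%N; rewrite (dhomogM hA hA') (dhomogM hB hB').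
  + exact: regular_modM.
  + exact: tofrac_divM.
Qed.

HB.instance Definition _ X :=
  GRing.isSubringClosed.Build {fraction poly} (fraction_on X)
    (fraction_on_subring X).

Record fraction_ring X := FractionRing {
  fraction_val :> {fraction poly};
  _ : fraction_val \in fraction_on X }.
HB.instance Definition _ X := [isSub for @fraction_val X].
HB.instance Definition _ X := [Choice of fraction_ring X by <:].
HB.instance Definition _ X :=
  [SubChoice_isSubComNzRing of fraction_ring X by <:].

Lemma fraction_valB X (u v : fraction_ring X) :
  fraction_val (u - v) = fraction_val u - fraction_val v.
Proof. exact: (rmorphB (val : fraction_ring X -> _)). Qed.

Lemma fraction_valM X (u v : fraction_ring X) :
  fraction_val (u * v) = fraction_val u * fraction_val v.
Proof. exact: (rmorphM (val : fraction_ring X -> _)). Qed.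

Definition zero_on X : {pred fraction_ring X} :=
  fun u => `[< exists A B,
                 is_fraction_on X (fraction_val u) A B /\ vanishing_ideal X A >].

Lemma zero_on_zmod X : zmod_closed (@zero_on X).
Proof.
split.
- apply/asboolP; exists 0, 1; split; last by move=> v _; rewrite rmorph0.
  split; last by rewrite tofrac_div0.
    by exists 0%N; rewrite rpred0 dhomog1.
  by move=> G; rewrite mul1r.
- move=> u u' /asboolP[A [B [[[e [hA hB]] rB uE] vA]]].
  move=> /asboolP[A' [B' [[[e' [hA' hB']] rB' u'E] vA']]].
  apply/asboolP; exists (A * B' - A' * B), (B * B'); split; first split.
  + exists (e + e')%N; rewrite (dhomogM hB hB'); split=> //.
    by rewrite rpredB ?(dhomogM hA hB') // addnC (dhomogM hA' hB).
  + exact: regular_modM.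
  + have B0 := regular_mod_neq0 rB; have B'0 := regular_mod_neq0 rB'.
    by rewrite fraction_valB uE u'E tofrac_divB.
  + by move=> v Xv; rewrite rmorphB !rmorphM /= vA // vA' // !mul0r subr0.
Qed.

Lemma zero_on_proper X :
  1 \notin @zero_on X /\
  forall a, {in @zero_on X, forall u, a * u \in @zero_on X}.
Proof.
split.
- apply/asboolP => -[A [B [[_ rB E] vA]]].
  have AB := tofrac_div_eq1 (regular_mod_neq0 rB) E.
  by apply: (@vanishing_ideal_not1 X); apply: rB; rewrite mulr1 -AB.
- move=> a u /asboolP[A' [B' [[[e' [hA' hB']] rB' u'E] vA']]].
  have /asboolP[A [B [[e [hA hB]] rB aE]]] := valP a.
  apply/asboolP; exists (A * A'), (B * B'); split; first split.
  + by exists (e + e')%N; rewrite (dhomogM hA hA') (dhomogM hB hB').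
  + exact: regular_modM.
  + by rewrite fraction_valM u'E aE tofrac_divM.
  + by move=> v Xv; rewrite rmorphM /= vA' // mulr0.
Qed.

HB.instance Definition _ X :=
  GRing.isZmodClosed.Build (fraction_ring X) (@zero_on X) (zero_on_zmod X).
HB.instance Definition _ X :=
  isProperIdeal.Build (fraction_ring X) (@zero_on X) (zero_on_proper X).

Definition ratfun X : comNzRingType := Quotient.quot (@zero_on X).

(* The rational function phi is defined at the point x of X, with value c. *)
Definition ratfun_value X (phi : ratfun X) (x : P) (c : K) : Prop :=
  exists (u : fraction_ring X) A B,
    [/\ phi = (\pi u)%qT, is_fraction_on X (fraction_val u) A B,
        B.@[hcoord x] != 0 & c = A.@[hcoord x] / B.@[hcoord x]].

End OneSpace.

Section Maps.
Variables N M : nat.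

Definition eval_forms (G : 'I_M.+1 -> {mpoly K[N.+1]}) (x : pspace K N) :
  'rV[K]_M.+1 := \row_i (G i).@[hcoord x].

(* Maps are total functions, of which only the restriction to X matters. *)
Definition regular_map (X : set (pspace K N)) (Y : set (pspace K M))
    (f : pspace K N -> pspace K M) : Prop :=
  (forall x, X x -> Y (f x)) /\
  forall x, X x -> exists (e : nat) (G : 'I_M.+1 -> {mpoly K[N.+1]}),
    [/\ forall i, G i \is e.-homog, eval_forms G x != 0 &
        forall y, X y -> eval_forms G y != 0 ->
          line (f y) = <[eval_forms G y]>%VS].

(* psi is the pullback of phi along the dominant rational map X --> Y whose
   graph is r: whenever x is sent to y and phi is defined at y, psi is defined
   at x, with the same value. *)
Definition is_pullback (X : set (pspace K N)) (Y : set (pspace K M))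
    (r : pspace K N -> pspace K M -> Prop)
    (phi : ratfun Y) (psi : ratfun X) : Prop :=
  forall x y, X x -> Y y -> r x y ->
    forall c, ratfun_value phi y c -> ratfun_value psi x c.

End Maps.

Section Automorphisms.
Variable N : nat.
Local Notation P := (pspace K N).
Implicit Types (X : set P) (g : P -> P).

Definition automorphism X g : Prop :=
  regular_map X X g /\
  exists2 g' : P -> P, regular_map X X g' &
    forall x, X x -> g' (g x) = x /\ g (g' x) = x.

Definition linear_automorphism X g : Prop :=
  automorphism X g /\
  exists h : P -> P,
    [/\ automorphism setT h, h @` X = X & forall x, X x -> h x = g x].

Definition automorphism_order X g (d : nat) : Prop :=
  [/\ (0 < d)%N, forall x, X x -> iter d g x = x &
      forall k, (0 < k < d)%N -> ~ (forall x, X x -> iter k g x = x)].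

Definition Fix X g : set P := [set x | X x /\ g x = x].

(* psi = phi o g *)
Definition induced_action X g : ratfun X -> ratfun X -> Prop :=
  is_pullback (fun x y => y = g x).

End Automorphisms.

(* k is a subset of E, in use a subfield, to be identified with a fieldType. *)
Section GaloisExtensions.
Variables (E : comNzRingType) (k : set E).

(* phi identifies the extension E/k with L/k0. *)
Definition galois_model (k0 : fieldType) (L : splittingFieldType k0)
    (phi : {rmorphism L -> E}) : Prop :=
  [/\ bijective phi, k = [set phi a%:A | a in [set: k0]] &
      galois 1%AS {:L}%AS].

Definition galois_extension : Prop :=
  exists (k0 : fieldType) (L : splittingFieldType k0)
    (phi : {rmorphism L -> E}), galois_model phi.

(* E/k is Galois, and its Galois group is generated by the automorphism of E
   whose graph is sigma. *)
Definition generates_galois_group (sigma : E -> E -> Prop) : Prop :=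
  exists (k0 : fieldType) (L : splittingFieldType k0)
    (phi : {rmorphism L -> E}) (s : gal_of {:L}%AS),
    [/\ galois_model phi, forall u, sigma (phi u) (phi (s u)) &
        generator 'Gal({:L}%AS / 1%AS) s].

End GaloisExtensions.

Section GaloisPoints.
Variable n : nat.
Local Notation P := (pspace K n.+1).
Implicit Types (X : set P) (p : P).

Definition hyperplane (H : set P) : Prop :=
  exists U : {vspace 'rV[K]_n.+2},
    \dim U = n.+1 /\ H = [set x | (line x <= U)%VS].

(* The graph of the projection with center p onto H: y is the intersection of
   H with the projective line through p and x. *)
Definition projection p (H : set P) (x y : P) : Prop :=
  [/\ x != p, H y & (line y <= line p + line x)%VS].

(* The subfield K_p of the function field of X. *)
Definition pulled_back_field X p (H : set P) : set (ratfun X) :=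
  [set psi | exists phi : ratfun H, is_pullback (projection p H) phi psi].

Definition galois_point X p : Prop :=
  exists H, [/\ hyperplane H, ~ H p &
                galois_extension (@pulled_back_field X p H)].

Definition outer_galois_point X p : Prop := galois_point X p /\ ~ X p.

Definition belongs_to_galois_point X (g : P -> P) p : Prop :=
  exists H, [/\ hyperplane H, ~ H p &
    generates_galois_group (@pulled_back_field X p H) (@induced_action _ X g)].

End GaloisPoints.

End Geometry.

(* Main.v *)
Require Import Defs.
From HB Require Import structures.
From mathcomp Require Import all_boot all_order all_algebra all_fingroup all_solvable all_field.
From mathcomp Require Import boolp classical_sets reals complex.
From mathcomp Require Import mpoly.
From mathcomp Require Import ring zify.

(* The lift M of g to coordinates satisfies F(vM) = mu F(v) and M ^ d scalar, so
   it is diagonalizable, and Fix(g) is the union of the linear sections of X by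
   its eigenspaces. A component of codimension 1 lies in P(W) for an eigenspace
   W of codimension at most 2. Codimension 2 would mean P(W) in X, and the
   equivariance of F would then make X singular; so M is a multiple of a homology,
   of center p and of ratio om, a primitive d-th root of unity. The center is not
   on X: otherwise the equivariance would make X singular or reducible. In coordinates
   with p = (1 : 0 : ... : 0), F is then a x_0 ^ d + G(x_1, ..., x_(n+1)), and the
   function field of X is the Kummer extension of K_p generated by x_0 / x_j,
   which g multiplies by om.
   Conversely, an automorphism g belonging to p fixes K_p, hence preserves the
   lines through p meeting X. The condition that vM and v are aligned with p is
   given by the vanishing of quadratic forms; as d > 2, it holds on the whole
   space, so M is a multiple of a homology with center p, and Fix(g) contains the
   section of X by its axis. *)

Set Implicit Arguments.
Unset Strict Implicit.
Unset Printing Implicit Defensive.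
Import GRing.Theory.
Local Open Scope classical_set_scope.
Local Open Scope ring_scope.

(** * Unique factorization of polynomials *)

(** Codimension is defined by chains of irreducible closed sets, and no dimension theory is used. A
    fixed locus of codimension 1 enters through one irreducible [Z] inside it from which no chain of
    length 2 leads into X; a component of a hyperplane section, placed strictly between [Z] and X,
    would be such a chain. The opposite estimate, that no such chain starts at a component of the
    section by the axis, comes from the norm along the projection from [p]: it turns a form
    vanishing on the middle term of a chain into a cone with vertex [p]. All passages from zeros to
    divisibility concern one prime form, so the Nullstellensatz is needed for hypersurfaces only,
    where it follows from Gauss's lemma and Bezout; hence the unique factorization. Smoothness makes
    F prime, since two factors would share a zero, and it makes the differential of F nonzero at
    every eigenvector on X, while equivariance lets it be nonzero on one eigenspace only.
    Characteristic 0 enters through the invertibility of d: T^d - c is then separable and M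
    diagonalizable, which excludes elations. *)

Section Divisibility.
Variable R : idomainType.
Implicit Types a b c p q : R.

Definition rdvd a b := exists c, b = c * a.

Definition irreducible_elt p :=
  [/\ p != 0, p \isn't a GRing.unit &
      forall a b, p = a * b -> a \is a GRing.unit \/ b \is a GRing.unit].

Definition prime_elt p :=
  [/\ p != 0, p \isn't a GRing.unit &
      forall a b, rdvd p (a * b) -> rdvd p a \/ rdvd p b].

Definition prime_factorization a :=
  exists u s, [/\ u \is a GRing.unit, forall q, q \in s -> prime_elt q &
                  a = u * \prod_(q <- s) q].

Lemma rdvd_refl a : rdvd a a.
Proof. by exists 1; rewrite mul1r. Qed.

Lemma rdvd_mull a b c : rdvd a c -> rdvd a (b * c).
Proof. by move=> [x ->]; exists (b * x); rewrite mulrA. Qed.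

Lemma rdvd_mulr a b c : rdvd a b -> rdvd a (b * c).
Proof. by rewrite mulrC; apply: rdvd_mull. Qed.

Lemma prime_elt_irreducible p : prime_elt p -> irreducible_elt p.
Proof.
move=> [p0 pU pP]; split=> // a b pE.
have [] : rdvd p a \/ rdvd p b by apply: pP; rewrite -pE; apply: rdvd_refl.
- move=> [c aE]; right; apply/unitrPr; exists c.
  apply: (mulfI p0); rewrite mulr1 [in RHS]pE aE.
  by ring.
- move=> [c bE]; left; apply/unitrPr; exists c.
  apply: (mulIf p0); rewrite mul1r -mulrA -bE -pE //.
Qed.

Lemma prime_dvd_prod p (s : seq R) :
  prime_elt p -> rdvd p (\prod_(q <- s) q) -> exists2 q, q \in s & rdvd p q.
Proof.
move=> [p0 pU pP]; elim: s => [|q s IH].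
  rewrite big_nil => -[c /esym/eqP cE]; case/negP: pU.
  by apply/unitrPr; exists c; rewrite mulrC; apply/eqP.
rewrite big_cons => /pP[pq|/IH[q' q's pq']].
  by exists q => //; rewrite mem_head.
by exists q' => //; rewrite in_cons q's orbT.
Qed.

Lemma irreducible_prime_factorization p :
  irreducible_elt p -> prime_factorization p -> prime_elt p.
Proof.
move=> [p0 pU pI] [u [[|q s] [uU sP pE]]].
  by move: pU; rewrite pE big_nil mulr1 uU.
have [q0 qU qP] := sP q (mem_head _ _).
move: pE; rewrite big_cons mulrCA => pE.
have [qU'|] := pI _ _ pE; first by rewrite qU' in qU.
move: (u * _) pE => v pE vU; split=> // a b [c abE].
have : rdvd q (a * b) by exists (c * v); rewrite abE pE; ring.
have qp d : rdvd q d -> rdvd p d.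
  by move=> [e ->]; exists (e * v^-1); rewrite pE [q * _]mulrC mulrA mulrVK.
by move=> /qP[] /qp; [left|right].
Qed.

End Divisibility.

Section GaussLemma.
Variable R : idomainType.
Implicit Types (p q f g : {poly R}) (c : R).

Lemma rdvd_polyC c p : rdvd c%:P p <-> forall i, rdvd c p`_i.
Proof.
split=> [[q ->] i|]; first by exists q`_i; rewrite coefMC.
move=> /choice[h hE]; exists (\poly_(i < size p) h i).
apply/polyP => i; rewrite coefMC coef_poly.
by case: ltnP => [_|/leq_sizeP->//]; rewrite -?hE // mul0r.
Qed.

Lemma rdvd_polyC_mulX c p : rdvd c%:P (p * 'X) -> rdvd c%:P p.
Proof. by move=> /rdvd_polyC H; apply/rdvd_polyC => i; have:= H i.+1; rewrite coefMX. Qed.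

(** Gauss's lemma for contents, by induction on both factors: [c] divides one of the two constant
    coefficients, and removing that coefficient leaves a product divisible by X, from which X is
    cancelled. *)
Lemma prime_polyC c : prime_elt c -> prime_elt c%:P.
Proof.
move=> [c0 cU cP]; split; rewrite ?polyC_eq0 // ?poly_unitE.
  by rewrite coefC /= (negPf cU) andbF.
move=> p q; elim/poly_ind: p q => [|p a IHp] q.
  by move=> _; left; exists 0; rewrite mul0r.
elim/poly_ind: q => [|q b IHq] H.
  by right; exists 0; rewrite mul0r.
have /cP[ca|cb] : rdvd c (a * b).
  have /rdvd_polyC/(_ 0%N) := H.
  by rewrite coef0M !coefD !coefMX !coefC /= !add0r.
- have {}ca : rdvd c%:P a%:P by case: ca => e ->; exists e%:P; rewrite polyCM.
  have : rdvd c%:P (p * (q * 'X + b%:P)).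
    apply: rdvd_polyC_mulX; case: H ca => e eE [e' e'E].
    exists (e - e' * (q * 'X + b%:P)).
    by rewrite mulrBl -eE mulrDl mulrAC [e' * _ * _]mulrAC -e'E [p * 'X * _]mulrAC addrK.
  move=> /IHp[[x ->]|]; last by right.
  by left; case: ca => e ->; exists (x * 'X + e); rewrite mulrDl mulrAC.
- have {}ca : rdvd c%:P b%:P by case: cb => e ->; exists e%:P; rewrite polyCM.
  have : rdvd c%:P ((p * 'X + a%:P) * q).
    apply: rdvd_polyC_mulX; case: H ca => e eE [e' e'E].
    exists (e - e' * (p * 'X + a%:P)).
    by rewrite mulrBl -eE [e' * _ * _]mulrAC -e'E [in RHS]mulrDr mulrA [b%:P * _]mulrC addrK.
  move=> /IHq[|[x ->]]; first by left.
  by right; case: ca => e ->; exists (x * 'X + e); rewrite mulrDl mulrAC.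
Qed.

Hypothesis factorial : forall c, c != 0 -> prime_factorization c.

Lemma unit_scale c : c \is a GRing.unit -> c%:P \is a GRing.unit.
Proof.
by move=> cU; apply/unitrPr; exists c^-1%:P; rewrite -polyCM divrr.
Qed.

(** A prime factor of [c] stays prime as a constant polynomial, so it divides [p] or [q] and can be
    cancelled there; the factors of [c] disappear one at a time. *)
Lemma clear_denominator c f p q : c != 0 -> c *: f = p * q ->
  exists p' q', [/\ f = p' * q', size p' = size p & size q' = size q].
Proof.
move=> /factorial [u [s [uU sP ->]]].
have szD e g : e != 0 -> size (g * e%:P) = size g.
  by move=> e0; rewrite mulrC mul_polyC size_scale.
elim: s sP p q => [|e s IH] sP p q.
  rewrite big_nil mulr1 => E; exists (u^-1 *: p), q; split=> //.
    by rewrite -scalerAl -E scalerA mulVr // scale1r.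
  by rewrite size_scale // invr_eq0; apply: contraTneq uU => ->; rewrite unitr0.
have {}IH := IH (fun x xs => sP x (@mem_behead _ (e :: s) x xs)).
have pe := sP e (mem_head _ _); have e0 : e != 0 by case: pe.
have [_ _ eP] := prime_polyC pe.
rewrite big_cons mulrCA -scalerA => E.
have : rdvd e%:P (p * q) by eexists; rewrite -E -mul_polyC mulrC.
have inj x y : e *: x = y * e%:P -> x = y.
  by rewrite [y * _]mulrC -mul_polyC; apply: mulfI; rewrite polyC_eq0.
move=> /eP[] [x xE]; [rewrite xE mulrAC in E|rewrite xE mulrA in E];
  move: (IH _ _ (inj _ _ E)) => [p' [q' [-> s1 s2]]]; exists p', q'; split=> //.
  by rewrite xE szD.
by rewrite xE szD.
Qed.

(** The relation [%|] allows a nonzero constant multiplier on [g]. A prime factor of this constant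
    divides the quotient, since it cannot divide [f], which is irreducible of positive degree. *)
Lemma rdvd_of_dvdp f g : irreducible_elt f -> (1 < size f)%N -> (f %| g)%R -> rdvd f g.
Proof.
move=> [f0 fU fI] sf /Pdiv.Idomain.dvdpP[[c p] /= c0 E].
have [u [s [uU sP cE]]] := factorial c0; rewrite {c c0}cE in E.
elim: s sP p E => [|e s IH] sP p.
  rewrite big_nil mulr1 => E; exists (u^-1 *: p).
  by rewrite -scalerAl -E scalerA mulVr // scale1r.
have {}IH := IH (fun x xs => sP x (@mem_behead _ (e :: s) x xs)).
have pe := sP e (mem_head _ _); have [e0 eU _] := pe.
have [_ ePU eP] := prime_polyC pe.
rewrite big_cons mulrCA -scalerA => E.
have : rdvd e%:P (p * f) by eexists; rewrite -E -mul_polyC mulrC.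
move=> /eP[] [x xE].
  have eP0 : e%:P != 0 by rewrite polyC_eq0.
  by apply: (IH x); apply: (mulfI eP0); rewrite mul_polyC E xE; ring.
have [xU|eU'] := fI _ _ xE; last by rewrite eU' in ePU.
move: sf; rewrite xE mulrC mul_polyC size_scale //.
by move: xU; rewrite poly_unitE => /andP[/eqP->].
Qed.

Lemma unit_size_poly f : f \is a GRing.unit -> size f = 1%N.
Proof. by rewrite poly_unitE => /andP[/eqP]. Qed.

(** The gcd divides [f] up to a constant; [clear_denominator] turns this into a genuine
    factorization of [f], one factor of which is a unit. *)
Lemma irreducible_dvdp_or_coprimep f g :
  irreducible_elt f -> (1 < size f)%N -> rdvd f g \/ coprimep f g.
Proof.
move=> If sf; have [f0 fU fI] := If.
have [[c q] /= c0 E] := Pdiv.Idomain.dvdpP _ _ (dvdp_gcdl f g).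
have [q' [g' [E' sq' sg']]] := clear_denominator c0 E.
have [] := fI _ _ E' => /unit_size_poly s1; last first.
  by right; rewrite coprimep_def -sg' s1.
left; apply: rdvd_of_dvdp => //.
have q0 : size q == 1%N by rewrite -sq' s1.
apply: dvdp_trans (dvdp_gcdr f g).
move/size_poly1P : q0 => [a a0 qE]; move: E; rewrite qE mul_polyC => E.
apply: (@Pdiv.Idomain.eq_dvdp _ a c%:P); first by [].
by rewrite -E -mul_polyC.
Qed.

Lemma irreducible_poly_prime f : irreducible_elt f -> prime_elt f.
Proof.
move=> If; have [f0 fU fI] := If.
have [sf|sf] := leqP (size f) 1%N.
  move: (size1_polyC sf) => fE.
  rewrite fE; apply: prime_polyC; apply: irreducible_prime_factorization; last first.
    by apply: factorial; rewrite -polyC_eq0 -fE.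
  split; first by rewrite -polyC_eq0 -fE.
    by apply: contra fU => /unit_scale; rewrite -fE.
  move=> a b abE; have := fI a%:P b%:P; rewrite -polyCM -abE => /(_ fE).
  by rewrite !poly_unitE !coefC /= => -[] /andP[_]; [left|right].
split=> // a b [c E].
have [|cop] := irreducible_dvdp_or_coprimep a If sf; first by left.
right; apply: rdvd_of_dvdp => //.
by rewrite -(Gauss_dvdpr b cop) E dvdp_mull.
Qed.

End GaussLemma.

Section MpolyMorphisms.
Variables (R : comNzRingType) (n : nat).

Lemma mpoly_rmorph_ext (S : nzRingType) (f g : {rmorphism {mpoly R[n]} -> S}) :
  (forall c, f c%:MP = g c%:MP) -> (forall i, f 'X_i = g 'X_i) -> f =1 g.
Proof.
move=> fgC fgX p; rewrite [p]mpolyE !rmorph_sum; apply: eq_bigr => m _.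
rewrite -mul_mpolyC !rmorphM fgC mpolyXE_id !rmorph_prod; congr (_ * _).
by apply: eq_bigr => i _; rewrite !rmorphXn fgX.
Qed.

Lemma rmorph_mmap (S T : comNzRingType) (f : {rmorphism S -> T})
    (phi : {rmorphism R -> S}) (h : 'I_n -> S) (p : {mpoly R[n]}) :
  f (mmap phi h p) = mmap (f \o phi) (f \o h) p.
Proof.
rewrite /mmap rmorph_sum; apply: eq_bigr => m _.
rewrite rmorphM /mmap1 rmorph_prod; congr (_ * _).
by apply: eq_bigr => i _; rewrite rmorphXn.
Qed.

End MpolyMorphisms.

Section UnivariateMpoly.
Variables (R : comNzRingType) (n : nat).
Local Notation widen := (widen_ord (leqnSn n)).

Lemma muniX_max : muni 'X_ord_max = 'X :> {poly {mpoly R[n]}}.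
Proof.
rewrite /muni mmapX mmap1U; case: splitP => // j /= jE.
by have := ltn_ord j; rewrite -jE ltnn.
Qed.

Lemma muniX_widen i : muni 'X_(widen i) = ('X_i)%:P :> {poly {mpoly R[n]}}.
Proof.
rewrite /muni mmapX mmap1U; case: splitP => [j jE|j] /=.
  by congr ('X__)%:P; apply/val_inj; rewrite /= -jE.
by rewrite ord1 /= addn0 => /eqP; rewrite ltn_eqF.
Qed.

(** The inverse of [muni]. Singling out the last variable carries Gauss's lemma by induction on the
    number of variables. *)
Definition mpoly_of_poly (P : {poly {mpoly R[n]}}) : {mpoly R[n.+1]} :=
  (map_poly (@mwiden _ _) P).['X_ord_max].

Lemma mwiden_muni (p : {mpoly R[n]}) : muni (mwiden p) = p%:P.
Proof.
suff /(_ p) : @muni n R \o @mwiden n R =1 polyC by [].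
apply: mpoly_rmorph_ext => [c|i] /=.
  by rewrite mwidenC muniC.
by rewrite mwidenX mnmwiden1 muniX_widen.
Qed.

Lemma mpoly_of_polyK : cancel mpoly_of_poly (@muni _ _).
Proof.
move=> P; rewrite /mpoly_of_poly -horner_map /= muniX_max -map_poly_comp /=.
rewrite (eq_map_poly (g := polyC)); last by move=> p /=; rewrite mwiden_muni.
by rewrite -[LHS]/(P \Po 'X) comp_polyXr.
Qed.

Lemma muniK : cancel (@muni n R) mpoly_of_poly.
Proof.
move=> p; rewrite /mpoly_of_poly.
suff /(_ p) :
  horner_eval 'X_ord_max \o map_poly (@mwiden n R) \o @muni n R =1 idfun by [].
apply: mpoly_rmorph_ext => [c|i] /=; rewrite /horner_eval.
  by rewrite muniC map_polyC hornerC /= mwidenC.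
case: (unliftP ord_max i) => [j|] ->.
  have -> : lift ord_max j = widen j by apply/val_inj; rewrite /= /bump leqNgt ltn_ord.
  by rewrite muniX_widen map_polyC hornerC /= mwidenX mnmwiden1.
by rewrite muniX_max map_polyX hornerX.
Qed.

Lemma meval_muni (p : {mpoly R[n.+1]}) (v : 'I_n.+1 -> R) :
  p.@[v] = (map_poly (meval (v \o widen)) (muni p)).[v ord_max].
Proof.
suff /(_ p) : meval v =1
  horner_eval (v ord_max) \o map_poly (meval (v \o widen)) \o @muni n R by [].
apply: mpoly_rmorph_ext => [c|i] /=; rewrite /horner_eval.
  by rewrite muniC map_polyC hornerC /= !mevalC.
case: (unliftP ord_max i) => [j|] ->.
  have -> : lift ord_max j = widen j by apply/val_inj; rewrite /= /bump leqNgt ltn_ord.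
  by rewrite muniX_widen map_polyC hornerC /= !mevalXU.
by rewrite muniX_max map_polyX hornerX mevalXU.
Qed.

End UnivariateMpoly.

Section MpolyFactorial.
Variable K : fieldType.

Lemma mpoly_unitP n (p : {mpoly K[n]}) :
  reflect (exists2 c, c != 0 & p = c%:MP) (p \is a GRing.unit).
Proof.
apply: (iffP idP) => [/unitrP[q [/mpoly_intro_unit/andP[/eqP pE u] _]]|[c c0 ->]].
  by exists p@_0; rewrite -?unitfE.
by rewrite rmorph_unit ?unitfE.
Qed.

Lemma mpoly_unit_msize n (p : {mpoly K[n]}) :
  (p \is a GRing.unit) = (msize p == 1%N).
Proof.
apply/mpoly_unitP/msize_poly1P => -[c c0 pE]; exists c => //.
Qed.

Lemma irreducible_factorization n (p : {mpoly K[n]}) : p != 0 ->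
  exists u s, [/\ u \is a GRing.unit, forall q, q \in s -> irreducible_elt q &
                  p = u * \prod_(q <- s) q].
Proof.
have [m] := ubnP (msize p); elim: m p => // m IH p sp p0.
have [pU|pU] := boolP (p \is a GRing.unit).
  by exists p, [::]; rewrite big_nil mulr1.
have [Ip|nIp] := pselect (irreducible_elt p).
  exists 1, [:: p]; rewrite big_seq1 mul1r unitr1; split=> // q.
  by rewrite inE => /eqP->.
have [a [b [pE aU bU]]] : exists a b, [/\ p = a * b, a \isn't a GRing.unit &
    b \isn't a GRing.unit].
  apply: contrapT => H; apply: nIp; split=> // a b pE.
  have [aU|aU] := boolP (a \is a GRing.unit); first by left.
  have [bU|bU] := boolP (b \is a GRing.unit); first by right.
  by case: H; exists a, b.
have a0 : a != 0 by apply: contraNneq p0; rewrite pE => ->; rewrite mul0r.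
have b0 : b != 0 by apply: contraNneq p0; rewrite pE => ->; rewrite mulr0.
move: aU bU; rewrite !mpoly_unit_msize => aU bU.
have a1 : (0 < msize a)%N by rewrite lt0n msize_poly_eq0.
have b1 : (0 < msize b)%N by rewrite lt0n msize_poly_eq0.
move: sp; rewrite pE msizeM // => sp.
have [] := IH a _ a0; first by move: (msize a) (msize b) a1 b1 aU bU sp; lia.
move=> u [s [uU sI aE]].
have [] := IH b _ b0; first by move: (msize a) (msize b) a1 b1 aU bU sp; lia.
move=> u' [s' [u'U s'I bE]].
exists (u * u'), (s ++ s'); rewrite unitrM uU u'U big_cat /=; split=> //.
  by move=> q; rewrite mem_cat => /orP[/sI|/s'I].
by rewrite [in LHS]aE [in LHS]bE; ring.
Qed.

Lemma unit_muni n (q : {mpoly K[n.+1]}) :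
  (muni q \is a GRing.unit) = (q \is a GRing.unit).
Proof.
apply/idP/idP => [/unitrPr[P PE]|]; last exact: rmorph_unit.
apply/unitrPr; exists (mpoly_of_poly P); apply: (can_inj (@muniK K n)).
by rewrite rmorphM /= mpoly_of_polyK PE rmorph1.
Qed.

Lemma rdvd_muni n (a b : {mpoly K[n.+1]}) : rdvd (muni a) (muni b) -> rdvd a b.
Proof.
move=> [c]; rewrite -[c]mpoly_of_polyK -muniM => /(can_inj (@muniK K n)) bE.
by exists (mpoly_of_poly c).
Qed.

Lemma irreducible_muni n (p : {mpoly K[n.+1]}) :
  irreducible_elt p -> irreducible_elt (muni p).
Proof.
have injm := can_inj (@muniK K n).
move=> [p0 pU pI]; split.
- by rewrite -(rmorph0 (@muni n K)) (inj_eq injm).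
- by rewrite unit_muni.
- move=> a b; rewrite -[a]mpoly_of_polyK -[b]mpoly_of_polyK => E.
  have {}E : p = mpoly_of_poly a * mpoly_of_poly b by apply: injm; rewrite muniM.
  by have [aU|bU] := pI _ _ E; [left|right]; rewrite unit_muni.
Qed.

Lemma irreducible_mpoly_prime n (p : {mpoly K[n]}) :
  irreducible_elt p -> prime_elt p.
Proof.
elim: n p => [|n IH] p Ip.
  have [p0 /negP pU _] := Ip; case: pU; apply/mpoly_unitP; exists p@_0.
    by apply: contraNneq p0 => p0; apply/eqP/mpolyP => m;
      rewrite mcoeff0 -p0; congr mcoeff; apply/mnmP; case.
  apply/mpolyP => m; rewrite mcoeffC.
  have -> : m = 0%MM by apply/mnmP; case.
  by rewrite eqxx mulr1.
have fact (c : {mpoly K[n]}) : c != 0 -> prime_factorization c.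
  move=> /irreducible_factorization[u [s [uU sI cE]]].
  by exists u, s; split=> // q /sI/IH.
have [p0 pU _] := Ip.
have [_ _ pP] := irreducible_poly_prime fact (irreducible_muni Ip).
split=> // a b [c E].
have : rdvd (muni p) (muni a * muni b).
  by exists (muni c); have := congr1 (@muni n K) E; rewrite !muniM.
by move=> /pP[] /rdvd_muni; [left|right].
Qed.

Lemma mpoly_prime_factorization n (p : {mpoly K[n]}) :
  p != 0 -> prime_factorization p.
Proof.
move=> /irreducible_factorization[u [s [uU sI cE]]].
by exists u, s; split=> // q /sI/irreducible_mpoly_prime.
Qed.

End MpolyFactorial.

Lemma rmorph_bezout (A B : idomainType) (h : {rmorphism A -> B}) (u w a b r : A) :
  u * a + w * b = r -> h a = 0 -> h b = 0 -> h r = 0.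
Proof. by move=> <- a0 b0; rewrite rmorphD !rmorphM a0 b0 !mulr0 addr0. Qed.

(** * Forms and their zeros *)

Section Nullstellensatz.
Variable K : closedFieldType.
Local Notation widen := (widen_ord (leqnSn _)).

Definition ord_extend n (v : 'I_n -> K) (t : K) (i : 'I_n.+1) : K :=
  if unlift ord_max i is Some j then v j else t.

Lemma meval_ord_extend n (p : {mpoly K[n.+1]}) v t :
  p.@[ord_extend v t] = (map_poly (meval v) (muni p)).[t].
Proof.
rewrite meval_muni {2}/ord_extend unlift_none; congr (_.[_]).
apply: eq_map_poly => q; apply: meval_eq => i /=; rewrite /ord_extend.
have -> : widen i = lift ord_max i by apply/val_inj; rewrite /= /bump leqNgt ltn_ord.
by rewrite liftK.
Qed.

Lemma poly_nonroot (P : {poly K}) : P != 0 -> exists t, P.[t] != 0.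
Proof. by move=> /closed_nonrootP. Qed.

Lemma mpoly_nonroot n (p : {mpoly K[n]}) : p != 0 -> exists v, p.@[v] != 0.
Proof.
elim: n p => [|n IH] p p0.
  exists (fun=> 0); apply: contraNneq p0 => p0; apply/eqP.
  have m0 (m : 'X_{1..0}) : m = 0%MM by apply/mnmP; case.
  have pE : p = (p@_0)%:MP.
    by apply/mpolyP => m; rewrite mcoeffC (m0 m) eqxx mulr1.
  by move: p0; rewrite pE mevalC => ->.
have : muni p != 0 by rewrite -(rmorph0 (@muni n K)) (inj_eq (can_inj (@muniK K n))).
rewrite -lead_coef_eq0 => /IH[v v0].
have /poly_nonroot[t t0] : map_poly (meval v) (muni p) != 0.
  by rewrite -lead_coef_eq0 lead_coef_map_eq.
by exists (ord_extend v t); rewrite meval_ord_extend.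
Qed.

Lemma mpoly_eval_eq0 n (p : {mpoly K[n]}) : (forall v, p.@[v] = 0) -> p = 0.
Proof.
by move=> p0; apply/eqP; apply: contrapT => /negP/mpoly_nonroot[v]; rewrite p0 eqxx.
Qed.

(** If [f] involves the last variable and does not divide [g], the two are coprime over the fraction
    field of the other variables, and Bezout gives a nonzero combination [r] free of the last
    variable. If [f] is free of it, the induction hypothesis applies to each coefficient of [g]. *)
Lemma nullstellensatz_prime n (f g : {mpoly K[n]}) : prime_elt f ->
  (forall v, f.@[v] = 0 -> g.@[v] = 0) -> rdvd f g.
Proof.
elim: n f g => [|n IH] f g fP fg.
  have [f0 /negP[]] := fP; apply/mpoly_unitP.
  have m0 (m : 'X_{1..0}) : m = 0%MM by apply/mnmP; case.
  have fE : f = (f@_0)%:MP.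
    by apply/mpolyP => m; rewrite mcoeffC (m0 m) eqxx mulr1.
  by exists f@_0; rewrite // -(mpolyC_eq0 0) -fE.
have If := prime_elt_irreducible fP.
have fact (c : {mpoly K[n]}) := @mpoly_prime_factorization K n c.
have IP := irreducible_muni If.
apply: rdvd_muni.
have {}fg v t : (map_poly (meval v) (muni f)).[t] = 0 ->
    (map_poly (meval v) (muni g)).[t] = 0.
  by have := fg (ord_extend v t); rewrite !meval_ord_extend.
have [sf|sf] := leqP (size (muni f)) 1%N.
  move: (size1_polyC sf) IP fg => -> Ic fg.
  have Ic' : irreducible_elt (muni f)`_0.
    have [c0 cU cI] := Ic; split.
    - by rewrite -polyC_eq0.
    - by apply: contra cU => cU; apply: rmorph_unit.
    - move=> a b abE; have := cI a%:P b%:P; rewrite -polyCM -abE => /(_ erefl).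
      by rewrite !poly_unitE !coefC /= => -[] /andP[_]; [left|right].
  apply/rdvd_polyC => i; apply: IH; first exact: irreducible_mpoly_prime.
  move=> v v0; rewrite -coef_map.
  suff -> : map_poly (meval v) (muni g) = 0 by rewrite coef0.
  apply/eqP; apply: contrapT => /negP/poly_nonroot[t]; rewrite fg ?eqxx //.
  by rewrite map_polyC hornerC.
have [//|/Bezout_coprimepP[[u w]] /=] := irreducible_dvdp_or_coprimep fact (muni g) IP sf.
rewrite -size_poly_eq1 => /size_poly1P[r r0 E].
have [f0 _ _] := IP.
(* At this [v] the combination [r] is nonzero and [muni f] keeps its degree, so it has a root [t];
   then [f], hence [g], vanishes at (v, t), and so would [r]. *)
have /mpoly_nonroot[v] : r * lead_coef (muni f) != 0.
  by rewrite mulf_neq0 // lead_coef_eq0.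
rewrite rmorphM mulf_eq0 negb_or => /andP[rv lv].
have : size (map_poly (meval v) (muni f)) != 1%N.
  by rewrite size_map_poly_id0 // neq_ltn sf orbT.
move=> /closed_rootP[t /rootP t0].
pose ev := horner_eval t \o map_poly (meval v).
have : ev r%:P = 0.
  have H := rmorph_bezout (h := ev) E.
  apply: H; first exact: t0.
  exact: fg t0.
rewrite /ev /horner_eval /comp.
rewrite map_polyC hornerC.
by move=> /eqP; rewrite (negPf rv).
Qed.

End Nullstellensatz.

Section LineExpansion.
Variables (R S : comNzRingType) (n : nat) (phi : {rmorphism R -> S}).
Implicit Types (h : 'I_n -> S) (p : 'I_n -> R) (G : {mpoly R[n]}).

(** [G] along the line through [h] in the direction [p]. The coefficients lie in a ring [S] so that
    [h] may be generic: polynomials in two parameters for common zeros, polynomials in the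
    coordinates for norms. *)
Definition line_expand h p G : {poly S} :=
  mmap (polyC \o phi) (fun i => (h i)%:P + phi (p i) *: 'X) G.

Lemma horner_line_expand h p G t :
  (line_expand h p G).[t] = mmap phi (fun i => h i + phi (p i) * t) G.
Proof.
rewrite -[LHS]/(horner_eval t _) /line_expand rmorph_mmap.
apply: eq_bigr => m _; congr (_ * _).
  by rewrite /= /horner_eval hornerC.
rewrite /mmap1; apply: eq_bigr => i _.
by rewrite /= /horner_eval hornerD hornerC hornerZ hornerX.
Qed.

(** The degree is only bounded and [c] may vanish, which makes the notion multiplicative over any
    commutative ring. *)
Definition has_top (P : {poly S}) e c := (size P <= e.+1)%N /\ P`_e = c.

Lemma has_top_mul P Q e f c c' :
  has_top P e c -> has_top Q f c' -> has_top (P * Q) (e + f) (c * c').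
Proof.
move=> [sP Pe] [sQ Qf]; split.
  by apply: leq_trans (size_polyMleq _ _) _; lia.
rewrite coefM (bigD1 (inord e)) //= inordK ?ltnS ?leq_addr // addKn Pe Qf.
rewrite big1 ?addr0 // => i iD.
have [ie|ie] := ltnP e i; first by rewrite (leq_sizeP _ _ sP) ?mul0r.
have {}ie : (i < e)%N.
  rewrite ltn_neqAle ie andbT; apply: contraNneq iD => iE.
  by apply/eqP/val_inj; rewrite /= inordK ?ltnS ?leq_addr.
by rewrite [Q`_ _](leq_sizeP _ _ sQ) ?mulr0 //; lia.
Qed.

Lemma has_top_line_expand h p G e : G \is e.-homog ->
  has_top (line_expand h p G) e (phi G.@[p]).
Proof.
move=> /dhomogP Ge; rewrite /line_expand /meval /mmap rmorph_sum.
have top1 m : has_top (mmap1 (fun i => (h i)%:P + phi (p i) *: 'X) m) (mdeg m)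
    (phi (mmap1 p m)).
  rewrite mdegE /mmap1 rmorph_prod.
  elim/big_ind3: _ => [|P1 e1 c1 P2 e2 c2|i _].
  - by split; rewrite ?size_poly1 // coef1.
  - exact: has_top_mul.
  - rewrite rmorphXn; elim: (m i) => [|k IH].
      by rewrite !expr0; split; rewrite ?size_poly1 // coef1.
    rewrite !exprS -add1n; apply: has_top_mul => //.
    split; last by rewrite coefD coefC coefZ coefX /= add0r mulr1.
    apply: leq_trans (size_polyD _ _) _; rewrite geq_max.
    rewrite (leq_trans (size_polyC_leq1 _)) //=.
    by apply: leq_trans (size_scale_leq _ _) _; rewrite size_polyX.
have : {in msupp G, forall m, mdeg m = e} by [].
elim: (msupp G) => [|m s IH] He.
  by rewrite !big_nil; split; rewrite ?size_poly0 ?coef0.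
rewrite !big_cons; have {IH}[s1 c1] : has_top (\sum_(m <- s)
   (polyC \o phi) G@_m * mmap1 (fun i => (h i)%:P + phi (p i) *: 'X) m) e
   (\sum_(m <- s) phi (idfun G@_m * mmap1 p m)).
  by apply: IH => x xs; apply: He; rewrite in_cons xs orbT.
have [s2 c2] := top1 m; rewrite He ?mem_head // in s2 c2.
have [s3 c3] : has_top ((polyC \o phi) G@_m *
    mmap1 (fun i => (h i)%:P + phi (p i) *: 'X) m) (0 + e) (phi (idfun G@_m * mmap1 p m)).
  rewrite rmorphM; apply: has_top_mul; last by [].
  by split; rewrite /= ?coefC ?size_polyC_leq1.
split; last by rewrite coefD c1 c3.
by apply: leq_trans (size_polyD _ _) _; rewrite geq_max s3.
Qed.

End LineExpansion.

Lemma map_line_expand (R S T : comNzRingType) n (phi : {rmorphism R -> S})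
    (f : {rmorphism S -> T}) h (p : 'I_n -> R) G :
  map_poly f (line_expand phi h p G) = line_expand (f \o phi) (f \o h) p G.
Proof.
rewrite /line_expand rmorph_mmap; apply: eq_bigr => m _; congr (_ * _).
  by rewrite /= map_polyC.
rewrite /mmap1; apply: eq_bigr => i _.
by rewrite /= rmorphD /= map_polyC /= map_polyZ /= map_polyX.
Qed.

Lemma mpoly_ind_ring (R : comNzRingType) n (P : {mpoly R[n]} -> Prop) :
  (forall c, P c%:MP) -> (forall i, P 'X_i) ->
  (forall p q, P p -> P q -> P (p + q)) ->
  (forall p q, P p -> P q -> P (p * q)) -> forall p, P p.
Proof.
move=> PC PX PD PM p; rewrite [p]mpolyE.
apply: (big_ind P); [by rewrite -mpolyC0 | exact: PD | move=> m _].
rewrite -mul_mpolyC; apply: (PM) => //; rewrite mpolyXE_id.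
apply: (big_ind P); [by rewrite -mpolyC1 | exact: PM | move=> i _].
by elim: (m i) => [|k IH]; rewrite ?expr0 -?mpolyC1 // exprS; apply: PM.
Qed.

Section Forms.
Variables (K : closedFieldType) (N : nat).
Local Notation vec := 'rV[K]_N.
Local Notation poly := {mpoly K[N]}.
Implicit Types (v u w : vec) (A B F G : poly) (a c t : K).

Definition ev G v : K := G.@[v 0].

Lemma evE (h : 'I_N -> K) G : G.@[h] = ev G (\row_i h i).
Proof. by apply: meval_eq => i; rewrite mxE. Qed.

Lemma evD G G' v : ev (G + G') v = ev G v + ev G' v. Proof. exact: mevalD. Qed.
Lemma evB G G' v : ev (G - G') v = ev G v - ev G' v. Proof. exact: mevalB. Qed.
Lemma evM G G' v : ev (G * G') v = ev G v * ev G' v. Proof. exact: mevalM. Qed.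
Lemma evZ a G v : ev (a *: G) v = a * ev G v. Proof. exact: mevalZ. Qed.
Lemma evC a v : ev a%:MP v = a. Proof. exact: mevalC. Qed.
Lemma ev0 v : ev 0 v = 0. Proof. exact: meval0. Qed.
Lemma ev1 v : ev 1 v = 1. Proof. exact: meval1. Qed.
Lemma evXn G k v : ev (G ^+ k) v = ev G v ^+ k. Proof. exact: rmorphXn. Qed.
Lemma ev_sum I (r : seq I) (P : pred I) (G : I -> poly) v :
  ev (\sum_(i <- r | P i) G i) v = \sum_(i <- r | P i) ev (G i) v.
Proof. exact: rmorph_sum. Qed.
Lemma ev_prod I (r : seq I) (P : pred I) (G : I -> poly) v :
  ev (\prod_(i <- r | P i) G i) v = \prod_(i <- r | P i) ev (G i) v.
Proof. exact: rmorph_prod. Qed.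

Lemma ev_eq0 G : (forall v, ev G v = 0) -> G = 0.
Proof. by move=> G0; apply: mpoly_eval_eq0 => h; rewrite evE. Qed.

Lemma ev_inj G G' : (forall v, ev G v = ev G' v) -> G = G'.
Proof. by move=> GG'; apply/eqP; rewrite -subr_eq0; apply/eqP/ev_eq0 => v; rewrite evB GG' subrr. Qed.

Lemma ev_neq0 G : G != 0 -> exists v, ev G v != 0.
Proof. by move=> /mpoly_nonroot[h]; rewrite evE; exists (\row_i h i). Qed.

Lemma nullstellensatz F G :
  prime_elt F -> (forall v, ev F v = 0 -> ev G v = 0) -> rdvd F G.
Proof.
by move=> FP FG; apply: nullstellensatz_prime => // h; rewrite !evE; apply: FG.
Qed.

Lemma horner_ext (P Q : {poly K}) : (forall t, P.[t] = Q.[t]) -> P = Q.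
Proof.
move=> PQ; apply/eqP; rewrite -subr_eq0; apply: contrapT => /negP/poly_nonroot[t].
by rewrite hornerD hornerN PQ subrr eqxx.
Qed.

Lemma ev_homog G e a v : G \is e.-homog -> ev G (a *: v) = a ^+ e * ev G v.
Proof.
move=> /dhomogP Ge; rewrite /ev !mevalE mulr_sumr [RHS]big_seq [LHS]big_seq.
apply: eq_bigr => m /Ge me; rewrite mulrCA; congr (_ * _).
under eq_bigr do rewrite mxE exprMn.
by rewrite big_split /= prodrXr; congr (_ ^+ _ * _); rewrite -[LHS]mdegE; exact: me.
Qed.

Lemma ev_homog0 G e : G \is e.-homog -> (0 < e)%N -> ev G 0 = 0.
Proof.
by move=> Ge e0; rewrite -(scale0r 0) (ev_homog _ _ Ge) expr0n gtn_eqF // mul0r.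
Qed.

(** For fixed [v], the values at [v] of the homogeneous components of [G] are the coefficients of
    the polynomial t -> G(t v), so those of degree other than [e] vanish as functions. *)
Lemma homog_ev G e : (forall a v, ev G (a *: v) = a ^+ e * ev G v) -> G \is e.-homog.
Proof.
move=> H; have GE := pihomog_partitionE (mf := mdeg) (leqnn (msize G)).
have ne0 j : j != e -> pihomog mdeg j G = 0.
  move=> je; apply: ev_eq0 => v.
  have [jG|jG] := ltnP j (msize G); last first.
    rewrite pihomogE big_seq_cond big1 ?ev0 // => m /andP[/msize_mdeg_lt mG /eqP mj].
    by move: mG; rewrite mj ltnNge jG.
  have : \poly_(i < msize G) ev (pihomog mdeg i G) v = (ev G v) *: 'X^e.
    apply: horner_ext => t; rewrite horner_poly hornerZ hornerXn mulrC -H.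
    rewrite [in RHS]GE ev_sum; apply: eq_bigr => i _.
    by rewrite (ev_homog _ _ (pihomogP _ _ _)) mulrC.
  by move=> /(congr1 (fun P : {poly K} => P`_j)); rewrite coef_poly jG coefZ coefXn (negPf je) mulr0.
rewrite GE; apply: rpred_sum => i _.
have [->|/ne0 ->] := eqVneq (i : nat) e; [exact: pihomogP | exact: rpred0].
Qed.

Lemma dhomog_prod_fam I (r : seq I) (B : I -> poly) e :
  (forall i, B i \is e.-homog) -> \prod_(i <- r) B i \is (size r * e).-homog.
Proof.
move=> Be; elim: r => [|i r IH]; first by rewrite big_nil dhomog1.
by rewrite big_cons mulSn; apply: dhomogM.
Qed.

Lemma pihomog_neq0 A : A != 0 -> exists j, pihomog mdeg j A != 0.
Proof.
move=> A0; apply: contrapT => H; move/negP: A0; apply.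
rewrite (pihomog_partitionE (mf := mdeg) (leqnn (msize A))) big1 // => i _.
by apply/eqP; apply: contrapT => /negP Ai; apply: H; exists i.
Qed.

(** Where F(v) is nonzero, A(t v) divides a monomial in t, so at most one homogeneous component of
    [A] is nonzero at [v]. Hence the product of two distinct components with [F] vanishes
    identically. *)
Lemma dhomog_factor F A B e : F != 0 -> F \is e.-homog -> F = A * B ->
  exists i, A \is i.-homog.
Proof.
move=> F0 Fe FAB.
have [j Aj0] : exists j, pihomog mdeg j A != 0.
  by apply: pihomog_neq0; apply: contraNneq F0; rewrite FAB => ->; rewrite mul0r.
suff Ai i : i != j -> pihomog mdeg i A = 0.
  exists j; rewrite (pihomog_partitionE (mf := mdeg) (leqnn (msize A))).
  apply: rpred_sum => i _.
  have [->|/Ai ->] := eqVneq (i : nat) j; [exact: pihomogP | exact: rpred0].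
move=> ij; apply/eqP.
suff : pihomog mdeg i A * pihomog mdeg j A * F == 0.
  by rewrite !mulf_eq0 (negPf Aj0) (negPf F0) !orbF.
apply/eqP/ev_eq0 => v; rewrite !evM.
have [->|Fv] := eqVneq (ev F v) 0; first by rewrite mulr0.
pose L G := \poly_(k < msize G) ev (pihomog mdeg k G) v.
have LE G t : (L G).[t] = ev G (t *: v).
  rewrite horner_poly [in RHS](pihomog_partitionE (mf := mdeg) (leqnn (msize G))) ev_sum.
  by apply: eq_bigr => k _; rewrite (ev_homog _ _ (pihomogP _ _ _)) mulrC.
have LC G k : (L G)`_k = ev (pihomog mdeg k G) v.
  rewrite coef_poly; case: ltnP => // Gk.
  rewrite pihomogE big_seq_cond big1 ?ev0 // => m /andP[/msize_mdeg_lt mG /eqP mk].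
  by move: mG; rewrite mk ltnNge Gk.
have : L A %| 'X^e.
  apply/dvdpP; exists ((ev F v)^-1 *: L B); apply: horner_ext => t.
  rewrite hornerXn -scalerAl hornerZ hornerM !LE [ev B _ * _]mulrC -evM -FAB.
  by rewrite (ev_homog _ _ Fe) mulrCA mulVf // mulr1.
rewrite -['X]subr0 -polyC0 => /dvdp_exp_XsubCP[k _].
rewrite polyC0 subr0 => /eqpP[[c c'] /= /andP[c0 c'0] E].
have LAE l : l != k -> (L A)`_l = 0.
  move=> lk; have := congr1 (fun P : {poly K} => P`_l) E.
  by rewrite !coefZ coefXn (negPf lk) mulr0 => /eqP; rewrite mulf_eq0 (negPf c0) => /eqP.
rewrite -!LC; have [ik|/LAE->] := eqVneq i k; last by rewrite !mul0r.
by rewrite [(L A)`_j]LAE ?mulr0 ?mul0r // -ik eq_sym.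
Qed.

Definition lpoly G v u : {poly K} := line_expand idfun (v 0) (u 0) G.

Lemma lpolyE G v u t : (lpoly G v u).[t] = ev G (v + t *: u).
Proof.
rewrite horner_line_expand /ev; apply: meval_eq => i.
by rewrite !mxE mulrC.
Qed.

Lemma form_root G e v u : G \is e.-homog -> (0 < e)%N -> ev G u != 0 ->
  exists t, ev G (v + t *: u) = 0.
Proof.
move=> Ge e0 Gu; have [s1 c1] := has_top_line_expand idfun (v 0) (u 0) Ge.
have : size (lpoly G v u) != 1%N.
  apply: contraNneq Gu => s0; rewrite -[ev G u]c1; apply/eqP/nth_default.
  by rewrite -/(lpoly G v u) s0.
by move=> /closed_rootP[t /rootP]; rewrite lpolyE; exists t.
Qed.

Definition dirder u G : poly := \sum_i u 0 i *: G^`M(i).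

Lemma ev_dirder u G v : ev (dirder u G) v = \sum_i u 0 i * ev G^`M(i) v.
Proof. by rewrite ev_sum; apply: eq_bigr => i _; rewrite evZ. Qed.

Lemma ev_dirder_mul u A B v :
  ev (dirder u (A * B)) v = ev (dirder u A) v * ev B v + ev A v * ev (dirder u B) v.
Proof.
rewrite !ev_dirder mulr_suml mulr_sumr -big_split /=; apply: eq_bigr => i _.
by rewrite mderivM evD !evM; ring.
Qed.

Lemma deriv_lpoly G v u t : ((lpoly G v u)^`()).[t] = ev (dirder u G) (v + t *: u).
Proof.
elim/mpoly_ind_ring: G => [c|i|A B IHA IHB|A B IHA IHB].
- have -> : lpoly c%:MP v u = c%:P by apply: horner_ext => s; rewrite lpolyE evC hornerC.
  rewrite derivC horner0 ev_dirder big1 // => i _.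
  by rewrite mderivC ev0 mulr0.
- have -> : lpoly 'X_i v u = (v 0 i)%:P + (u 0 i) *: 'X.
    by apply: horner_ext => s; rewrite lpolyE /ev mevalXU !mxE hornerD hornerC hornerZ hornerX mulrC.
  rewrite derivD derivC derivZ derivX add0r alg_polyC hornerC ev_dirder.
  rewrite (bigD1 i) //= big1 ?addr0 => [|j ji]; rewrite mderivX mnm1E.
    rewrite eqxx /= evZ mul1r (_ : U_(i) - U_(i) = 0)%MM ?mpolyX0 ?ev1 ?mulr1 //.
    by apply/mnmP => k; rewrite mnmBE subnn mnm0E.
  by rewrite eq_sym (negPf ji) /= scale0r ev0 mulr0.
- have -> : lpoly (A + B) v u = lpoly A v u + lpoly B v u.
    by apply: horner_ext => s; rewrite hornerD !lpolyE evD.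
  rewrite derivD hornerD IHA IHB !ev_dirder -big_split /=; apply: eq_bigr => i _.
  by rewrite mderivD evD mulrDr.
- have -> : lpoly (A * B) v u = lpoly A v u * lpoly B v u.
    by apply: horner_ext => s; rewrite hornerM !lpolyE evM.
  by rewrite derivM hornerD !hornerM IHA IHB !lpolyE ev_dirder_mul.
Qed.

Lemma dirder_ev G v u : ev (dirder u G) v = ((lpoly G v u)^`()).[0].
Proof. by rewrite deriv_lpoly scale0r addr0. Qed.

Lemma dirder_homog G e u : G \is e.-homog -> dirder u G \is e.-1.-homog.
Proof.
move=> Ge; apply: rpred_sum => i _; apply: rpredZ; apply/dhomogP => m.
rewrite mcoeff_msupp mcoeff_mderiv => m0; have : (m + U_(i))%MM \in msupp G.
  by rewrite mcoeff_msupp; apply: contraNneq m0 => ->; rewrite mul0rn.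
move=> /(dhomog_mf Ge) E; have : mdeg (m + U_(i))%MM = e := E.
by rewrite mdegD mdeg1 addn1 => <-.
Qed.

End Forms.

Section Substitution.
Variable K : closedFieldType.

Definition msub m n (M : 'M[K]_(m, n)) (G : {mpoly K[n]}) : {mpoly K[m]} :=
  G \mPo [tuple \sum_j M j i *: 'X_j | i < n].

Lemma ev_msub m n (M : 'M[K]_(m, n)) G v : ev (msub M G) v = ev G (v *m M).
Proof.
rewrite /ev /msub comp_mpoly_meval; apply: meval_eq => i.
rewrite tnth_mktuple rmorph_sum mxE; apply: eq_bigr => j _.
by rewrite /= mevalZ mevalXU mulrC.
Qed.

Lemma msub_homog m n (M : 'M[K]_(m, n)) G e : G \is e.-homog -> msub M G \is e.-homog.
Proof.
by move=> Ge; apply: homog_ev => c v; rewrite !ev_msub -scalemxAl (ev_homog _ _ Ge).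
Qed.

End Substitution.

(** * Common zeros of two forms, by elimination *)

Section CommonZeros.
Variable K : closedFieldType.

(** A plane curve through the origin has another point. Otherwise [r] has no zero with x nonzero, so
    it is constant in y (the outer variable) for these x, hence free of y, and the point (0, 1) is
    on the curve. *)
Lemma plane_curve_zero (r : {poly {poly K}}) : r.[0].[0] = 0 ->
  exists x y : K, ((x != 0) || (y != 0)) /\ r.[y%:P].[x] = 0.
Proof.
move=> r0; apply: contrapT => H.
have rx x : x != 0 -> (size (map_poly (horner_eval x) r) <= 1)%N.
  move=> x0; rewrite leqNgt; apply/negP => s1; apply: H.
  have : size (map_poly (horner_eval x) r) != 1%N by rewrite gtn_eqF.
  move=> /closed_rootP[y /rootP ry]; exists x, y; rewrite x0; split=> //.
  by rewrite -ry -[y in RHS](hornerC y x) -[_.[x]]/(horner_eval x _) -horner_map.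
have rj j : (0 < j)%N -> r`_j = 0.
  move=> j0; have : r`_j * 'X = 0.
    apply: horner_ext => x; rewrite hornerM hornerX horner0.
    have [->|/rx/leq_sizeP/(_ j j0)] := eqVneq x 0; first by rewrite mulr0.
    by rewrite coef_map /= /horner_eval => ->; rewrite mul0r.
  by move=> /eqP; rewrite mulf_eq0 polyX_eq0 orbF => /eqP.
have rE : r = (r`_0)%:P by apply/size1_polyC/leq_sizeP.
apply: H; exists 0, 1; rewrite oner_eq0 orbT; split=> //.
by move: r0; rewrite rE !hornerC.
Qed.

(** Elimination from a point [p] outside both hypersurfaces. The resultant of A and B along the
    lines of direction [p] through the plane of the basis vectors [i] and [j] is a polynomial in x
    and y. It vanishes at the origin, where both restrictions are multiples of powers of the
    parameter; any other zero gives the common point. *)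
Lemma common_zero N (A B : {mpoly K[N]}) d e : (2 < N)%N ->
  A \is d.-homog -> B \is e.-homog -> (0 < d)%N -> (0 < e)%N -> A * B != 0 ->
  exists v, [/\ v != 0, ev A v = 0 & ev B v = 0].
Proof.
move=> N2 Ad Be d0 e0 /ev_neq0[p]; rewrite evM mulf_eq0 negb_or => /andP[Ap Bp].
have [k pk] : exists k, p 0 k != 0.
  by apply/rV0Pn; apply: contraNneq Ap => ->; rewrite (ev_homog0 Ad).
have [i [j [ik jk ij]]] : exists i j : 'I_N, [/\ i != k, j != k & i != j].
  have /card_gt1P[i [j [ik jk ij]]] : (1 < #|predC1 k|)%N by rewrite cardC1 card_ord; lia.
  by exists i, j; split.
pose phi := @polyC {poly K} \o @polyC K.
pose h l : {poly {poly K}} := ((l == i)%:R *: 'X)%:P + ((l == j)%:R : {poly K}) *: 'X.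
pose L G := line_expand phi h (p 0) G.
pose f x y := horner_eval x \o map_poly (horner_eval y) : {poly {poly K}} -> K.
pose w x y : 'rV[K]_N := \row_l (x * (l == i)%:R + y * (l == j)%:R).
have fphi x y c : horner_eval x (horner_eval y%:P (phi c)) = c.
  by rewrite /horner_eval /phi /= !hornerC.
have Lmap G x y : map_poly (horner_eval x \o horner_eval y%:P) (L G) = lpoly G (w x y) p.
  rewrite map_line_expand /lpoly; apply: horner_ext => t; rewrite !horner_line_expand.
  rewrite /mmap; apply: eq_bigr => m _; rewrite /= fphi; congr (_ * _).
  rewrite /mmap1; apply: eq_bigr => l _; congr (_ ^+ _).
  rewrite /= fphi mxE /h /horner_eval; congr (_ + _).
  rewrite hornerD hornerC hornerZ hornerX hornerD hornerZ hornerX hornerM hornerC.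
  by rewrite mulrC; congr (_ + _); rewrite mulrC; case: (l == j); rewrite ?hornerC ?horner0.
pose r := resultant (L A) (L B).
have Ltop G l : G \is l.-homog -> ev G p != 0 -> lead_coef (L G) = phi (ev G p).
  move=> Gl Gp; have [s c] := has_top_line_expand phi h (p 0) Gl.
  have Gp' : phi (ev G p) != 0 by rewrite /phi /= !polyC_eq0.
  rewrite lead_coefE (_ : size (L G) = l.+1) //; apply/eqP; rewrite eqn_leq s ltnNge.
  by apply: contraNN Gp' => sl; rewrite -[phi _]c; apply/eqP/nth_default.
(* Specialization commutes with the resultant because the leading coefficients are the nonzero
   constants A(p) and B(p). *)
have rE x y : r.[y%:P].[x] = resultant (lpoly A (w x y) p) (lpoly B (w x y) p).
  pose F := horner_eval x \o horner_eval y%:P.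
  rewrite -!Lmap -(map_resultant (f := F)) //.
  - by rewrite (Ltop _ _ Ad Ap) /F /= fphi.
  - by rewrite (Ltop _ _ Be Bp) /F /= fphi.
have lp0 G l : G \is l.-homog -> lpoly G (w 0 0) p = ev G p *: 'X^l.
  move=> Gl; apply: horner_ext => t; rewrite lpolyE hornerZ hornerXn mulrC -(ev_homog _ _ Gl).
  by congr ev; apply/rowP => l'; rewrite !mxE !mul0r !add0r.
have lpt x y : r.[y%:P].[x] = 0 -> exists t, ev A (w x y + t *: p) = 0 /\ ev B (w x y + t *: p) = 0.
  rewrite rE => /eqP; rewrite resultant_eq0 => s1.
  have : size (gcdp (lpoly A (w x y) p) (lpoly B (w x y) p)) != 1%N by rewrite gtn_eqF.
  move=> /closed_rootP[t]; rewrite root_gcd => /andP[/rootP tA /rootP tB].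
  by exists t; rewrite -!lpolyE.
have [|x [y [xy /lpt[t [tA tB]]]]] := @plane_curve_zero r.
  have -> : r.[0].[0] = r.[0%:P].[0] by rewrite polyC0.
  rewrite rE (lp0 _ _ Ad) (lp0 _ _ Be); apply/eqP; rewrite resultant_eq0.
  have Xd : 'X %| gcdp (ev A p *: 'X^d) (ev B p *: 'X^e).
    by rewrite dvdp_gcd !dvdpZr // -['X]expr1 !dvdp_exp2l.
  apply: leq_trans (dvdp_leq _ Xd); first by rewrite size_polyX.
  by rewrite gcdp_eq0 !scaler_eq0 (negPf Ap) -size_poly_eq0 size_polyXn.
(* The coordinate [k] of this vector is t p_k with p_k nonzero, so if the vector is 0 then t = 0,
   and next x = y = 0. *)
exists (w x y + t *: p); split=> //; apply: contraTneq xy => /rowP E.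
have t0 : t = 0.
  have := E k; rewrite !mxE [k == i]eq_sym [k == j]eq_sym (negPf ik) (negPf jk) !mulr0 !add0r.
  by move=> /eqP; rewrite mulf_eq0 (negPf pk) orbF => /eqP.
have := E i; rewrite !mxE t0 mul0r eqxx (negPf ij) mulr0 !addr0 mulr1 => ->.
have := E j; rewrite !mxE t0 mul0r eqxx eq_sym (negPf ij) mulr0 !addr0 add0r mulr1 => ->.
by rewrite eqxx.
Qed.

End CommonZeros.

(** * Hypersurfaces of a projective space *)

Section Points.
Variables (K : closedFieldType) (N : nat).
Local Notation P := (pspace K N).
Local Notation vec := 'rV[K]_N.+1.
Local Notation poly := {mpoly K[N.+1]}.
Implicit Types (x y : P) (v u : vec) (A B F G : poly).

Definition rep x : vec := vpick (line x).

Lemma dim_line x : \dim (line x) = 1%N.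
Proof. by case: x => l /= /eqP. Qed.

Lemma rep_neq0 x : rep x != 0.
Proof. by rewrite vpick0 -dimv_eq0 dim_line. Qed.

Lemma line_rep x : line x = <[rep x]>%VS.
Proof.
apply/eqP; rewrite eq_sym eqEdim dim_line dim_vline rep_neq0 andbT.
exact: memv_pick.
Qed.

Lemma ev_hcoord G x : G.@[hcoord x] = ev G (rep x).
Proof. by []. Qed.

Lemma point_default_subproof : \dim <[const_mx 1 : vec]> == 1%N.
Proof.
rewrite dim_vline; suff -> : const_mx 1 != 0 :> vec by [].
by apply/rV0Pn; exists 0; rewrite mxE oner_eq0.
Qed.

(* At v = 0 this is a junk point. *)
Definition pt v : P := insubd (PSpace point_default_subproof) <[v]>%VS.

Lemma line_pt v : v != 0 -> line (pt v) = <[v]>%VS.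
Proof. by move=> v0; rewrite [LHS]insubdK // unfold_in dim_vline v0. Qed.

Lemma line_inj x y : line x = line y -> x = y.
Proof. exact: val_inj. Qed.

Lemma pt_rep x : pt (rep x) = x.
Proof. by apply: line_inj; rewrite line_pt ?rep_neq0 // -line_rep. Qed.

Lemma rep_pt v : v != 0 -> exists2 c, c != 0 & rep (pt v) = c *: v.
Proof.
move=> v0; have : rep (pt v) \in <[v]>%VS by rewrite -line_pt // memv_pick.
move=> /vlineP[c E]; exists c => //; apply: contraNneq (rep_neq0 (pt v)) => c0.
by rewrite E c0 scale0r.
Qed.

Lemma pt_scale c v : c != 0 -> pt (c *: v) = pt v.
Proof.
move=> c0; have [->|v0] := eqVneq v 0; first by rewrite scaler0.
apply: line_inj; rewrite !line_pt ?scaler_eq0 ?negb_or ?c0 //.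
apply/eqP; rewrite eqEdim !dim_vline scaler_eq0 negb_or c0 v0 /= andbT.
by rewrite -memvE memvZ // memv_line.
Qed.

Lemma pt_eq v u : v != 0 -> u != 0 -> pt v = pt u -> exists2 c, c != 0 & v = c *: u.
Proof.
move=> v0 u0 E; have : v \in <[u]>%VS by rewrite -line_pt // -E line_pt // memv_line.
move=> /vlineP[c vE]; exists c => //; apply: contraNneq v0 => c0.
by rewrite vE c0 scale0r.
Qed.

Lemma line_eq_pt x v : v != 0 -> line x = <[v]>%VS -> x = pt v.
Proof. by move=> v0 E; apply: line_inj; rewrite line_pt. Qed.

Lemma ev_rep_pt G e v : G \is e.-homog -> v != 0 ->
  (ev G (rep (pt v)) == 0) = (ev G v == 0).
Proof.
move=> Ge v0; have [c c0 ->] := rep_pt v0.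
by rewrite (ev_homog _ _ Ge) mulf_eq0 expf_eq0 (negPf c0) andbF.
Qed.

Lemma ratio_rep_pt A B e v : A \is e.-homog -> B \is e.-homog -> v != 0 ->
  ev A (rep (pt v)) / ev B (rep (pt v)) = ev A v / ev B v.
Proof.
move=> Ae Be v0; have [c c0 ->] := rep_pt v0.
by rewrite (ev_homog _ _ Ae) (ev_homog _ _ Be) -mulf_div divff ?mul1r // expf_neq0.
Qed.

Lemma homog0_const A : A \is 0.-homog -> A = (ev A 0)%:MP.
Proof.
move=> A0; apply: ev_inj => v; rewrite evC -(scale0r v) (ev_homog _ _ A0).
by rewrite expr0 mul1r.
Qed.

Lemma homog_factors F A B e : F != 0 -> F \is e.-homog -> F = A * B ->
  exists i j, [/\ A \is i.-homog, B \is j.-homog & e = (i + j)%N].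
Proof.
move=> F0 Fe E; have [i Ai] := dhomog_factor F0 Fe E.
have [j Bj] : exists j, B \is j.-homog.
  by apply: (dhomog_factor F0 Fe (B := A)); rewrite mulrC.
exists i, j; split=> //; apply: dhomog_uniq F0 Fe _.
by rewrite E; apply: dhomogM.
Qed.

Lemma prime_homog_gt0 F e : prime_elt F -> F \is e.-homog -> (0 < e)%N.
Proof.
move=> [F0 FU _]; case: e => // /homog0_const FE; case/negP: FU; apply/mpoly_unitP.
by exists (ev F 0) => //; rewrite -(mpolyC_eq0 N.+1) -FE.
Qed.

Lemma prime_dvd_homog F A e : F != 0 -> F \is e.-homog -> rdvd A F ->
  exists i, A \is i.-homog.
Proof. by move=> F0 Fe [c E]; apply: (dhomog_factor F0 Fe (B := c)); rewrite mulrC. Qed.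

Lemma ev_rdvd F G v : rdvd F G -> ev F v = 0 -> ev G v = 0.
Proof. by move=> [c ->]; rewrite evM => ->; rewrite mulr0. Qed.

Definition vanish (Z : set P) G := forall x, Z x -> ev G (rep x) = 0.

(** If neither closed set contains [Z], each has a defining form that does not vanish on [Z], while
    the product of the two forms does. *)
Lemma irreducible_closed_forms (Z : set P) : zclosed Z -> Z !=set0 ->
  (forall A B i j, A \is i.-homog -> B \is j.-homog ->
    vanish Z (A * B) -> vanish Z A \/ vanish Z B) ->
  irreducible_closed Z.
Proof.
move=> Zc Z0 H; split=> // _ _ [S1 [hS1 ->]] [S2 [hS2 ->]] ZZ.
apply: contrapT => /not_orP[n1 n2].
have wit (S : set poly) : ~ (Z `<=` [set x | forall G, S G -> G.@[hcoord x] = 0]) ->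
    exists2 G, S G & ~ vanish Z G.
  move=> n; apply: contrapT => nG; apply: n => x Zx G SG; apply: contrapT => Gx.
  by apply: nG; exists G => // /(_ x Zx).
have [A SA nA] := wit _ n1; have [B SB nB] := wit _ n2.
have [i Ai] := hS1 _ SA; have [j Bj] := hS2 _ SB.
case: (H _ _ _ _ Ai Bj) => // x /ZZ[/(_ A SA) | /(_ B SB)] /=;
  by rewrite ev_hcoord evM => ->; rewrite ?mul0r ?mulr0.
Qed.

Lemma zclosed_form G e : G \is e.-homog -> zclosed [set x | ev G (rep x) = 0].
Proof.
move=> Ge; exists [set G]; split; first by move=> _ ->; exists e.
by apply/seteqP; split => x /=; [move=> Gx _ -> | apply].
Qed.

Lemma zclosedI (Y Z : set P) : zclosed Y -> zclosed Z -> zclosed (Y `&` Z).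
Proof.
move=> [S [hS ->]] [T [hT ->]]; exists (S `|` T); split.
  by move=> G [/hS|/hT].
apply/seteqP; split => x /=; first by move=> [xS xT] G [/xS|/xT].
by move=> H; split => G GS; apply: H; [left|right].
Qed.

Lemma irreducible_vanish_mul (Z : set P) A B i j : irreducible_closed Z ->
  A \is i.-homog -> B \is j.-homog -> vanish Z (A * B) -> vanish Z A \/ vanish Z B.
Proof.
move=> [_ _ H] Ai Bj AB.
have [] := H _ _ (zclosed_form Ai) (zclosed_form Bj); [|by left|by right].
move=> x /AB /eqP; rewrite evM mulf_eq0 => /orP[] /eqP; [by left|by right].
Qed.

Lemma irreducible_vanish_prod (Z : set P) (s : seq poly) (u : poly) : irreducible_closed Z ->
  u \is a GRing.unit -> (forall q, q \in s -> exists i, q \is i.-homog) ->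
  vanish Z (u * \prod_(q <- s) q) -> exists2 q, q \in s & vanish Z q.
Proof.
move=> Zi /mpoly_unitP[c c0 ->{u}] sH Zs.
have {}Zs : vanish Z (\prod_(q <- s) q).
  by move=> x /Zs /eqP; rewrite evM evC mulf_eq0 (negPf c0) => /eqP.
elim: s sH Zs => [|q s IH] sH.
  rewrite big_nil => Z1; have [_ [x Zx] _] := Zi.
  by have /eqP := etrans (esym (ev1 _)) (Z1 x Zx); rewrite oner_eq0.
have {}IH := IH (fun r rs => sH r (@mem_behead _ (q :: s) r rs)).
have [i qi] := sH q (mem_head _ _).
have [j sj] : exists j, \prod_(q' <- s) q' \is j.-homog.
  have : forall q', q' \in s -> exists i, q' \is i.-homog.
    by move=> x xs; apply: sH; rewrite in_cons xs orbT.
  elim: {IH sH} s => [|x s IH] sH; first by exists 0%N; rewrite big_nil dhomog1.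
  have [k xk] := sH x (mem_head _ _).
  have [|l sl] := IH; first by move=> y ys; apply: sH; rewrite in_cons ys orbT.
  by exists (k + l)%N; rewrite big_cons dhomogM.
rewrite big_cons => /(irreducible_vanish_mul Zi qi sj)[Zq|/IH[q' q's Zq']].
  by exists q => //; rewrite mem_head.
by exists q' => //; rewrite in_cons q's orbT.
Qed.

End Points.

Section Hypersurface.
Variables (K : closedFieldType) (N d : nat) (F : {mpoly K[N.+1]}).
Hypothesis Fd : F \is d.-homog.
Hypothesis d_gt0 : (0 < d)%N.
Local Notation X := [set x : pspace K N | F.@[hcoord x] = 0].

Lemma affine_coneE v : affine_cone X v <-> ev F v = 0.
Proof.
split=> [[->|[x Xx]]|Fv]; first exact: ev_homog0 Fd d_gt0.
  rewrite line_rep => /vlineP[c ->]; rewrite (ev_homog _ _ Fd).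
  by rewrite -ev_hcoord Xx mulr0.
have [->|v0] := eqVneq v 0; first by left.
right; exists (pt v); last by rewrite line_pt // memv_line.
by apply/eqP; rewrite /= ev_hcoord (ev_rep_pt Fd) ?Fv.
Qed.

Lemma vanishing_idealE G :
  vanishing_ideal X G <-> forall v, ev F v = 0 -> ev G v = 0.
Proof.
by split=> H v; [move=> Fv; apply: H; apply/affine_coneE | move/affine_coneE; apply: H].
Qed.

(** By the product rule, a common zero of two factors of positive degree is a singular point. *)
Lemma smooth_prime : (1 < N)%N ->
  (forall x : pspace K N, X x -> exists i, (F^`M(i)).@[hcoord x] != 0) -> prime_elt F.
Proof.
move=> N1 smooth; apply: irreducible_mpoly_prime.
have F0 : F != 0.
  apply: contraTneq isT => F0; have [|i] := smooth (pt (const_mx 1)).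
    by rewrite /= F0 meval0.
  by rewrite F0 mderiv0 meval0 eqxx.
split=> //.
  apply/mpoly_unitP => -[c c0 FE]; have := ev_homog0 Fd d_gt0.
  by rewrite FE evC => /eqP; rewrite (negPf c0).
move=> A B E; have [i [j [Ai Bj dE]]] := homog_factors F0 Fd E.
have unit0 (G : {mpoly K[N.+1]}) : G != 0 -> G \is 0.-homog -> G \is a GRing.unit.
  move=> G0 Gh; have GE := homog0_const Gh; apply/mpoly_unitP; exists (ev G 0) => //.
  by rewrite -(mpolyC_eq0 N.+1) -GE.
have A0 : A != 0 by apply: contraNneq F0; rewrite E => ->; rewrite mul0r.
have B0 : B != 0 by apply: contraNneq F0; rewrite E => ->; rewrite mulr0.
case: i Ai dE => [Ai _|i Ai]; first by left; apply: unit0.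
case: j Bj => [Bj _|j Bj dE]; first by right; apply: unit0.
have AB0 : A * B != 0 by rewrite -E.
have [v [v0 Av Bv]] := common_zero (N := N.+1) N1 Ai Bj isT isT AB0.
have [|k] := smooth (pt v).
  by apply/eqP; rewrite /= ev_hcoord (ev_rep_pt Fd) // E evM Av mul0r.
have Ap : ev A (rep (pt v)) = 0 by apply/eqP; rewrite (ev_rep_pt Ai) // Av.
have Bp : ev B (rep (pt v)) = 0 by apply/eqP; rewrite (ev_rep_pt Bj) // Bv.
by rewrite ev_hcoord E mderivM evD !evM Ap Bp mul0r mulr0 addr0 eqxx.
Qed.

Hypothesis Fprime : prime_elt F.

Lemma vanishing_ideal_rdvd G : vanishing_ideal X G <-> rdvd F G.
Proof.
split=> [/vanishing_idealE|FG]; first exact: nullstellensatz.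
by apply/vanishing_idealE => v; apply: ev_rdvd.
Qed.

Lemma form_zero : (0 < N)%N -> exists2 v, v != 0 & ev F v = 0.
Proof.
move=> N0; pose e i : 'rV[K]_N.+1 := delta_mx 0 i.
have [Fe|Fe] := eqVneq (ev F (e ord_max)) 0.
  exists (e ord_max) => //; apply/rV0Pn; exists ord_max.
  by rewrite !mxE !eqxx oner_eq0.
have [t Ft] := form_root (e ord0) Fd d_gt0 Fe.
exists (e ord0 + t *: e ord_max) => //; apply/rV0Pn; exists ord0.
have z : (ord0 == ord_max :> 'I_N.+1) = false by rewrite -val_eqE /= ltn_eqF.
by rewrite !mxE !eqxx z mulr0 addr0 oner_eq0.
Qed.

Lemma vanish_rdvd G e : (0 < N)%N -> G \is e.-homog -> vanish X G -> rdvd F G.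
Proof.
move=> N0 Ge XG.
have G0 v : v != 0 -> ev F v = 0 -> ev G v = 0.
  move=> v0 Fv; apply/eqP; rewrite -(ev_rep_pt Ge) //; apply/eqP/XG/eqP.
  by rewrite /= ev_hcoord (ev_rep_pt Fd) // Fv.
apply: nullstellensatz => // v Fv; have [->|v0] := eqVneq v 0; last exact: G0.
(* The zero vector represents no point; in degree 0 the form is a constant, whose value is read at a
   point of X. *)
case: e Ge => [|e] Ge; last exact: ev_homog0 Ge _.
have [w w0 Fw] := form_zero N0.
by rewrite -(G0 w w0 Fw) (homog0_const Ge) !evC.
Qed.

Lemma hypersurface_irreducible : (0 < N)%N -> irreducible_closed X.
Proof.
move=> N0; apply: irreducible_closed_forms.
- exact: zclosed_form Fd.
- have [v v0 Fv] := form_zero N0; exists (pt v).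
  by apply/eqP; rewrite /= ev_hcoord (ev_rep_pt Fd) // Fv.
- move=> A B i j Ai Bj AB; have [_ _ FP] := Fprime.
  have := vanish_rdvd N0 (dhomogM Ai Bj) AB.
  by move=> /FP[]/ev_rdvd H; [left|right] => x Xx; apply: H.
Qed.

End Hypersurface.

Section LinearForms.
Variables (K : closedFieldType) (N : nat).
Implicit Types (G D : {mpoly K[N.+1]}) (v u w : 'rV[K]_N.+1).

Lemma ev_homog1D G v u : G \is 1.-homog -> ev G (v + u) = ev G v + ev G u.
Proof.
move=> G1; have [s c] := has_top_line_expand idfun (v 0) (u 0) G1.
have E t : ev G (v + t *: u) = (lpoly G v u).[t] by rewrite lpolyE.
have := E 1; have := E 0; rewrite scale1r scale0r addr0 => -> ->.
have -> : lpoly G v u = ((lpoly G v u)`_0)%:P + ev G u *: 'X.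
  apply/polyP => -[|[|i]]; rewrite coefD coefC coefZ coefX /= ?mulr0 ?addr0 ?add0r ?mulr1 //.
  by rewrite nth_default // (leq_trans s).
by rewrite !hornerD !hornerC !hornerZ !hornerX mulr0 mulr1 addr0.
Qed.

Lemma ev_homog1 G v : G \is 1.-homog -> ev G v = \sum_j v 0 j * ev G (delta_mx 0 j).
Proof.
move=> G1; rewrite {1}[v]row_sum_delta.
elim/big_rec2: _ => [|j a b _ <-]; first exact: ev_homog0 G1 isT.
by rewrite ev_homog1D // (ev_homog _ _ G1) expr1.
Qed.

Lemma linear_form_prime G : G \is 1.-homog -> G != 0 -> prime_elt G.
Proof.
move=> G1 G0; apply: irreducible_mpoly_prime.
have unit0 (H : {mpoly K[N.+1]}) : H != 0 -> H \is 0.-homog -> H \is a GRing.unit.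
  move=> H0 Hh; have HE := homog0_const Hh; apply/mpoly_unitP; exists (ev H 0) => //.
  by rewrite -(mpolyC_eq0 N.+1) -HE.
split=> //.
  apply/mpoly_unitP => -[c c0 GE]; have := ev_homog0 G1 isT.
  by rewrite GE evC => /eqP; rewrite (negPf c0).
move=> A B E; have [i [j [Ai Bj]]] := homog_factors G0 G1 E.
have A0 : A != 0 by apply: contraNneq G0; rewrite E => ->; rewrite mul0r.
have B0 : B != 0 by apply: contraNneq G0; rewrite E => ->; rewrite mulr0.
case: i Ai => [|[|i]] Ai // dE; first by left; apply: unit0.
by right; apply: unit0; case: j Bj dE.
Qed.

Lemma mpolyXi_homog i : 'X_i \is [in K[N.+1], 1.-homog].
Proof. by rewrite dhomogX; apply/eqP; exact: mdeg1. Qed.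

Lemma evX i v : ev 'X_i v = v 0 i.
Proof. exact: mevalXU. Qed.

Lemma mpolyXi_prime i : prime_elt ('X_i : {mpoly K[N.+1]}).
Proof.
apply: linear_form_prime (mpolyXi_homog i) _.
apply/eqP => /(congr1 (fun G => ev G (delta_mx 0 i))); rewrite evX ev0 mxE !eqxx.
by move=> /eqP; rewrite oner_eq0.
Qed.

(** Projective points give no information at the zero vector; multiplying [D] by a coordinate makes
    it vanish there too. *)
Lemma ev_eq0_off0 D : (forall v, v != 0 -> ev D v = 0) -> D = 0.
Proof.
move=> D0; have [X0 _ _] := mpolyXi_prime ord0; apply: (mulfI X0).
rewrite mulr0; apply: ev_eq0 => v; rewrite evM evX.
by have [->|/D0->] := eqVneq v 0; rewrite ?mxE ?mul0r ?mulr0.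
Qed.

End LinearForms.

(** * Linear automorphisms *)

Section RegularMaps.
Variables (K : closedFieldType) (N : nat).
Local Notation P := (pspace K N).
Local Notation forms := ('I_N.+1 -> {mpoly K[N.+1]}).
Implicit Types (h : P -> P) (G : forms) (v u : 'rV[K]_N.+1).

Definition evf G v : 'rV[K]_N.+1 := \row_i ev (G i) v.

Lemma evf_homog G e c v : (forall i, G i \is e.-homog) -> evf G (c *: v) = c ^+ e *: evf G v.
Proof. by move=> Ge; apply/rowP => i; rewrite !mxE (ev_homog _ _ (Ge i)). Qed.

(** Common zeros of [G] are allowed, so [h] is described only on an open set, possibly empty. *)
Definition represents h e G :=
  (forall i, G i \is e.-homog) /\
  forall v, v != 0 -> evf G v != 0 -> h (pt v) = pt (evf G v).

Lemma proportional (m : nat) (a b : 'rV[K]_m) : a != 0 -> b != 0 ->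
  (forall i k, a 0 i * b 0 k = a 0 k * b 0 i) -> exists2 c, c != 0 & a = c *: b.
Proof.
move=> a0 /rV0Pn[k bk] ab.
have aE : a = (a 0 k / b 0 k) *: b.
  by apply/rowP => i; rewrite mxE mulrAC -ab mulfK.
by exists (a 0 k / b 0 k) => //; apply: contraNneq a0 => c0; rewrite aE c0 scale0r.
Qed.

Lemma local_representation h v : regular_map setT setT h -> v != 0 ->
  exists e G, represents h e G /\ evf G v != 0.
Proof.
move=> [_ /(_ (pt v) I)[e [G [Ge Gv hG]]]] v0; exists e, G.
have sc u : u != 0 -> exists2 c, c != 0 & eval_forms G (pt u) = c *: evf G u.
  move=> u0; have [c c0 cE] := rep_pt u0; exists (c ^+ e); first by rewrite expf_neq0.
  by rewrite -evf_homog // -cE; apply/rowP => i; rewrite !mxE.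
have [c c0 cE] := sc _ v0; split; last first.
  by apply: contraNneq Gv; rewrite cE => ->; rewrite scaler0.
split=> // u u0 Gu; have [b b0 bE] := sc _ u0.
have bG : b *: evf G u != 0 by rewrite scaler_eq0 negb_or b0.
by rewrite -(pt_scale (evf G u) b0); apply: line_eq_pt => //; rewrite -bE hG // bE.
Qed.

Lemma represents_cross h e G e' G' i k :
  represents h e G -> represents h e' G' -> G i * G' k = G k * G' i.
Proof.
move=> [Ge hG] [Ge' hG']; apply/eqP; rewrite -subr_eq0; apply/eqP/ev_eq0_off0 => v v0.
have E j : evf G v 0 j = ev (G j) v by rewrite mxE.
have E' j : evf G' v 0 j = ev (G' j) v by rewrite mxE.
rewrite evB !evM -!E -!E'.
have [->|Gv] := eqVneq (evf G v) 0; first by rewrite !mxE !mul0r subrr.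
have [->|Gv'] := eqVneq (evf G' v) 0; first by rewrite !mxE !mulr0 subrr.
have [|c c0 ->] := pt_eq Gv Gv'; first by rewrite -hG // hG'.
by rewrite !mxE; ring.
Qed.

(* A tuple of forms of minimal degree representing h has no common factor; a
   common zero v of the tuple would produce one, by comparison with a tuple
   that represents h near v. *)
Lemma global_representation h : regular_map setT setT h ->
  exists e G, represents h e G /\ forall v, v != 0 -> evf G v != 0.
Proof.
move=> hreg.
pose Q e := `[< exists G, represents h e G /\ exists2 v, v != 0 & evf G v != 0 >].
have exQ : exists e, Q e.
  have v0 : delta_mx 0 0 != 0 :> 'rV[K]_N.+1.
    by apply/rV0Pn; exists 0; rewrite mxE !eqxx oner_eq0.
  have [e [G [hG Gv]]] := local_representation hreg v0.
  by exists e; apply/asboolP; exists G; split=> //; exists (delta_mx 0 0).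
case: (ex_minnP exQ) => e /asboolP[G [hG [v0 v00 Gv0]]] mine; exists e, G; split=> // v v_neq0.
apply/eqP => Gv; have [e' [G' [hG' /rV0Pn[j]]]] := local_representation hreg v_neq0.
rewrite mxE => Gj'v.
have Gj'0 : G' j != 0 by apply: contraNneq Gj'v => ->; rewrite ev0.
have Gj0 : G j != 0.
  apply/eqP => Gj0; case/rV0Pn: (Gv0) => i; rewrite mxE => /negP; apply; apply/eqP.
  suff -> : G i = 0 by rewrite ev0.
  apply: (mulIf Gj'0); rewrite mul0r (represents_cross i j hG hG') Gj0 mul0r //.
have [Ge _] := hG.
have [u [s [/mpoly_unitP[c c0 ->] sP GjE]]] := mpoly_prime_factorization Gj0.
have [q qs qv] : exists2 q, q \in s & ev q v = 0.
  have : ev (G j) v = 0 by have := congr1 (fun w : 'rV[K]_N.+1 => w 0 j) Gv; rewrite /evf !mxE.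
  rewrite GjE evM evC ev_prod => /eqP; rewrite mulf_eq0 (negPf c0) /= prodf_seq_eq0.
  by move=> /hasP[q qs /eqP qv]; exists q.
have Pq := sP q qs; have [q0 _ qP] := Pq.
have qGj : rdvd q (G j).
  rewrite GjE; apply: rdvd_mull; rewrite (big_rem q) //=; apply: rdvd_mulr; exact: rdvd_refl.
have qG i : rdvd q (G i).
  have : rdvd q (G i * G' j) by rewrite (represents_cross i j hG hG'); apply: rdvd_mulr.
  move=> /qP[//|/ev_rdvd/(_ qv)/eqP]; by rewrite (negPf Gj'v).
have [k qk] := prime_dvd_homog Gj0 (Ge j) qGj.
have k0 := prime_homog_gt0 Pq qk.
have /choice[C CE] := qG.
have Ck i : C i \is (e - k).-homog.
  have [->|C0] := eqVneq (C i) 0; first exact: rpred0.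
  have Gi0 : G i != 0 by rewrite CE mulf_neq0.
  have [a [b [Ca qb ->]]] := homog_factors Gi0 (Ge i) (CE i).
  by rewrite (dhomog_uniq q0 qk qb) addnK.
have ke : (k <= e)%N.
  have [a [b [Ca qb ->]]] := homog_factors Gj0 (Ge j) (CE j).
  by rewrite (dhomog_uniq q0 qk qb) leq_addl.
have CG w : evf G w = ev q w *: evf C w.
  by apply/rowP => i; rewrite !mxE CE evM mulrC.
suff /asboolP/mine : exists C, represents h (e - k)%N C /\ exists2 v, v != 0 & evf C v != 0.
  by rewrite leqNgt ltn_subrL k0 (leq_trans k0 ke).
exists C; split; last first.
  by exists v0 => //; apply: contraNneq Gv0; rewrite CG => ->; rewrite scaler0.
split=> // w w0 Cw; have [e'' [G'' [hG'' Gw'']]] := local_representation hreg w0.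
have [|c' c'0 ->] := proportional Cw Gw''.
  move=> i l; rewrite !mxE -!evM; congr ev.
  by apply: (mulfI q0); rewrite !mulrA ![q * _]mulrC -!CE (represents_cross i l hG hG'').
by rewrite pt_scale //; have [_ ->] := hG''.
Qed.

End RegularMaps.

Section LinearAutomorphisms.
Variables (K : closedFieldType) (N : nat).
Implicit Types (h : pspace K N -> pspace K N).

(** The composite [H] of the forms of [h] and of its inverse represents the identity, so H_i X_j =
    H_j X_i and H_j = C X_j with one form C. A zero of C off the origin would be a common zero of
    these tuples, so C is constant; the product of the two degrees is then 1, and the forms of [h]
    are linear. *)
Lemma projective_automorphism_linear h : (0 < N)%N -> automorphism setT h ->
  exists M : 'M[K]_N.+1, M \in unitmx /\ forall v, v != 0 -> h (pt v) = pt (v *m M).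
Proof.
move=> N0 [hreg [h' hreg' hh']].
have [e [G [[Ge hG] G0]]] := global_representation hreg.
have [e' [G' [[Ge' hG'] G0']]] := global_representation hreg'.
pose H j := G' j \mPo [tuple G i | i < N.+1].
have Hev j v : ev (H j) v = ev (G' j) (evf G v).
  rewrite /ev comp_mpoly_meval; apply: meval_eq => i.
  by rewrite tnth_mktuple mxE.
have He j : H j \is (e * e').-homog.
  apply: homog_ev => c v; rewrite !Hev (evf_homog _ _ Ge) (ev_homog _ _ (Ge' j)).
  by rewrite exprM.
have HX i j : H i * 'X_j = H j * 'X_i.
  apply/eqP; rewrite -subr_eq0; apply/eqP/ev_eq0_off0 => v v0.
  have Gv := G0 v v0; have G'v := G0' _ Gv.
  have : pt (evf G' (evf G v)) = pt v.
    by rewrite -hG' // -hG //; have [] := hh' (pt v) I.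
  move=> /(pt_eq G'v v0)[c c0 /rowP cE].
  have cE' k : ev (H k) v = c * v 0 k by have := cE k; rewrite !mxE Hev.
  by rewrite evB !evM !cE' !evX; ring.
have other (j : 'I_N.+1) : exists i : 'I_N.+1, i != j.
  have /card_gt0P[i ij] : (0 < #|predC1 j|)%N by rewrite cardC1 card_ord.
  by exists i.
have XnX i j : i != j -> ~ rdvd ('X_j : {mpoly K[N.+1]}) 'X_i.
  move=> ij [c /(congr1 (fun G => ev G (delta_mx 0 i)))]; rewrite evM !evX !mxE !eqxx.
  by rewrite eq_sym (negPf ij) mulr0 => /eqP; rewrite oner_eq0.
have /choice[C CE] j : rdvd ('X_j : {mpoly K[N.+1]}) (H j).
  have [i ij] := other j; have [_ _ XP] := mpolyXi_prime K j.
  have : rdvd ('X_j : {mpoly K[N.+1]}) (H j * 'X_i) by rewrite HX; exists (H i).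
  by move=> /XP[//|/(XnX _ _ ij)].
have X0 i : 'X_i != 0 :> {mpoly K[N.+1]} by case: (mpolyXi_prime K i).
have CC i j : C i = C j.
  by apply: (mulIf (X0 i)); apply: (mulIf (X0 j)); rewrite -!CE HX CE; ring.
have C0 : C ord0 != 0.
  apply: contraTneq isT => C0; pose v := delta_mx 0 0 : 'rV[K]_N.+1.
  have v0 : v != 0 by apply/rV0Pn; exists 0; rewrite mxE !eqxx oner_eq0.
  have /rV0Pn[j Gj] := G0' _ (G0 _ v0).
  by move: Gj; rewrite mxE -Hev CE (CC j ord0) C0 mul0r ev0 eqxx.
have H0 : H ord0 != 0 by rewrite CE mulf_neq0.
have [m [k [Cm X1 ee']]] := homog_factors H0 (He ord0) (CE ord0).
have k1 : k = 1%N by apply: dhomog_uniq (X0 ord0) X1 (mpolyXi_homog _ _).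
have m0 : m = 0%N.
  case: m Cm ee' => // m Cm _.
  have [v v0 Cv] := form_zero Cm isT N0.
  have /rV0Pn[j Gj] := G0' _ (G0 _ v0).
  by move: Gj; rewrite mxE -Hev CE (CC j ord0) evM Cv mul0r eqxx.
have e1 : e = 1%N by move: ee'; rewrite k1 m0 => /eqP; rewrite muln_eq1 => /andP[/eqP].
rewrite e1 in Ge.
pose M : 'M[K]_N.+1 := \matrix_(j, i) ev (G i) (delta_mx 0 j).
have GM v : evf G v = v *m M.
  by apply/rowP => i; rewrite !mxE (ev_homog1 _ (Ge i)); apply: eq_bigr => j _; rewrite mxE.
exists M; split; last by move=> v v0; rewrite -GM hG // G0.
rewrite -row_free_unit -kermx_eq0; apply/eqP/row_matrixP => i; rewrite row0.
apply/eqP; apply: contraT => /G0; rewrite GM => /negP[].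
by rewrite -row_mul mulmx_ker row0.
Qed.

End LinearAutomorphisms.

Section ProportionalMaps.
Variables (K : fieldType) (m k : nat).
Implicit Types (A B : 'M[K]_(m, k)) (u w : 'rV[K]_k) (v : 'rV[K]_m).

Definition parallel u w := forall i j, u 0 i * w 0 j = u 0 j * w 0 i.

Lemma parallel_sub u w : w != 0 -> parallel u w -> exists a, u = a *: w.
Proof.
move=> /rV0Pn[l wl] uw; exists (u 0 l / w 0 l).
by apply/rowP => i; rewrite mxE mulrAC -uw mulfK.
Qed.

Let polarize (a b c e a' b' c' e' : K) : a * b = c * e -> a' * b' = c' * e' ->
  (a + a') * (b + b') = (c + c') * (e + e') -> a * b' + a' * b = c * e' + c' * e.
Proof.
move=> E1 E2 E; apply: (addrI (a * b + a' * b')).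
by transitivity ((a + a') * (b + b')); [ring | rewrite E E1 E2; ring].
Qed.

(** Subtract from A the multiple of B that makes C = A - a B kill a vector [v1] with [w = v1 *m B]
    nonzero. Polarizing the quadratic condition at [v1] shows that C has its image in the line of
    [w]. If C were nonzero, polarizing at a vector not killed by C would put the image of B in the
    same line, against its rank. *)
Lemma proportional_maps A B : (forall v, parallel (v *m A) (v *m B)) ->
  (1 < \rank B)%N -> exists a, A = a *: B.
Proof.
move=> AB rB.
have rank1 w : ~ forall v, exists a, v *m B = a *: w.
  move=> H; move: rB; rewrite ltnNge (leq_trans _ (rank_leq_row w)) // mxrankS //.
  by apply/row_subP => i; apply/sub_rVP; have [a aE] := H (delta_mx 0 i); exists a; rewrite rowE.
have [v1 v10] : exists v, v *m B != 0.
  apply: contrapT => H; apply: (rank1 0) => v; exists 0; rewrite scale0r; apply/eqP.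
  by apply: contrapT => /negP v0; apply: H; exists v.
have [a v1E] := parallel_sub v10 (AB v1); exists a.
pose C := A - a *: B; suff : C = 0 by move=> /eqP; rewrite subr_eq0 => /eqP.
have CB v : parallel (v *m C) (v *m B).
  move=> i j; rewrite mulmxBr -scalemxAr !mxE.
  by have := AB v i j; rewrite !mxE => E; rewrite !mulrBl E; ring.
have v1C : v1 *m C = 0 by rewrite mulmxBr v1E -scalemxAr subrr.
have pol v v' i j : (v *m C) 0 i * (v' *m B) 0 j + (v' *m C) 0 i * (v *m B) 0 j =
    (v *m C) 0 j * (v' *m B) 0 i + (v' *m C) 0 j * (v *m B) 0 i.
  have addE (D : 'M[K]_(m, k)) l : ((v + v') *m D) 0 l = (v *m D) 0 l + (v' *m D) 0 l.
    by rewrite mulmxDl mxE.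
  by have := CB (v + v') i j; rewrite !addE; apply: polarize; apply: CB.
apply/eqP; apply: contrapT => /negP C0; set w := v1 *m B in v10.
have Cw v : exists c, v *m C = c *: w.
  by apply: parallel_sub => // i j; have := pol v v1 i j; rewrite v1C !mxE !mul0r !addr0.
have [v vC] : exists v, v *m C != 0.
  apply: contrapT => H; move/negP: C0; apply; apply/eqP/row_matrixP => i; rewrite row0 rowE.
  by apply/eqP; apply: contrapT => /negP v0; apply: H; exists (delta_mx 0 i).
have [c cE] := Cw v; have c0 : c != 0 by apply: contraNneq vC; rewrite cE => ->; rewrite scale0r.
have [b bE] : exists b, v *m B = b *: w.
  apply: parallel_sub => // i j; have := CB v i j; rewrite cE.
  by rewrite ![(c *: w) 0 _]mxE -!mulrA => /(mulfI c0) E; rewrite mulrC -E mulrC.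
case: (rank1 w) => v'; apply: parallel_sub => // i j.
have [c' c'E] := Cw v'; have := pol v v' i j; rewrite cE c'E bE.
rewrite ![(_ *: w) 0 _]mxE => E; apply: (mulfI c0).
apply/eqP; rewrite -subr_eq0; move/eqP: E; rewrite -subr_eq0 => /eqP E.
by apply/eqP; rewrite -[RHS]oppr0 -[in RHS]E; ring.
Qed.

End ProportionalMaps.

Section Setup.
Variable K : closedFieldType.

Lemma prime_low_degree N (F G : {mpoly K[N.+1]}) d e : prime_elt F -> F \is d.-homog ->
  G \is e.-homog -> (e < d)%N -> (forall v, ev F v = 0 -> ev G v = 0) -> G = 0.
Proof.
move=> FP Fd Ge ed FG; apply/eqP; apply: contrapT => /negP G0.
have [c cE] := nullstellensatz FP FG.
have [i [j [_ Fj eE]]] := homog_factors G0 Ge cE.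
by have F0 : F != 0; [case: FP | move: ed; rewrite eE (dhomog_uniq F0 Fd Fj); lia].
Qed.

(* The 2 x 2 minors of (vA, vB) are quadratic forms in v. *)
Lemma parallel_on_hypersurface N (F : {mpoly K[N.+1]}) d (A B : 'M[K]_N.+1) :
  prime_elt F -> F \is d.-homog -> (2 < d)%N ->
  (forall v, ev F v = 0 -> parallel (v *m A) (v *m B)) ->
  forall v, parallel (v *m A) (v *m B).
Proof.
move=> FP Fd d2 H v i j.
pose L (C : 'M[K]_N.+1) l : {mpoly K[N.+1]} := msub C 'X_l.
have L1 C l : L C l \is 1.-homog by apply: msub_homog; apply: mpolyXi_homog.
have LE C l u : ev (L C l) u = (u *m C) 0 l by rewrite ev_msub evX.
suff D0 : L A i * L B j - L A j * L B i = 0.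
  by apply/eqP; rewrite -subr_eq0 -!LE -!evM -evB D0 ev0.
apply: (prime_low_degree FP Fd _ d2) => [|u Fu].
  by apply: rpredB; apply: (dhomogM (L1 _ _) (L1 _ _)).
by rewrite evB !evM !LE H // subrr.
Qed.

Lemma iter_projective N (X : set (pspace K N)) g (M : 'M[K]_N.+1) :
  (forall x, X x -> X (g x)) -> (forall x, X x -> g x = pt (rep x *m M)) ->
  M \in unitmx -> forall k x, X x -> iter k g x = pt (rep x *m M ^+ k).
Proof.
move=> gX gM MU; elim=> [|k IH] x Xx; first by rewrite expr0 mulmx1 pt_rep.
rewrite iterSr IH ?exprS; last exact: gX.
rewrite (gM _ Xx).
have v0 : rep x *m M != 0.
  apply: contraNneq (rep_neq0 x) => E.
  by rewrite -[rep x]mulmx1 -(mulmxV MU) mulmxA E mul0mx.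
have [c c0 ->] := rep_pt v0.
by rewrite -scalemxAl pt_scale // -mulmxA.
Qed.

(** F(vM) vanishes on X, so it is a multiple of F, by a constant since the degrees agree. As the
    d-th iterate of [g] is the identity, v M^d is parallel to v for v on the cone over X; this is a
    quadratic condition, so it holds everywhere and M^d is scalar. A smaller scalar power would
    contradict the order of [g]. *)
Lemma linear_automorphism_setup n d (X : set (pspace K n.+1)) g : (0 < n)%N -> (2 < d)%N ->
  smooth_hypersurface d X -> linear_automorphism X g -> automorphism_order X g d ->
  exists (F : {mpoly K[n.+2]}) (M : 'M[K]_n.+2) (mu c : K),
    [/\ [/\ F \is d.-homog, X = [set x | F.@[hcoord x] = 0], prime_elt F &
            forall x, X x -> exists i, (F^`M(i)).@[hcoord x] != 0],
        [/\ M \in unitmx, forall x, X x -> g x = pt (rep x *m M) &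
            forall v, ev F (v *m M) = mu * ev F v] &
        c != 0 /\ M ^+ d = c%:M /\
        forall k a, (0 < k < d)%N -> M ^+ k <> a%:M].
Proof.
move=> n0 d2 [F [Fd XE smooth]] [[[gX _] _] [h [hA hX hg]]] [_ gd gk].
have d0 : (0 < d)%N by lia.
have [M [MU hM]] := projective_automorphism_linear (isT : (0 < n.+1)%N) hA.
have n1 : (1 < n.+1)%N by [].
have FP : prime_elt F by apply: (smooth_prime Fd) => // x; rewrite -XE; apply: smooth.
have gM x : X x -> g x = pt (rep x *m M).
  by move=> Xx; rewrite -hg // -[x in LHS]pt_rep hM // rep_neq0.
have Xpt v : v != 0 -> X (pt v) <-> ev F v = 0.
  move=> v0; rewrite XE /= ev_hcoord; split=> /eqP H; apply/eqP;
  by move: H; rewrite (ev_rep_pt Fd).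
have vM v : v != 0 -> v *m M != 0.
  by apply: contraNneq => E; rewrite -[v]mulmx1 -(mulmxV MU) mulmxA E mul0mx.
have FM v : ev F v = 0 -> ev (msub M F) v = 0.
  rewrite ev_msub => Fv; have [->|v0] := eqVneq v 0; first by rewrite mul0mx (ev_homog0 Fd).
  by apply/Xpt; rewrite ?vM // -hM // -hX; exists (pt v) => //; apply/Xpt.
have [mu muE] := nullstellensatz FP FM.
have [F0 _ _] := FP.
have msF0 : msub M F != 0.
  have [v Fv] := ev_neq0 F0; apply: contraNneq Fv => E.
  by rewrite -[v]mulmx1 -(mulVmx MU) mulmxA -ev_msub E ev0.
have [i [j [mui Fj dE]]] := homog_factors msF0 (msub_homog M Fd) muE.
have i0 : i = 0%N by have := dhomog_uniq F0 Fd Fj; lia.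
rewrite i0 in mui.
have iterM := iter_projective gX gM MU.
have rk1 : (1 < \rank (1%:M : 'M[K]_n.+2))%N by rewrite mxrank1.
have [c MdE] : exists c, M ^+ d = c *: 1%:M.
  apply: proportional_maps rk1; apply: (parallel_on_hypersurface FP Fd) => // v Fv.
  have [->|v0] := eqVneq v 0; first by move=> k l; rewrite !mul0mx !mxE !mul0r.
  have Xv : X (pt v) by apply/Xpt.
  have := gd _ Xv; rewrite iterM //; have [b b0 ->] := rep_pt v0.
  have Md : M ^+ d \in unitmx by rewrite -[_ \in _]/(M ^+ d \is a GRing.unit) unitrX.
  have vMd : v *m M ^+ d != 0.
    by apply: contraNneq v0 => E; rewrite -[v]mulmx1 -(mulmxV Md) mulmxA E mul0mx.
  rewrite -scalemxAl pt_scale // => /(pt_eq vMd v0)[b' _ ->] k l.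
  by rewrite mulmx1 !mxE; ring.
rewrite scalemx1 in MdE.
exists F, M, (ev mu 0), c; split; split=> //.
- by move=> v; rewrite -ev_msub muE evM (homog0_const mui) !evC.
- apply: contraTneq (unitrX d MU) => c0; rewrite MdE c0.
  by rewrite -scalemx1 scale0r unitr0.
split=> //.
move=> k a k0 Mk; apply: (gk k k0) => x Xx; rewrite iterM // Mk mul_mx_scalar.
have a0 : a != 0.
  have Mku : M ^+ k \is a GRing.unit by rewrite unitrX.
  by apply: contraTneq Mku => a0; rewrite Mk a0 -scalemx1 scale0r unitr0.
by rewrite pt_scale ?pt_rep.
Qed.

End Setup.

(** * Fixed loci of codimension one *)

Section Gradient.
Variables (K : closedFieldType) (N : nat).
Implicit Types (F : {mpoly K[N.+1]}) (v u w : 'rV[K]_N.+1).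

Definition gradient F v : 'cV[K]_N.+1 := \col_i ev F^`M(i) v.

Lemma dirder_gradient F u v : ev (dirder u F) v = (u *m gradient F v) 0 0.
Proof. by rewrite ev_dirder mxE; apply: eq_bigr => i _; rewrite mxE. Qed.

(** Derivative of F(vM) = mu F(v) at [w] in the direction [u]. For a given eigenvector [w], the
    differential of F at [w] can be nonzero only on the eigenspace whose eigenvalue [b] satisfies b
    a^(d-1) = mu. *)
Lemma gradient_invariant F d (M : 'M[K]_N.+1) mu a b u w :
  F \is d.-homog -> (0 < d)%N -> (forall v, ev F (v *m M) = mu * ev F v) ->
  a != 0 -> w *m M = a *: w -> u *m M = b *: u ->
  b * a ^+ d.-1 * (u *m gradient F w) 0 0 = mu * (u *m gradient F w) 0 0.
Proof.
move=> Fd d0 FM a0 wM uM; rewrite -dirder_gradient.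
have E : lpoly F (a *: w) (b *: u) = mu *: lpoly F w u.
  by apply: horner_ext => t; rewrite hornerZ !lpolyE -FM mulmxDl -scalemxAl wM uM !scalerA [t * b]mulrC.
have := congr1 (fun P : {poly K} => P^`().[0]) E.
rewrite derivZ hornerZ !deriv_lpoly !scale0r !addr0 => <-.
rewrite (ev_homog _ _ (dirder_homog _ Fd)) !dirder_gradient -scalemxAl.
have -> : (b *: (u *m gradient F w)) 0 0 = b * (u *m gradient F w) 0 0 by rewrite mxE.
by rewrite mulrCA mulrA.
Qed.

Lemma gradient_zero_line F w u : (forall t, ev F (w + t *: u) = 0) -> (u *m gradient F w) 0 0 = 0.
Proof.
move=> H; rewrite -dirder_gradient dirder_ev.
have -> : lpoly F w u = 0 by apply: horner_ext => t; rewrite lpolyE H horner0.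
by rewrite deriv0 horner0.
Qed.

Lemma smooth_gradient F d w : F \is d.-homog ->
  (forall x : pspace K N, F.@[hcoord x] = 0 -> exists i, (F^`M(i)).@[hcoord x] != 0) ->
  w != 0 -> ev F w = 0 -> gradient F w != 0.
Proof.
move=> Fd smooth w0 Fw; have [|i] := smooth (pt w).
  by apply/eqP; rewrite ev_hcoord (ev_rep_pt Fd) // Fw.
have Fi : F^`M(i) \is d.-1.-homog.
  have := dirder_homog (delta_mx 0 i) Fd.
  rewrite /dirder (bigD1 i) //= big1 ?addr0 ?mxE ?eqxx ?scale1r // => j /negPf ji.
  by rewrite mxE ji scale0r.
rewrite ev_hcoord (ev_rep_pt Fi) //; apply: contraNneq => /colP/(_ i).
by rewrite !mxE => ->.
Qed.

End Gradient.

Lemma two_independent_rows (K : fieldType) m n (B : 'M[K]_(m, n)) : (1 < \rank B)%N ->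
  exists u v : 'rV_n, [/\ (u <= B)%MS, (v <= B)%MS &
    forall x y, x *: u + y *: v = 0 -> x = 0 /\ y = 0].
Proof.
move=> r1; pose i0 := Ordinal (ltnW r1); pose i1 := Ordinal r1.
exists (row i0 (row_base B)), (row i1 (row_base B)).
split; try by rewrite (submx_trans (row_sub _ _)) ?eq_row_base.
move=> x y E; have /row_freeP[C CE] := row_base_free B.
have := congr1 (mulmx^~ C) E; rewrite mul0mx mulmxDl -!scalemxAl -!row_mul CE => /rowP E'.
have := E' i0; have := E' i1; rewrite !mxE -!val_eqE /=.
by rewrite !mulr0 !mulr1 addr0 add0r.
Qed.

Lemma form_zero_sub (K : closedFieldType) N m (f : {mpoly K[N]}) e (B : 'M[K]_(m, N)) :
  f \is e.-homog -> (0 < e)%N -> (1 < \rank B)%N ->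
  exists2 w, w != 0 & (w <= B)%MS /\ ev f w = 0.
Proof.
move=> fe e0 /two_independent_rows[u [v [uB vB uv]]].
have v0 : v != 0.
  apply/eqP => E; have [|_ /eqP] := uv 0 1; first by rewrite E scale0r scaler0 addr0.
  by rewrite oner_eq0.
have [fv|fv] := eqVneq (ev f v) 0; first by exists v.
have [t ft] := form_root u fe e0 fv.
exists (u + t *: v); last by split; rewrite // addmx_sub // scalemx_sub.
apply/eqP => E; have [|/eqP] := uv 1 t; first by rewrite scale1r.
by rewrite oner_eq0.
Qed.

Section HyperplaneSection.
Variables (K : closedFieldType) (N d : nat) (F : {mpoly K[N.+1]}).
Hypotheses (Fd : F \is d.-homog) (d1 : (1 < d)%N) (Fprime : prime_elt F).
Variables (p : 'rV[K]_N.+1) (l : 'cV[K]_N.+1).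
Hypothesis pl : p *m l = 1%:M.
Local Notation X := [set x : pspace K N | F.@[hcoord x] = 0].
Implicit Types (G f : {mpoly K[N.+1]}) (u v : 'rV[K]_N.+1).

(** The projection from [p] onto the hyperplane [l = 0], acting on rows. It replaces a choice of
    coordinates adapted to [p] and [l]: the polynomials in the coordinates of the hyperplane are
    those with [msub hproj G = G], the cones with vertex [p]. *)
Definition hproj : 'M[K]_N.+1 := 1%:M - l *m p.
Definition hform v : K := (v *m l) 0 0.
Definition lin_form (c : 'cV[K]_N.+1) : {mpoly K[N.+1]} := msub c 'X_ord0.

Lemma lin_form_homog c : lin_form c \is 1.-homog.
Proof. by apply: msub_homog; rewrite dhomogX; apply/eqP; exact: mdeg1. Qed.

Lemma ev_lin_form c v : ev (lin_form c) v = (v *m c) 0 0.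
Proof. by rewrite ev_msub /ev mevalXU. Qed.

Lemma mul_hform v : v *m l = (hform v)%:M.
Proof. exact: mx11_scalar. Qed.

Lemma mul_hproj v : v *m hproj = v - hform v *: p.
Proof. by rewrite mulmxBr mulmx1 mulmxA mul_hform mul_scalar_mx. Qed.

Lemma hform_p : hform p = 1.
Proof. by rewrite /hform pl mxE eqxx. Qed.

Lemma hformD v u : hform (v + u) = hform v + hform u.
Proof. by rewrite /hform mulmxDl mxE. Qed.

Lemma hformZ c v : hform (c *: v) = c * hform v.
Proof. by rewrite /hform -scalemxAl mxE. Qed.

Lemma hform_hproj v : hform (v *m hproj) = 0.
Proof. by rewrite mul_hproj -scaleNr hformD hformZ hform_p mulr1 subrr. Qed.

Lemma hproj_id v : hform v = 0 -> v *m hproj = v.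
Proof. by rewrite mul_hproj => ->; rewrite scale0r subr0. Qed.

Lemma hproj_idem v : v *m hproj *m hproj = v *m hproj.
Proof. by rewrite hproj_id // hform_hproj. Qed.

Lemma mul_p_hproj : p *m hproj = 0.
Proof. by rewrite mul_hproj hform_p scale1r subrr. Qed.

Lemma hproj_shift v t : (v + t *: p) *m hproj = v *m hproj.
Proof. by rewrite mulmxDl -scalemxAl mul_p_hproj scaler0 addr0. Qed.

Lemma lin_form_neq0 : lin_form l != 0.
Proof.
apply/eqP => /(congr1 (fun G => ev G p)); rewrite ev_lin_form ev0 -/(hform p) hform_p.
by move=> /eqP; rewrite oner_eq0.
Qed.

(** Otherwise F would vanish on the hyperplane and be divisible by its equation, against primality
    and [d > 1]. *)
Lemma hyperplane_section_neq0 : msub hproj F != 0.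
Proof.
have [F0 _ FP] := Fprime.
apply/eqP => pF0; have LP := linear_form_prime (lin_form_homog l) lin_form_neq0.
have [|c cE] := nullstellensatz LP (G := F).
  move=> v; rewrite ev_lin_form => lv; have := congr1 (fun G => ev G v) pF0.
  by rewrite ev_msub ev0 hproj_id.
have [i [j [ci Lj dE]]] := homog_factors F0 Fd cE.
have j1 : j = 1%N := dhomog_uniq lin_form_neq0 Lj (lin_form_homog l).
have [] : rdvd F c \/ rdvd F (lin_form l) by apply: FP; rewrite -cE; apply: rdvd_refl.
- move=> Fc; case/eqP: F0; rewrite cE (prime_low_degree Fprime Fd ci) ?mul0r //; first lia.
  by move=> v; apply: ev_rdvd.
- move=> Fl; case/eqP: lin_form_neq0; apply: (prime_low_degree Fprime Fd (lin_form_homog l)) => //.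
  by move=> v; apply: ev_rdvd.
Qed.

Lemma not_vanish_lin_form c : c != 0 -> ~ vanish X (lin_form c).
Proof.
move=> c0 H; have L1 := lin_form_homog c.
have L0 : lin_form c = 0.
  apply: (prime_low_degree Fprime Fd L1 d1) => v Fv.
  have [->|v0] := eqVneq v 0; first exact: ev_homog0 L1 _.
  apply/eqP; rewrite -(ev_rep_pt L1 v0); apply/eqP/H/eqP.
  by rewrite /= ev_hcoord (ev_rep_pt Fd) // Fv.
case/eqP: c0; apply/colP => i; have := ev_lin_form c (delta_mx 0 i).
by rewrite L0 ev0 -rowE !mxE.
Qed.

(* A divisor of the cone msub hproj G with vertex p is itself such a cone: along
   the line through v and p both factors of a constant are constant. *)
Lemma cone_divisor G f : msub hproj G != 0 -> rdvd f (msub hproj G) -> msub hproj f = f.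
Proof.
move=> G0 [c cE]; apply/eqP; rewrite -subr_eq0; apply/eqP; apply: (mulIf G0).
rewrite mul0r; apply: ev_eq0 => v; rewrite evM evB !ev_msub.
have [->|Gv] := eqVneq (ev G (v *m hproj)) 0; first by rewrite mulr0.
have E t : ev c (v *m hproj + t *: p) * ev f (v *m hproj + t *: p) = ev G (v *m hproj).
  by rewrite -evM -cE ev_msub hproj_shift hproj_idem.
have : lpoly f (v *m hproj) p \is a GRing.unit.
  apply/unitrPr; exists ((ev G (v *m hproj))^-1 *: lpoly c (v *m hproj) p).
  apply: horner_ext => t; rewrite -scalerAr hornerZ hornerM !lpolyE [_ * ev c _]mulrC E.
  by rewrite mulVf // hornerC.
rewrite poly_unitE => /andP[/size_poly1P[b b0 fE] _].
have fb t : ev f (v *m hproj + t *: p) = b by rewrite -lpolyE fE hornerC.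
have := fb 0; have := fb (hform v); rewrite {1}mul_hproj subrK scale0r addr0 => -> ->.
by rewrite subrr mul0r.
Qed.

(** When [f] is a prime factor of [msub hproj F], this is a component of the section of X by the
    hyperplane. Writing [f] as a cone keeps a single polynomial ring for X and its sections. *)
Definition section_component f : set (pspace K N) :=
  [set x | ev f (rep x) = 0 /\ ev (lin_form l) (rep x) = 0].

(** The projection maps the zeros of the cone [f] into the component, so a product A B vanishing on
    the component pulls back to a product divisible by [f], and primality of [f] separates the
    factors. *)
Lemma section_component_irreducible f e : (1 < N)%N -> prime_elt f -> f \is e.-homog ->
  msub hproj f = f -> irreducible_closed (section_component f).
Proof.
move=> N1 fP fe fpi; have e0 := prime_homog_gt0 fP fe.
have mem v : v != 0 -> ev f v = 0 -> hform v = 0 -> section_component f (pt v).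
  move=> v0 fv lv; split; apply/eqP; first by rewrite (ev_rep_pt fe) // fv.
  by rewrite (ev_rep_pt (lin_form_homog l)) // ev_lin_form -/(hform v) lv.
have [w w0 [fw lw]] : exists2 w, w != 0 & ev f w = 0 /\ hform w = 0.
  have [|w w0 [/sub_kermxP wl fw]] := form_zero_sub (B := kermx l) fe e0.
    by rewrite mxrank_ker; move: (rank_leq_col l); clear -N1; lia.
  by exists w => //; rewrite /hform wl mxE.
apply: irreducible_closed_forms.
- exact: zclosedI (zclosed_form fe) (zclosed_form (lin_form_homog l)).
- by exists (pt w); apply: mem.
- move=> A B i j Ai Bj AB; have [_ _ fPP] := fP.
  have ABd := dhomogM Ai Bj.
  have ABev v : v != 0 -> ev f v = 0 -> hform v = 0 -> ev (A * B) v = 0.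
    by move=> v0 fv lv; apply/eqP; rewrite -(ev_rep_pt ABd v0); apply/eqP/AB/mem.
  have : rdvd f (msub hproj A * msub hproj B).
    apply: nullstellensatz => // v fv; rewrite evM !ev_msub -evM.
    have fu : ev f (v *m hproj) = 0 by rewrite -ev_msub fpi.
    have [->|u0] := eqVneq (v *m hproj) 0; last by rewrite ABev // hform_hproj.
    have [ij0|ij0] := posnP (i + j); last exact: ev_homog0 ABd ij0.
    by move: ABd (ABev w w0 fw lw); rewrite ij0 => /homog0_const ->; rewrite !evC.
  move=> /fPP[] fA; [left|right] => x [fx lx];
    by have := ev_rdvd fA fx; rewrite ev_msub hproj_id // /hform -ev_lin_form.
Qed.

Lemma exists_section_component (Z : set (pspace K N)) : irreducible_closed Z ->
  Z `<=` X -> (forall x, Z x -> hform (rep x) = 0) ->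
  exists f e, [/\ prime_elt f, f \is e.-homog, rdvd f (msub hproj F) & Z `<=` section_component f].
Proof.
move=> Zi ZX Zl; have s0 := hyperplane_section_neq0.
have [u [s [uU sP FE]]] := mpoly_prime_factorization s0.
have sd q : q \in s -> rdvd q (msub hproj F).
  by move=> qs; rewrite FE; apply: rdvd_mull; rewrite (big_rem q) //=; apply: rdvd_mulr; apply: rdvd_refl.
have [||q qs Zq] := irreducible_vanish_prod Zi uU (s := s).
- by move=> q /sd/(prime_dvd_homog s0 (msub_homog _ Fd)).
- by rewrite -FE => x Zx; rewrite ev_msub hproj_id ?Zl //; apply: ZX.
have [e qe] := prime_dvd_homog s0 (msub_homog _ Fd) (sd q qs).
exists q, e; split; [exact: sP | by [] | exact: sd | move=> x Zx; split; first exact: Zq].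
by rewrite ev_lin_form; apply: Zl.
Qed.

Lemma section_component_sub f : rdvd f (msub hproj F) -> section_component f `<=` X.
Proof.
move=> fF x [fx lx] /=; have := ev_rdvd fF fx.
by rewrite ev_msub hproj_id // /hform -ev_lin_form.
Qed.

Lemma section_component_proper f : ~ (X `<=` section_component f).
Proof.
move=> H; apply: (@not_vanish_lin_form l).
  by apply: contraTneq (oner_neq0 K) => l0; rewrite -hform_p /hform l0 mulmx0 mxE eqxx.
by move=> x /H[].
Qed.

End HyperplaneSection.

Section Eigenspaces.
Variables (K : closedFieldType) (N d : nat) (M : 'M[K]_N.+1) (c : K).
Hypotheses (dK : d%:R != 0 :> K) (c0 : c != 0) (Mdc : M ^+ d = c%:M).

Let d_gt0 : (0 < d)%N.
Proof. by case: d dK => //; rewrite eqxx. Qed.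

Lemma eigen_roots : exists2 rs : seq K, uniq rs & 'X^d - c%:P = \prod_(r <- rs) ('X - r%:P).
Proof.
have mon : 'X^d - c%:P \is monic by apply: monicXnsubC.
have [rs E] := closed_field_poly_normal ('X^d - c%:P).
rewrite (monicP mon) scale1r in E; exists rs => //.
rewrite -separable_prod_XsubC -E unlock.
(* Separability, from the identity -(T^d - c)/c + (T/(d c)) d T^(d-1) = 1. *)
apply/Bezout_eq1_coprimepP; exists ((- c^-1)%:P, (d%:R * c)^-1 *: 'X).
rewrite derivB derivXn derivC subr0 /= -scaler_nat -scalerAl -scalerAr scalerA.
rewrite -exprS prednK // mulrBr -polyCM mul_polyC mulNr mulVf // polyCN opprK.
have -> : (d%:R * c)^-1 * d%:R = c^-1 by rewrite invfM mulrC mulrA mulfV // mul1r.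
by rewrite scaleNr addrC addrA subrr add0r.
Qed.

(** M is diagonalizable because its minimal polynomial divides T^d - c, which is split and
    separable. This form of the statement lets a gradient or a linear form be shown zero by testing
    eigenvectors. *)
Lemma eigen_span k (B : 'M[K]_(N.+1, k)) :
  (forall b, eigenspace M b *m B = 0) -> B = 0.
Proof.
move=> EB; have [rs rsU rsE] := eigen_roots.
have dvd : mxminpoly M %| \prod_(r <- rs) ('X - r%:P).
  apply: mxminpoly_min; rewrite -rsE rmorphB rmorphXn /= horner_mx_X horner_mx_C.
  by rewrite Mdc subrr.
have /diagonalizablePeigen[rs' _ span] : diagonalizable M.
  by apply/diagonalizableP; exists rs.
rewrite -[B]mul1mx; apply/sub_kermxP; rewrite -span.
elim/big_ind: _ => [|A A' AB AB'|r _]; first exact: sub0mx.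
  by rewrite addsmx_sub AB.
by apply/sub_kermxP.
Qed.

Lemma eigenvalue_exp (v : 'rV[K]_N.+1) b k : v *m M = b *: v -> v *m M ^+ k = b ^+ k *: v.
Proof.
move=> vM; elim: k => [|k IH]; first by rewrite !expr0 mulmx1 scale1r.
by rewrite exprSr [M ^+ k * M]/(M ^+ k *m M) mulmxA IH -scalemxAl vM scalerA exprSr.
Qed.

Lemma eigenvalue_exp_d (v : 'rV[K]_N.+1) b : v != 0 -> v *m M = b *: v -> b ^+ d = c.
Proof.
move=> v0 /(eigenvalue_exp d); rewrite Mdc mul_mx_scalar => /eqP.
by rewrite -subr_eq0 -scalerBl scaler_eq0 (negPf v0) orbF subr_eq0 => /eqP.
Qed.

(** If no eigenspace contained [Z], each root b of T^d - c would have a column of M - b not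
    vanishing on [Z]; the product of these finitely many linear forms does vanish on [Z], against
    irreducibility. *)
Lemma irreducible_eigenspace (Z : set (pspace K N)) : irreducible_closed Z ->
  (forall x, Z x -> exists b, rep x *m M = b *: rep x) ->
  exists a, forall x, Z x -> rep x *m M = a *: rep x.
Proof.
move=> Zi Zeig; apply: contrapT => H; have [rs rsU rsE] := eigen_roots.
have /choice[f fP] : forall b, exists i, ~ vanish Z (lin_form (col i (M - b%:M))).
  move=> b; apply: contrapT => Hb; apply: H; exists b => x Zx.
  apply/eqP; rewrite -subr_eq0 -mul_mx_scalar -mulmxBr; apply/eqP/rowP => i.
  have Hi : vanish Z (lin_form (col i (M - b%:M))) by apply: contrapT => n; apply: Hb; exists i.
  by have := Hi x Zx; rewrite ev_lin_form colE mulmxA -colE !mxE.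
pose s := [seq lin_form (col (f b) (M - b%:M)) | b <- rs].
have [||q] := irreducible_vanish_prod Zi (unitr1 _) (s := s); last by move=> /mapP[b _ ->] /fP.
- by move=> q /mapP[b _ ->]; exists 1%N; apply: lin_form_homog.
- move=> x Zx; have [b bE] := Zeig x Zx; rewrite mul1r ev_prod.
  have : b \in rs.
    rewrite -root_prod_XsubC -rsE rootE !hornerE subr_eq0.
    by apply/eqP; apply: eigenvalue_exp_d (rep_neq0 x) bE.
  move=> brs; apply/eqP; rewrite prodf_seq_eq0; apply/hasP.
  exists (lin_form (col (f b) (M - b%:M))); first by apply/mapP; exists b.
  rewrite /= ev_lin_form colE mulmxA mulmxBr bE mul_mx_scalar subrr.
  by rewrite mul0mx mxE.
Qed.

End Eigenspaces.

Lemma irreducible_chain2 (K : closedFieldType) N (Z Z1 X : set (pspace K N)) :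
  irreducible_closed Z -> irreducible_closed Z1 -> irreducible_closed X ->
  Z `<` Z1 -> Z1 `<` X -> irreducible_chain Z X 2.
Proof.
move=> Zi Z1i Xi ZZ1 Z1X.
exists (fun i => match i with 0%N => Z | 1%N => Z1 | _ => X end); split=> //.
  move=> [|[|[|]]] // _; split=> //; last exact: properW.
  by apply: subset_trans (properW ZZ1) (properW Z1X).
by move=> [|[|]].
Qed.

Section FixedLocus.
Variables (K : closedFieldType) (N d : nat) (F : {mpoly K[N.+1]}).
Hypotheses (Fd : F \is d.-homog) (d2 : (2 < d)%N) (N1 : (1 < N)%N) (Fprime : prime_elt F).
Hypothesis smooth : forall x : pspace K N, F.@[hcoord x] = 0 -> exists i, (F^`M(i)).@[hcoord x] != 0.
Local Notation X := [set x : pspace K N | F.@[hcoord x] = 0].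

(** [l] and [l'] are two independent equations satisfied by W; the last condition says that [l'] is
    not a multiple of [l]. *)
Lemma exists_annihilators (W : 'M[K]_N.+1) : (\rank W < N)%N ->
  exists (p : 'rV[K]_N.+1) (l l' : 'cV[K]_N.+1),
    [/\ p *m l = 1%:M, W *m l = 0, W *m l' = 0 & hproj p l *m l' != 0].
Proof.
move=> rW; have /two_independent_rows[u [v [uW vW uv]]] : (1 < \rank (kermx W^T))%N.
  by rewrite mxrank_ker mxrank_tr; lia.
have ann (w : 'rV_N.+1) : (w <= kermx W^T)%MS -> W *m w^T = 0.
  by move=> /sub_kermxP E; apply: trmx_inj; rewrite trmx_mul trmxK E trmx0.
have u0 : u != 0.
  apply/eqP => E; have [|/eqP] := uv 1 0; first by rewrite E scale0r scaler0 addr0.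
  by rewrite oner_eq0.
have /rV0Pn[k uk] := u0.
pose p : 'rV[K]_N.+1 := (u 0 k)^-1 *: delta_mx 0 k.
have pu : p *m u^T = 1%:M.
  rewrite -scalemxAl -rowE; apply/matrixP => i j; rewrite !ord1 !mxE mulVf //.
exists p, u^T, v^T; split; rewrite ?ann //; apply/eqP.
rewrite mulmxBl mul1mx -mulmxA [p *m v^T]mx11_scalar mul_mx_scalar => E.
have [|_ /eqP] := uv (- (p *m v^T) 0 0) 1; last by rewrite oner_eq0.
have := congr1 trmx E; rewrite trmx0 linearB linearZ /= !trmxK => <-.
by rewrite scale1r scaleNr addrC.
Qed.

(* A hyperplane through W cuts X in a hypersurface; its component containing Z
   can only be Z itself, so Z is P(W) and W has codimension 2. *)
Lemma small_eigenspace (W : 'M[K]_N.+1) (Z : set (pspace K N)) :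
  irreducible_closed Z -> Z `<=` X -> (forall x, Z x -> (rep x <= W)%MS) ->
  ~ irreducible_chain Z X 2 -> (\rank W < N)%N ->
  (N.-1 <= \rank W)%N /\ forall u, (u <= W)%MS -> ev F u = 0.
Proof.
move=> Zi ZX ZW nchain /exists_annihilators[p [l [l' [pl Wl Wl' l'0]]]].
have d1 : (1 < d)%N by lia.
have d0 : (0 < d)%N by lia.
have Wl0 (u : 'rV_N.+1) : (u <= W)%MS -> hform l u = 0.
  by move=> /submxP[D ->]; rewrite /hform -mulmxA Wl mulmx0 mxE.
have Wl'0 (u : 'rV_N.+1) : (u <= W)%MS -> (u *m l') 0 0 = 0.
  by move=> /submxP[D ->]; rewrite -mulmxA Wl' mulmx0 mxE.
have [f [e [fP fe fF Zf]]] :=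
  exists_section_component Fd d1 Fprime pl Zi ZX (fun x Zx => Wl0 _ (ZW x Zx)).
have s0 := hyperplane_section_neq0 Fd d1 Fprime pl.
have fpi := cone_divisor pl s0 fF.
have Z1i := section_component_irreducible pl N1 fP fe fpi.
have Z1X : section_component l f `<` X.
  split; first exact: section_component_sub fF.
  exact: (section_component_proper Fd d1 Fprime pl).
have Xi := hypersurface_irreducible Fd d0 Fprime (ltnW N1).
have Z1Z : section_component l f `<=` Z.
  apply: contrapT => n; apply: nchain.
  exact: irreducible_chain2 Zi Z1i Xi (conj Zf n) Z1X.
(* The component lies in [Z], hence in P(W), where [l'] vanishes. So [f] divides the cone over the
   restriction of [l'] to the hyperplane, a nonzero linear form, and is proportional to it: the
   component is [l = l' = 0]. *)
have fl' : rdvd f (lin_form (hproj p l *m l')).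
  apply: nullstellensatz => // v fv; rewrite ev_lin_form mulmxA.
  have [->|u0] := eqVneq (v *m hproj p l) 0; first by rewrite mul0mx mxE.
  have fu : ev f (v *m hproj p l) = 0 by rewrite -ev_msub fpi.
  have : section_component l f (pt (v *m hproj p l)).
    split; apply/eqP; first by rewrite (ev_rep_pt fe) // fu.
    by rewrite (ev_rep_pt (lin_form_homog l)) // ev_lin_form -/(hform l _) hform_hproj.
  move=> /Z1Z/ZW/Wl'0; have [b b0 ->] := rep_pt u0.
  by rewrite -scalemxAl mxE => /eqP; rewrite mulf_eq0 (negPf b0) => /eqP.
have lf0 : lin_form (hproj p l *m l') != 0.
  apply/eqP => L0; case/eqP: l'0; apply/colP => i.
  by have := ev_lin_form (hproj p l *m l') (delta_mx 0 i); rewrite L0 ev0 -rowE !mxE.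
have [b bE] := fl'.
have [i [j [bi fj ij]]] := homog_factors lf0 (lin_form_homog _) bE.
have f0 : f != 0 by case: fP.
have e0 := prime_homog_gt0 fP fe.
have i0 : i = 0%N by have := dhomog_uniq f0 fe fj; lia.
rewrite i0 in bi; have bC := homog0_const bi.
have b0 : ev b 0 != 0.
  by apply: contraNneq lf0 => b0; rewrite bE bC b0 mul0r.
have sub (u : 'rV_N.+1) : hform l u = 0 -> (u *m l') 0 0 = 0 -> (u <= W)%MS /\ ev F u = 0.
  move=> lu l'u; have fu : ev f u = 0.
    have := ev_lin_form (hproj p l *m l') u; rewrite mulmxA hproj_id // l'u bE bC evM evC.
    by move=> /eqP; rewrite mulf_eq0 (negPf b0) => /eqP.
  have [->|u0] := eqVneq u 0; first by rewrite sub0mx (ev_homog0 Fd).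
  have Zu : Z (pt u).
    apply: Z1Z; split; apply/eqP; first by rewrite (ev_rep_pt fe) // fu.
    by rewrite (ev_rep_pt (lin_form_homog l)) // ev_lin_form -/(hform l u) lu.
  split; last by apply/eqP; rewrite -(ev_rep_pt Fd u0); apply/eqP/ZX.
  have := ZW _ Zu; have [a a0 ->] := rep_pt u0.
  by rewrite (eqmx_scale _ a0).
split; last by move=> u uW; have [] := sub u (Wl0 u uW) (Wl'0 u uW).
have : (kermx (row_mx l l') <= W)%MS.
  apply/row_subP => k; have [||] // := sub (row k (kermx (row_mx l l'))).
    rewrite /hform -row_mul; have /eqP := mulmx_ker (row_mx l l').
    by rewrite mul_mx_row row_mx_eq0 => /andP[/eqP -> _]; rewrite row0 mxE.
  rewrite -row_mul; have /eqP := mulmx_ker (row_mx l l').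
  by rewrite mul_mx_row row_mx_eq0 => /andP[_ /eqP ->]; rewrite row0 mxE.
move=> /mxrankS; apply: leq_trans; rewrite mxrank_ker.
by have := rank_leq_col (row_mx l l'); lia.
Qed.

End FixedLocus.

Lemma mx11_eq0 (R : nzRingType) (A : 'M[R]_1) : A 0 0 = 0 -> A = 0.
Proof. by move=> A0; apply/matrixP => i j; rewrite !ord1 A0 mxE. Qed.

Lemma mx11_normalize (F : fieldType) (A : 'M[F]_1) : A 0 0 != 0 -> (A 0 0)^-1 *: A = 1%:M.
Proof. by move=> A0; apply/matrixP => i j; rewrite !ord1 !mxE mulVf. Qed.

Section Homology.
Variables (K : closedFieldType) (N : nat) (p : 'rV[K]_N.+1) (l : 'cV[K]_N.+1).
Hypothesis pl : p *m l = 1%:M.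

(** On rows: the identity on the axis [l = 0], multiplication by [om] on the center [p]. *)
Definition homology (om : K) : 'M[K]_N.+1 := 1%:M + (om - 1) *: (l *m p).

Lemma mul_homology om v : v *m homology om = v *m hproj p l + (om * hform l v) *: p.
Proof.
rewrite mul_hproj mulmxDr mulmx1 -scalemxAr mulmxA mul_hform mul_scalar_mx scalerA.
by rewrite mulrBl mul1r scalerBl addrCA addrA [RHS]addrC addrA.
Qed.

Lemma mul_p_homology om : p *m homology om = om *: p.
Proof. by rewrite mul_homology mul_p_hproj // hform_p // mulr1 add0r. Qed.

Lemma mul_hyperplane_homology om v : hform l v = 0 -> v *m homology om = v.
Proof. by move=> lv; rewrite mul_homology hproj_id // lv mulr0 scale0r addr0. Qed.

Lemma hyperplane_split v : v = v *m hproj p l + hform l v *: p.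
Proof. by rewrite mul_hproj subrK. Qed.

Lemma matrix_ext_hyperplane k (A B : 'M[K]_(N.+1, k)) :
  p *m A = p *m B -> (forall v, hform l v = 0 -> v *m A = v *m B) -> A = B.
Proof.
move=> pAB lAB; apply/row_matrixP => i; rewrite !rowE [delta_mx _ _]hyperplane_split.
by rewrite !mulmxDl -!scalemxAl pAB lAB // hform_hproj.
Qed.

Lemma exp_scale_homology a om k : (a *: homology om) ^+ k = a ^+ k *: homology (om ^+ k).
Proof.
elim: k => [|k IH].
  by rewrite !expr0 scale1r /homology subrr scale0r addr0.
apply: matrix_ext_hyperplane => [|v lv]; rewrite exprS -[_ * _ ^+ k]/(_ *m _) IH mulmxA.
  by rewrite -!scalemxAr !(mul_p_homology, =^~ scalemxAl) !scalerA !exprS; congr (_ *: _); ring.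
by rewrite -!scalemxAr !(mul_hyperplane_homology, =^~ scalemxAl) // !scalerA exprSr.
Qed.

Lemma hyperplane_vector : (0 < N)%N -> exists2 w, w != 0 & hform l w = 0.
Proof.
move=> N0; have : (0 < \rank (kermx l))%N.
  by rewrite mxrank_ker; move: (rank_leq_col l); clear -N0; lia.
rewrite lt0n mxrank_eq0 => /rowV0Pn[w /sub_kermxP wl w0].
by exists w => //; rewrite /hform wl mxE.
Qed.

(** Comparing the d-th power on the axis and at the center gives a^d = c and om^d = 1; if [om] had
    order m < d, the m-th power would already be scalar. *)
Lemma homology_primitive d a om c : (0 < N)%N -> (0 < d)%N -> c != 0 ->
  (a *: homology om) ^+ d = c%:M ->
  (forall k b, (0 < k < d)%N -> (a *: homology om) ^+ k <> b%:M) ->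
  a != 0 /\ d.-primitive_root om.
Proof.
move=> N0 d0 c0 Md Mk; have [w w0 lw] := hyperplane_vector N0.
have p0 : p != 0.
  by apply: contraTneq (oner_neq0 K) => p0; rewrite -(hform_p pl) p0 /hform mul0mx mxE eqxx.
have vinj (v : 'rV[K]_N.+1) x y : v != 0 -> x *: v = y *: v -> x = y.
  by move=> v0 /eqP; rewrite -subr_eq0 -scalerBl scaler_eq0 (negPf v0) orbF subr_eq0 => /eqP.
have ad : a ^+ d = c.
  apply: (vinj w) => //; rewrite -[RHS]mul_mx_scalar -Md exp_scale_homology -scalemxAr.
  by rewrite mul_hyperplane_homology.
have a0 : a != 0.
  by apply: contraNneq c0 => a0; rewrite -ad a0 expr0n gtn_eqF.
split=> //; have omd : om ^+ d = 1.
  apply: (mulfI c0); rewrite mulr1 -[X in X * _]ad; apply: (vinj p) => //.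
  by rewrite -[RHS]mul_mx_scalar -Md exp_scale_homology -scalemxAr mul_p_homology scalerA.
have [m mprim md] := prim_order_exists d0 omd.
have [<- //|mneq] := eqVneq m d.
case: (Mk m (a ^+ m)).
  by rewrite (prim_order_gt0 mprim) ltn_neqAle mneq dvdn_leq.
rewrite exp_scale_homology (prim_expr_order mprim) /homology subrr scale0r addr0.
by rewrite scalemx1.
Qed.

End Homology.

Section LargeFixedLocus.
Variables (K : closedFieldType) (N d : nat) (F : {mpoly K[N.+1]}).
Hypotheses (Fd : F \is d.-homog) (d2 : (2 < d)%N) (N2 : (2 < N)%N) (Fprime : prime_elt F).
Hypothesis smooth : forall x : pspace K N, F.@[hcoord x] = 0 -> exists i, (F^`M(i)).@[hcoord x] != 0.
Variables (M : 'M[K]_N.+1) (mu c : K).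
Hypotheses (FM : forall v, ev F (v *m M) = mu * ev F v).
Hypotheses (dK : d%:R != 0 :> K) (c0 : c != 0) (Mdc : M ^+ d = c%:M).
Hypothesis Mk : forall k a, (0 < k < d)%N -> M ^+ k <> a%:M.

Let d0 : (0 < d)%N. Proof. by lia. Qed.
Let d1 : (1 < d)%N. Proof. by lia. Qed.

Lemma eigenvalue_neq0 (v : 'rV[K]_N.+1) b : v != 0 -> v *m M = b *: v -> b != 0.
Proof.
move=> v0 vM; apply: contraNneq c0 => b0.
by rewrite -(eigenvalue_exp_d Mdc v0 vM) b0 expr0n gtn_eqF.
Qed.

(* Along a linear space W of codimension 2 contained in X, the differential of F
   kills all eigenspaces of M but one, B; then V = W + B and, F being
   equivariant, X is singular along B. *)
Lemma no_codim2_eigenspace a : (N.-1 <= \rank (eigenspace M a))%N ->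
  (\rank (eigenspace M a) < N)%N ->
  ~ forall u, (u <= eigenspace M a)%MS -> ev F u = 0.
Proof.
move=> rW rW' WF.
have rW1 : (1 < \rank (eigenspace M a))%N by lia.
have eigP b (u : 'rV_N.+1) : (u <= eigenspace M b)%MS -> u *m M = b *: u.
  by move=> /eigenspaceP.
have [w1 w1W w10] : exists2 w : 'rV_N.+1, (w <= eigenspace M a)%MS & w != 0.
  by apply/rowV0Pn; rewrite -mxrank_eq0; lia.
have a0 := eigenvalue_neq0 w10 (eigP _ _ w1W).
have ad := eigenvalue_exp_d Mdc w10 (eigP _ _ w1W).
pose b := mu / a ^+ d.-1.
have muE : mu = b * a ^+ d.-1 by rewrite divfK // expf_neq0.
have rowsP b' k (B : 'M_(N.+1, k)) :
    (forall u : 'rV_N.+1, (u <= eigenspace M b')%MS -> u *m B = 0) -> eigenspace M b' *m B = 0.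
  by move=> H; apply/row_matrixP => i; rewrite row_mul row0 H // row_sub.
have key (w : 'rV_N.+1) : (w <= eigenspace M a)%MS -> w != 0 ->
    exists2 u : 'rV_N.+1, (u <= eigenspace M b)%MS & (u *m gradient F w) 0 0 != 0.
  move=> wW w0; apply: contrapT => H.
  have := smooth_gradient Fd smooth w0 (WF w wW); move/eqP; apply.
  apply: (eigen_span dK c0 Mdc) => b'; apply: rowsP => u ub'; apply: mx11_eq0.
  have [bb'|bb'] := eqVneq b' b.
    by apply/eqP; apply: contrapT => /negP n; apply: H; exists u; rewrite -?bb'.
  have := gradient_invariant Fd d0 FM a0 (eigP _ _ wW) (eigP _ _ ub').
  rewrite muE => /eqP; rewrite -subr_eq0 -mulrBl -mulrBl !mulf_eq0 subr_eq0 (negPf bb').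
  by rewrite expf_eq0 (negPf a0) andbF => /eqP.
have ab : b != a.
  apply/eqP => ba; have [u] := key w1 w1W w10; rewrite ba => uW /negP[]; apply/eqP.
  by apply: gradient_zero_line => t; apply: WF; rewrite addmx_sub // scalemx_sub.
have [q qb qgrad] := key w1 w1W w10.
have q0 : q != 0 by apply: contraNneq qgrad => ->; rewrite mul0mx mxE.
(* If this eigenspace were the line of [q], the derivative of F along [q], a form of degree d - 1,
   would have a zero on the eigenspace of [a], of dimension at least 2; the whole differential of F
   would vanish there. *)
have rb : (1 < \rank (eigenspace M b))%N.
  rewrite ltnNge; apply/negP => rb1.
  have bq : (eigenspace M b <= q)%MS.
    by have := mxrank_leqif_sup qb => /geq_leqif <-; rewrite rank_rV q0.
  have d10 : (0 < d.-1)%N by rewrite -subn1 subn_gt0.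
  have [w w0 [wW qw]] := form_zero_sub (dirder_homog q Fd) d10 rW1.
  have [u ub] := key w wW w0; have /sub_rVP[t ->] := submx_trans ub bq.
  rewrite -scalemxAl mxE -dirder_gradient qw mulr0 eqxx //.
have full k (B : 'M_(N.+1, k)) : eigenspace M a *m B = 0 -> eigenspace M b *m B = 0 -> B = 0.
  move=> Ba Bb; rewrite -[B]mul1mx; apply/sub_kermxP.
  have : (eigenspace M a + eigenspace M b <= kermx B)%MS.
    by rewrite addsmx_sub; apply/andP; split; apply/sub_kermxP.
  apply: submx_trans; rewrite sub1mx -[row_full _]/(_ == _).
  have cap0 : \rank (eigenspace M a :&: eigenspace M b)%MS = 0%N.
    apply/eqP; rewrite mxrank_eq0; apply/rowV0P => v; rewrite sub_capmx => /andP[va vb].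
    have /eqP := etrans (esym (eigP _ _ va)) (eigP _ _ vb).
    by rewrite -subr_eq0 -scalerBl scaler_eq0 subr_eq0 eq_sym (negPf ab) => /eqP.
  have := mxrank_sum_cap (eigenspace M a) (eigenspace M b); rewrite cap0 addn0 => E.
  by rewrite eqn_leq rank_leq_col /= E; move: rW rb; clear; lia.
have bd := eigenvalue_exp_d Mdc q0 (eigP _ _ qb).
have b0 := eigenvalue_neq0 q0 (eigP _ _ qb).
(* The two eigenspaces span, so equality would make M^2 scalar, while 2 < d. *)
have sq : a ^+ 2 != b ^+ 2.
  apply/eqP => ab2; apply: (Mk (k := 2) (a := a ^+ 2)) => //.
  apply/eqP; rewrite -subr_eq0; apply/eqP.
  by apply: full; apply: rowsP => u /eigP/(eigenvalue_exp 2) uM; rewrite mulmxBr uM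
    mul_mx_scalar ?ab2 subrr.
have dE : d = d.-1.+1 by rewrite prednK.
have mu_b : mu != b ^+ d.
  rewrite muE {2}dE exprS; apply: contraNneq ab => /(mulfI b0) E.
  by apply/eqP; apply: (mulIf (expf_neq0 d.-1 b0)); rewrite -exprS -E -exprS -dE ad bd.
have Fq : ev F q = 0.
  have := FM q; rewrite (eigP _ _ qb) (ev_homog _ _ Fd) => /eqP.
  by rewrite -subr_eq0 -mulrBl mulf_eq0 subr_eq0 eq_sym (negPf mu_b) => /eqP.
have := smooth_gradient Fd smooth q0 Fq; move/eqP; apply; apply: full; apply: rowsP => u uW;
  apply: mx11_eq0; have := gradient_invariant Fd d0 FM b0 (eigP _ _ qb) (eigP _ _ uW);
  move=> /eqP; rewrite -subr_eq0 -mulrBl mulf_eq0 subr_eq0.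
  have -> : (a * b ^+ d.-1 == mu) = false; last by move=> /eqP.
  apply/negbTE; apply: contraNneq sq => E.
  (* Multiplication by a b makes the powers a^d and b^d appear for m = d - 1; both equal [c]. *)
  have gen m : a * b ^+ m = b * a ^+ m -> a ^+ 2 * b ^+ m.+1 = b ^+ 2 * a ^+ m.+1.
    move=> H; transitivity (b * a * (a * b ^+ m)); first by rewrite [b ^+ m.+1]exprS; ring.
    by rewrite H [a ^+ m.+1]exprS; ring.
  have := gen d.-1; rewrite -muE prednK // ad bd => /(_ E) E2.
  by apply/eqP; apply: (mulIf c0).
by rewrite -exprS -dE eq_sym (negPf mu_b) => /eqP.
Qed.

(** Diagonalizability gives an eigenvector [p'] off the hyperplane, of eigenvalue [b] other than
    [a]. If F vanished at [p'], smoothness would make its differential there nonzero on the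
    hyperplane, so mu = a b^(d-1); but F is nonzero on the hyperplane, so mu = a^d, and a^d = b^d
    would give a = b. *)
Lemma hyperplane_eigenspace_homology a : \rank (eigenspace M a) = N ->
  exists p l om, [/\ p *m l = 1%:M, M = a *: homology p l om & ev F p != 0].
Proof.
move=> rW; have eigP b (u : 'rV_N.+1) : (u <= eigenspace M b)%MS -> u *m M = b *: u.
  by move=> /eigenspaceP.
have [w1 w1W w10] : exists2 w : 'rV_N.+1, (w <= eigenspace M a)%MS & w != 0.
  by apply/rowV0Pn; rewrite -mxrank_eq0; lia.
have a0 := eigenvalue_neq0 w10 (eigP _ _ w1W).
have ad := eigenvalue_exp_d Mdc w10 (eigP _ _ w1W).
have [l' l'0 Wl'] : exists2 l' : 'cV[K]_N.+1, l' != 0 & eigenspace M a *m l' = 0.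
  have : kermx (eigenspace M a)^T != 0 by rewrite -mxrank_eq0 mxrank_ker mxrank_tr rW; lia.
  move=> /rowV0Pn[u /sub_kermxP uW u0]; exists u^T.
    by rewrite -(inj_eq (@trmx_inj _ _ _)) trmxK trmx0.
  by apply: trmx_inj; rewrite trmx_mul trmxK uW trmx0.
have [b [p' p'b p'l]] : exists b, exists2 p' : 'rV_N.+1,
    (p' <= eigenspace M b)%MS & (p' *m l') 0 0 != 0.
  apply: contrapT => H; case/eqP: l'0; apply: (eigen_span dK c0 Mdc) => b.
  apply/row_matrixP => i; rewrite row_mul row0.
  apply: mx11_eq0; apply/eqP; apply: contrapT => /negP n; apply: H.
  by exists b; exists (row i (eigenspace M b)) => //; apply: row_sub.
pose l := ((p' *m l') 0 0)^-1 *: l'.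
have pl : p' *m l = 1%:M.
  by rewrite -scalemxAr mx11_normalize.
have Wl : (eigenspace M a <= kermx l)%MS.
  by apply/sub_kermxP; rewrite -scalemxAr Wl' scaler0.
have lW (u : 'rV_N.+1) : hform l u = 0 -> (u <= eigenspace M a)%MS.
  move=> lu; have : (u <= kermx l)%MS.
    by apply/sub_kermxP; rewrite mul_hform lu -scalemx1 scale0r.
  move=> /submx_trans; apply; have := mxrank_leqif_sup Wl => /geq_leqif <-.
  have : (0 < \rank l)%N; last by rewrite rW mxrank_ker; move: (\rank l) => r; clear; lia.
  rewrite lt0n mxrank_eq0; by apply: contraTneq (oner_neq0 K) => l0; rewrite -(hform_p pl) /hform l0 mulmx0 mxE eqxx.
have p'M := eigP _ _ p'b.
have ba : b != a.
  apply: contraNneq p'l => ba; rewrite ba in p'b.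
  by move: p'b => /submxP[D ->]; rewrite -mulmxA Wl' mulmx0 mxE.
have p'0 : p' != 0 by apply: contraNneq p'l => ->; rewrite mul0mx mxE.
have b0 := eigenvalue_neq0 p'0 p'M.
have bd := eigenvalue_exp_d Mdc p'0 p'M.
exists p', l, (b / a); split=> //.
  apply: (matrix_ext_hyperplane pl) => [|v lv].
    by rewrite p'M -scalemxAr mul_p_homology // scalerA mulrC divfK.
  by rewrite (eigP _ _ (lW v lv)) -scalemxAr mul_hyperplane_homology.
apply/negP => /eqP Fp.
have dE : d = d.-1.+1 by rewrite prednK.
case/eqP: (smooth_gradient Fd smooth p'0 Fp).
apply: (matrix_ext_hyperplane pl) => [|v lv]; rewrite mulmx0; apply: mx11_eq0.
  apply: gradient_zero_line => t; rewrite -{1}[p']scale1r -scalerDl (ev_homog _ _ Fd).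
  by rewrite Fp mulr0.
have := gradient_invariant Fd d0 FM b0 p'M (eigP _ _ (lW v lv)).
move=> /eqP; rewrite -subr_eq0 -mulrBl mulf_eq0 subr_eq0.
have [muE _|_ /eqP//] := eqVneq (a * b ^+ d.-1) mu.
case/eqP: (hyperplane_section_neq0 Fd d1 Fprime pl); apply: ev_eq0 => u; rewrite ev_msub.
have := FM (u *m hproj p' l); rewrite (eigP _ _ (lW _ (hform_hproj pl u))) (ev_homog _ _ Fd).
move=> /eqP; rewrite -subr_eq0 -mulrBl mulf_eq0 subr_eq0 -muE.
have [E _|_ /eqP//] := eqVneq (a ^+ d) (a * b ^+ d.-1).
case/eqP: ba; apply: (mulIf (expf_neq0 d.-1 b0)).
by rewrite -exprS -dE -E ad bd.
Qed.

Lemma fixed_codim1_homology (Z : set (pspace K N)) : irreducible_closed Z ->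
  (forall x, Z x -> F.@[hcoord x] = 0 /\ exists b, rep x *m M = b *: rep x) ->
  ~ irreducible_chain Z [set x | F.@[hcoord x] = 0] 2 ->
  exists a p l om, [/\ p *m l = 1%:M, M = a *: homology p l om & ev F p != 0].
Proof.
move=> Zi ZF nchain.
have [a Za] := irreducible_eigenspace dK c0 Mdc Zi (fun x Zx => (ZF x Zx).2).
have ZW x : Z x -> (rep x <= eigenspace M a)%MS by move=> /Za Zx; apply/eigenspaceP.
exists a; apply: hyperplane_eigenspace_homology.
have rN : (\rank (eigenspace M a) < N.+1)%N.
  rewrite ltn_neqAle rank_leq_col andbT; apply/negP => full.
  apply: (Mk (k := 1) (a := a)); first by lia.
  have : (1%:M <= eigenspace M a)%MS by rewrite sub1mx.
  by move=> /eigenspaceP; rewrite mul1mx scalemx1 expr1.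
have [rW|] := ltnP (\rank (eigenspace M a)) N; last by lia.
have [rW1 WF] := small_eigenspace Fd d2 (ltnW N2) Fprime Zi (fun x Zx => (ZF x Zx).1) ZW nchain rW.
by case: (no_codim2_eigenspace rW1 rW WF).
Qed.

End LargeFixedLocus.

(** * Hypersurfaces invariant under a homology *)

Section RotationInvariance.
Variables (A : idomainType) (d : nat) (z : A).
Hypothesis zd : d.-primitive_root z.
Implicit Types P Q : {poly A}.

Lemma comp_polyZX P (y : A) : P \Po (y *: 'X) = \poly_(i < size P) (P`_i * y ^+ i).
Proof.
rewrite comp_polyE poly_def; apply: eq_bigr => i _.
by rewrite exprZn scalerA.
Qed.

Lemma rotation_invariant_coef P i : P \Po (z *: 'X) = P -> ~~ (d %| i)%N -> P`_i = 0.
Proof.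
move=> PE id; have := congr1 (fun Q : {poly A} => Q`_i) PE.
rewrite comp_polyZX coef_poly; case: ltnP => [_ /eqP|/leq_sizeP->//].
rewrite -[X in _ == X]mulr1 -subr_eq0 -mulrBr mulf_eq0 subr_eq0 -(prim_order_dvd zd).
by rewrite (negPf id) orbF => /eqP.
Qed.

Lemma rotation_invariant_poly P : P \Po (z *: 'X) = P ->
  P = (\poly_(k < size P) P`_(k * d)) \Po 'X^d.
Proof.
move=> PE; have d0 := prim_order_gt0 zd.
apply/polyP => i; rewrite coef_comp_poly_Xn //.
case: ifPn => [id|/(rotation_invariant_coef PE)->//].
rewrite coef_poly divnK //; case: ltnP => // si; apply: nth_default.
by apply: leq_trans si (leq_div _ _).
Qed.

Lemma rotation_norm_invariant Q :
  let P := \prod_(i < d) (Q \Po (z ^+ i *: 'X)) in P \Po (z *: 'X) = P.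
Proof.
move=> P; rewrite /P rmorph_prod /=.
have -> : \prod_(i < d) (Q \Po (z ^+ i *: 'X) \Po (z *: 'X)) =
    \prod_(i < d) (Q \Po (z ^+ i.+1 *: 'X)).
  apply: eq_bigr => i _; rewrite -comp_polyA comp_polyZ comp_polyX scalerA.
  by rewrite exprSr.
move: (prim_order_gt0 zd) (prim_expr_order zd); case: (d) => // d' _ zd1.
by rewrite big_ord_recr /= zd1 [RHS]big_ord_recl /= expr0 mulrC.
Qed.

End RotationInvariance.

Section HomologyForm.
Variables (K : closedFieldType) (N d : nat) (F : {mpoly K[N.+1]}).
Hypotheses (Fd : F \is d.-homog) (d1 : (1 < d)%N) (N1 : (1 < N)%N) (Fprime : prime_elt F).
Variables (p : 'rV[K]_N.+1) (l : 'cV[K]_N.+1) (om a mu : K).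
Hypotheses (pl : p *m l = 1%:M) (omd : d.-primitive_root om) (a0 : a != 0).
Hypothesis FM : forall v, ev F (v *m (a *: homology p l om)) = mu * ev F v.
Hypothesis Fp : ev F p != 0.
Local Notation X := [set x : pspace K N | F.@[hcoord x] = 0].
Local Notation pi := (hproj p l).

Let d0 : (0 < d)%N. Proof. exact: ltnW d1. Qed.

Lemma homology_invariant v : ev F (v *m homology p l om) = ev F v.
Proof.
have FT u : a ^+ d * ev F (u *m homology p l om) = mu * ev F u.
  by rewrite -FM -scalemxAr (ev_homog _ _ Fd).
have muE : mu = a ^+ d.
  apply: (mulIf Fp); rewrite -FT mul_p_homology // (ev_homog _ _ Fd).
  by rewrite (prim_expr_order omd) mul1r.
by apply: (mulfI (expf_neq0 d a0)); rewrite FT muE.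
Qed.

(** On the line from [v *m pi] in the direction [p], F is a polynomial of degree d invariant under T
    -> om T, so only its terms of degrees 0 and d survive. *)
Lemma homology_form v : ev F v = ev F (v *m pi) + ev F p * hform l v ^+ d.
Proof.
pose P := lpoly F (v *m pi) p.
have [sP cP] := has_top_line_expand idfun ((v *m pi) 0) (p 0) Fd.
have PE : P \Po (om *: 'X) = P.
  apply: horner_ext => t; rewrite horner_comp hornerZ hornerX !lpolyE.
  rewrite -[RHS]homology_invariant mul_homology (hproj_shift pl) (hproj_idem pl).
  by rewrite hformD hformZ (hform_hproj pl) (hform_p pl) add0r mulr1.
have Pdef : P = (ev F (v *m pi))%:P + ev F p *: 'X^d.
  apply/polyP => i; rewrite coefD coefC coefZ coefXn.
  have [->|i0] := eqVneq i 0%N.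
    rewrite -horner_coef0 lpolyE scale0r addr0 [0%N == d]ltn_eqF //.
    by rewrite mulr0 addr0.
  rewrite add0r; have [->|id] := eqVneq i d; first by rewrite mulr1.
  rewrite mulr0; have [di|di] := boolP (d %| i)%N; last exact: rotation_invariant_coef PE di.
  apply: nth_default; apply: leq_trans sP _; rewrite ltn_neqAle eq_sym id.
  by rewrite dvdn_leq // lt0n.
rewrite {1}[v](hyperplane_split p l) -lpolyE -/P Pdef.
by rewrite hornerD hornerC hornerZ hornerXn.
Qed.

Lemma homology_invariant_root z v : z ^+ d = 1 -> ev F (v *m homology p l z) = ev F v.
Proof.
move=> zd; rewrite homology_form [RHS]homology_form mul_homology.
rewrite (hproj_shift pl) (hproj_idem pl) hformD hformZ (hform_hproj pl) (hform_p pl).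
by rewrite add0r mulr1 exprMn zd mul1r.
Qed.

Lemma mul_homologyM z y (v : 'rV[K]_N.+1) : v *m homology p l z *m homology p l y = v *m homology p l (z * y).
Proof.
rewrite !mul_homology (hproj_shift pl) (hproj_idem pl) hformD hformZ (hform_hproj pl) (hform_p pl).
by rewrite add0r mulr1 mulrCA mulrA.
Qed.

(* The norm of G along the projection with center p. *)
Lemma projection_norm G e : G \is e.-homog -> exists R, [/\ R \is (d * e).-homog,
  msub pi R = R &
  forall v, ev F v = 0 -> ev R v = \prod_(i < d) ev G (v *m homology p l (om ^+ i))].
Proof.
move=> Ge; pose Q := line_expand (@mpolyC N.+1 K) (fun i => msub pi 'X_i) (p 0) G.
pose z : {mpoly K[N.+1]} := om%:MP.
have zd : d.-primitive_root z by rewrite fmorph_primitive_root.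
pose P := \prod_(i < d) (Q \Po (z ^+ i *: 'X)).
have PE := rotation_invariant_poly zd (rotation_norm_invariant zd Q).
rewrite -/P in PE.
set P' := \poly_(k < size P) P`_(k * d) in PE.
(* The product of the conjugates is [P'] evaluated at T^d, where T is the coordinate [hform l v]
   along [p]. On X, [homology_form] gives T^d = -F(v pi)/F(p), and substituting this cone eliminates
   T. *)
pose R := P'.[- (ev F p)^-1 *: msub pi F].
have Qv (v : 'rV[K]_N.+1) t : (map_poly (meval (v 0)) Q).[t] = ev G (v *m pi + t *: p).
  rewrite map_line_expand horner_line_expand -[RHS]/(mmap _ _ _) /mmap.
  apply: eq_bigr => m _; congr (_ * _); first exact: mevalC.
  rewrite /mmap1; apply: eq_bigr => i _; congr (_ ^+ _).
  rewrite [RHS]mxE; congr (_ + _); first by rewrite -[LHS]/(ev (msub pi 'X_i) v) ev_msub evX.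
  by rewrite mxE mulrC; congr (_ * _); exact: mevalC.
(* Here [v] is arbitrary and [t] is any such root, so the formula determines R everywhere; its
   homogeneity and cone property are read from it. *)
have RE (v : 'rV[K]_N.+1) t : t ^+ d = - ev F (v *m pi) / ev F p ->
    ev R v = \prod_(i < d) ev G (v *m pi + (om ^+ i * t) *: p).
  move=> tE; have sE : meval (v 0) (- (ev F p)^-1 *: msub pi F) = t ^+ d.
    rewrite -[LHS]/(ev _ v) evZ ev_msub tE; ring.
  transitivity (map_poly (meval (v 0)) P').[t ^+ d]; first by rewrite -sE horner_map.
  have -> : (map_poly (meval (v 0)) P').[t ^+ d] = (map_poly (meval (v 0)) P).[t].
    by rewrite PE map_comp_poly horner_comp map_polyXn hornerXn.
  rewrite /P rmorph_prod horner_prod; apply: eq_bigr => i _.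
  rewrite -Qv -[X in X.[_] = _]/(map_poly (meval (v 0)) (Q \Po (z ^+ i *: 'X))).
  rewrite map_comp_poly horner_comp; congr (_.[_]).
  rewrite map_polyZ map_polyX hornerZ hornerX rmorphXn; congr (_ ^+ _ * _).
  exact: mevalC.
have root (v : 'rV[K]_N.+1) : exists t, t ^+ d = - ev F (v *m pi) / ev F p.
  have /closed_rootP[t] : size ('X^d - (- ev F (v *m pi) / ev F p)%:P) != 1%N.
    by rewrite size_XnsubC // eqSS -lt0n.
  by rewrite rootE !hornerE subr_eq0 => /eqP; exists t.
exists R; split.
- apply: homog_ev => b v; have [t tE] := root v.
  rewrite (RE v t tE) (RE (b *: v) (b * t)); last first.
    by rewrite exprMn tE -scalemxAl (ev_homog _ _ Fd); ring.
  rewrite (eq_bigr (fun i : 'I_d => b ^+ e * ev G (v *m pi + (om ^+ i * t) *: p))).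
    by rewrite big_split /= prodr_const card_ord -exprM mulnC.
  move=> i _; rewrite -(ev_homog _ _ Ge) -scalemxAl scalerDr scalerA.
  by congr (ev G (_ + _ *: _)); rewrite mulrCA.
- apply: ev_inj => v; rewrite ev_msub; have [t tE] := root v.
  by rewrite (RE v t tE) (RE (v *m pi) t) ?hproj_idem.
- move=> v Fv; rewrite (RE v (hform l v)).
    by apply: eq_bigr => i _; rewrite mul_homology.
  have := homology_form v; rewrite Fv => /eqP; rewrite eq_sym addrC addr_eq0 => /eqP E.
  by rewrite -E mulrAC mulfV // mul1r.
Qed.

(** If the norm vanished on X, the prime F would divide one conjugate of [G], and [G] itself would
    vanish on X since the homologies whose ratio is a d-th root of unity preserve F. *)
Lemma projection_norm_neq0 G e R : G \is e.-homog ->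
  (forall v, ev F v = 0 -> ev R v = \prod_(i < d) ev G (v *m homology p l (om ^+ i))) ->
  (exists2 v, ev F v = 0 & ev G v != 0) -> exists2 v, ev F v = 0 & ev R v != 0.
Proof.
move=> Ge RE [v Fv Gv]; apply: contrapT => H.
have : rdvd F (\prod_(q <- [seq msub (homology p l (om ^+ i)) G | i : 'I_d <- enum 'I_d]) q).
  apply: nullstellensatz => // u Fu; rewrite big_map big_enum /= ev_prod.
  under eq_bigr do rewrite ev_msub.
  by rewrite -RE //; apply/eqP; apply: contrapT => /negP n; apply: H; exists u.
move=> /(prime_dvd_prod Fprime)[q /mapP[i _ ->] FG].
have om0 : om != 0 by rewrite (prim_root_eq0 omd) -lt0n.
have := ev_rdvd FG (v := v *m homology p l (om ^- i)).
rewrite ev_msub mul_homologyM mulVf ?expf_neq0 // homology_invariant_root; last first.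
  by rewrite exprVn -exprM mulnC exprM (prim_expr_order omd) expr1n invr1.
move=> /(_ Fv); rewrite /homology subrr scale0r addr0 mulmx1 => Gv0.
by rewrite Gv0 eqxx in Gv.
Qed.

Lemma homology_eigenvector (v : 'rV[K]_N.+1) b : v != 0 -> ev F v = 0 ->
  v *m (a *: homology p l om) = b *: v -> hform l v = 0.
Proof.
move=> v0 Fv; rewrite -scalemxAr mul_homology => E.
apply/eqP; apply: contrapT => /negP h0.
have := congr1 (hform l) E; rewrite !hformZ hformD hformZ (hform_hproj pl) (hform_p pl).
rewrite add0r mulr1 mulrA => /(mulIf h0) bE.
have := congr1 (mulmx^~ pi) E; rewrite -!scalemxAl -bE (hproj_shift pl) (hproj_idem pl) => /eqP.
rewrite -subr_eq0 -scalerBl scaler_eq0 -[X in X - _]mulr1 -mulrBr mulf_eq0 (negPf a0) /=.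
rewrite subr_eq0 => /orP[/eqP om1|/eqP vpi].
  have := prim_order_dvd omd 1; rewrite -om1 expr1n eqxx dvdn1 => /eqP dE.
  by move: (d1); rewrite dE.
move: Fv; rewrite homology_form vpi (ev_homog0 Fd) // add0r => /eqP.
by rewrite mulf_eq0 (negPf Fp) expf_eq0 (negPf h0) andbF.
Qed.

(** Let [c 1] be the middle term of a chain and [G] a form vanishing on it but not on [c 2]. The
    norm of [G] is a cone, nonzero on X, and one of its prime factors [q] vanishes on [c 1], hence
    on the component. Both [q] and [f] are cones, so [f] divides [q] and is associate to it. Thus
    [f] vanishes on [c 1], where [homology_form] reduces F = 0 to the vanishing of [hform l]: [c 1]
    lies in the component, a contradiction. *)
Lemma section_component_codim1 f e : prime_elt f -> f \is e.-homog ->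
  rdvd f (msub pi F) -> ~ irreducible_chain (section_component l f) X 2.
Proof.
move=> fP fe fF [c [c0 cX cc]].
have s0 := hyperplane_section_neq0 Fd d1 Fprime pl.
have fpi := cone_divisor pl s0 fF.
have [c1i c1X] := cX 1%N isT; have [_ c2X] := cX 2%N isT.
have [Zc1 nc1Z] := cc 0%N isT; rewrite c0 in Zc1 nc1Z.
have [_ nc2] := cc 1%N isT.
have [x c2x nx] : exists2 x, c 2%N x & ~ c 1%N x.
  by apply: contrapT => H; apply: nc2 => x c2x; apply: contrapT => nx; apply: H; exists x.
have [[S [hS c1E]] _ _] := c1i.
have [G SG Gx] : exists2 G, S G & ev G (rep x) != 0.
  apply: contrapT => H; apply: nx; rewrite c1E => G SG.
  by apply/eqP; apply: contrapT => /negP n; apply: H; exists G.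
have [k Gk] := hS G SG.
have [R [Rh Rpi RE]] := projection_norm Gk.
have [v Fv Rv] : exists2 v, ev F v = 0 & ev R v != 0.
  by apply: (projection_norm_neq0 Gk RE); exists (rep x) => //; apply: c2X.
have R0 : R != 0 by apply: contraNneq Rv => ->; rewrite ev0.
have c1R : vanish (c 1%N) R.
  move=> y c1y; rewrite RE; last exact: c1X.
  move: c1y; rewrite c1E => /(_ G SG) Gy.
  apply/eqP; rewrite prodf_seq_eq0; apply/hasP; exists (Ordinal d0); rewrite ?mem_index_enum //=.
  by rewrite /homology subrr scale0r addr0 mulmx1 -ev_hcoord Gy.
have [u [s [uU sP RsE]]] := mpoly_prime_factorization R0.
have sR q : q \in s -> rdvd q R.
  by move=> qs; rewrite RsE; apply: rdvd_mull; rewrite (big_rem q) //=; apply: rdvd_mulr; apply: rdvd_refl.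
have [||q qs c1q] := irreducible_vanish_prod c1i uU (s := s).
- by move=> q /sR/(prime_dvd_homog R0 Rh).
- by rewrite -RsE.
have qP := sP q qs; have [j qj] := prime_dvd_homog R0 Rh (sR q qs).
have qpi : msub pi q = q by apply: (cone_divisor pl (G := R)); rewrite ?Rpi //; apply: sR.
have fq : rdvd f q.
  apply: nullstellensatz => // w fw; rewrite -qpi ev_msub.
  have [->|w0] := eqVneq (w *m pi) 0; first exact: ev_homog0 qj (prime_homog_gt0 qP qj).
  apply/eqP; rewrite -(ev_rep_pt qj w0); apply/eqP/c1q/Zc1; split; apply/eqP.
    by rewrite (ev_rep_pt fe w0) -ev_msub fpi fw.
  by rewrite (ev_rep_pt (lin_form_homog l) w0) ev_lin_form -/(hform l _) hform_hproj.
have [b qE] := fq; have [_ _ qI] := prime_elt_irreducible qP.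
have [bU|fU] := qI _ _ qE; last by case: fP; rewrite fU.
have [b' b'0 bE] := mpoly_unitP _ bU.
apply: nc1Z => y c1y; have fy : ev f (rep y) = 0.
  by have := c1q y c1y; rewrite qE evM bE evC => /eqP; rewrite mulf_eq0 (negPf b'0) => /eqP.
split=> //; have := homology_form (rep y); rewrite -ev_hcoord (c1X _ c1y) -ev_msub.
rewrite (ev_rdvd fF fy) add0r => /esym/eqP; rewrite mulf_eq0 (negPf Fp) expf_eq0 d0 /=.
by rewrite ev_lin_form => /eqP.
Qed.

(** The center is off X, so the fixed points are those of the axis. X lies in no hyperplane, which
    gives chains of length 1; a component of the section by the axis starts no chain of length 2. *)
Lemma homology_fixed_codim (g : pspace K N -> pspace K N) :
  (forall x, X x -> g x = pt (rep x *m (a *: homology p l om))) -> has_codim (Fix X g) X 1.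
Proof.
move=> gM; have Xi := hypersurface_irreducible Fd d0 Fprime (ltnW N1).
have s0 := hyperplane_section_neq0 Fd d1 Fprime pl.
have fixh x : Fix X g x <-> X x /\ hform l (rep x) = 0.
  split=> [[Xx]|[Xx hx]].
    rewrite gM // -[x in RHS]pt_rep => E; split=> //.
    have [T0|T0] := eqVneq (rep x *m (a *: homology p l om)) 0.
      by apply: (homology_eigenvector (rep_neq0 x) Xx (b := 0)); rewrite T0 scale0r.
    have [b _ bE] := pt_eq T0 (rep_neq0 x) E.
    exact: homology_eigenvector (rep_neq0 x) Xx bE.
  split=> //; rewrite gM // -scalemxAr mul_hyperplane_homology // pt_scale // pt_rep //.
split.
  move=> Z Zi ZFix; exists (fun i => if i is 0%N then Z else X); split=> //.
    by move=> [|[|]] // _; split=> //; move=> x /ZFix/fixh[].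
  move=> [|] // _; split; first by move=> x /ZFix/fixh[].
  move=> XZ; apply: (not_vanish_lin_form Fd d1 Fprime (c := l)).
    by apply: contraTneq (oner_neq0 K) => l0; rewrite -(hform_p pl) /hform l0 mulmx0 mxE eqxx.
  by move=> x /XZ/ZFix/fixh[_]; rewrite ev_lin_form.
have [u [s [uU sP FE]]] := mpoly_prime_factorization s0.
(* A prime factor exists: a form of degree d > 0 vanishes at 0 and is not a unit. *)
case: s sP FE => [_ FE|f s sP FE].
  have := ev_homog0 (msub_homog pi Fd) d0; have [b b0 uE] := mpoly_unitP _ uU.
  by rewrite FE big_nil mulr1 uE evC => /eqP; rewrite (negPf b0).
have fP := sP f (mem_head _ _).
have fF : rdvd f (msub pi F) by exists (u * \prod_(q <- s) q); rewrite FE big_cons; ring.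
have [e fe] := prime_dvd_homog s0 (msub_homog _ Fd) fF.
have fpi := cone_divisor pl s0 fF.
move=> H; apply: (section_component_codim1 fP fe fF).
have Zi := section_component_irreducible pl N1 fP fe fpi.
apply: (H _ Zi).
move=> x Zx; apply/fixh; split; first exact: section_component_sub fF _ Zx.
by case: Zx => _; rewrite ev_lin_form.
Qed.

End HomologyForm.

(** * Kummer extensions *)

Section SubfieldType.
Variables (E : fieldType) (P : {pred E}).

(** The closure proof is an argument so that instances can be attached to a predicate that is a
    variable. *)
Definition subfield_pred (_ : divring_closed P) : {pred E} := P.

Variable HP : divring_closed P.

HB.instance Definition _ := GRing.isDivringClosed.Build E (subfield_pred HP) HP.

Record subfield_type := SubfieldType {
  subfield_val :> E;
  _ : subfield_val \in subfield_pred HP }.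
HB.instance Definition _ := [isSub for subfield_val].
HB.instance Definition _ := [Choice of subfield_type by <:].
HB.instance Definition _ := [SubChoice_isSubIntegralDomain of subfield_type by <:].
HB.instance Definition _ := [SubIntegralDomain_isSubField of subfield_type by <:].

End SubfieldType.

Lemma exists_subfield_type (E : fieldType) (P : {pred E}) : divring_closed P ->
  exists (k0 : fieldType) (iota : {rmorphism k0 -> E}), forall x, x \in P <-> exists c, iota c = x.
Proof.
move=> HP; exists (subfield_type HP), (val : subfield_type HP -> E) => x.
by split=> [xP|[c <-]]; [exists (SubfieldType (HP := HP) xP) | exact: (valP c)].
Qed.

Section Kummer.
Variables (k0 E : fieldType) (iota : {rmorphism k0 -> E}) (y : E) (a z : k0) (d : nat).
Variable s : {rmorphism E -> E}.
Hypotheses (zd : d.-primitive_root z) (y0 : y != 0) (yd : y ^+ d = iota a).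
Hypotheses (s_iota : forall c, s (iota c) = iota c) (sy : s y = iota z * y).
Hypothesis generated : forall u, exists q : {poly k0}, u = (map_poly iota q).[y].

Let p : {poly k0} := 'X^d - a%:P.
Let d0 : (0 < d)%N. Proof. exact: prim_order_gt0 zd. Qed.

Let root_p : root (map_poly iota p) y.
Proof. by rewrite rmorphB /= map_polyXn map_polyC rootE !hornerE yd subrr. Qed.

Let size_p : size p = d.+1.
Proof. exact: size_XnsubC. Qed.

Let p_neq0 : p != 0. Proof. by rewrite -size_poly_eq0 size_p. Qed.

Lemma kummer_conjugate_root (q : {poly k0}) i :
  root (map_poly iota q) y -> root (map_poly iota q) (iota (z ^+ i) * y).
Proof.
move=> qy; elim: i => [|i IH]; first by rewrite expr0 rmorph1 mul1r.
have -> : iota (z ^+ i.+1) * y = s (iota (z ^+ i) * y).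
  by rewrite rmorphM s_iota sy mulrA -rmorphM exprSr.
have -> : map_poly iota q = map_poly s (map_poly iota q).
  by apply/polyP => j; rewrite !coef_map /= s_iota.
by rewrite fmorph_root.
Qed.

(** A nonzero polynomial over [k0] vanishing at [y] vanishes at the conjugates z^i y, which are d
    distinct elements, so its degree is at least d. *)
Lemma kummer_irreducible : irreducible_poly p.
Proof.
apply/(subfx_irreducibleP root_p p_neq0) => q qy q0; rewrite size_p.
pose rs := [seq iota (z ^+ i) * y | i <- seq.iota 0 d].
have : (size rs < size (map_poly iota q))%N.
  apply: max_poly_roots.
  - by rewrite map_poly_eq0.
  - by apply/allP => _ /mapP[i _ ->]; apply: kummer_conjugate_root.
  - rewrite map_inj_in_uniq ?iota_uniq // => i j; rewrite !mem_iota !add0n /= => id jd.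
    move=> /(mulIf y0)/fmorph_inj/eqP; rewrite (eq_prim_root_expr zd) !modn_small //.
    by move=> /eqP.
by rewrite size_map size_iota size_map_poly.
Qed.

(** [L] is k0[T]/(T^d - a), mapped onto E by T -> y. It is generated by the distinct roots z^i r of
    T^d - a, hence Galois, and normality provides [t] with t r = z r, which matches [s] on the
    generator. *)
Lemma kummer_model : exists (L : splittingFieldType k0) (phi : {rmorphism L -> E})
    (t : gal_of {:L}),
  [/\ bijective phi, forall c, phi c%:A = iota c, galois 1 {:L},
      forall u, s (phi u) = phi (t u) & generator 'Gal({:L} / 1)%g t].
Proof.
pose L0 : fieldExtType k0 := SubFieldExtType root_p kummer_irreducible.
pose phi : {rmorphism L0 -> E} := @subfx_inj _ _ iota y p.
pose r : L0 := subfx_root iota y p.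
have phir : phi r = y by apply: subfx_inj_root.
have phiA c : phi c%:A = iota c by apply: subfx_inj_base.
have phi_inj : injective phi by apply: fmorph_inj.
have phi_map (q : {poly k0}) w : phi (map_poly (in_alg L0) q).[w] = (map_poly iota q).[phi w].
  rewrite -horner_map -map_poly_comp; congr (_.[_]).
  by apply: eq_map_poly => c; apply: phiA.
have phi_bij : bijective phi.
  have /choice[psi psiE] : forall u, exists x, phi x = u.
    move=> u; have [q ->] := generated u.
    by exists (map_poly (in_alg L0) q).[r]; rewrite phi_map phir.
  by exists psi => [x|u]; [apply: phi_inj; rewrite psiE | apply: psiE].
have rgen (x : L0) : exists q : {poly k0}, x = (map_poly (in_alg L0) q).[r].
  have [q qE] := generated (phi x); exists q.
  by apply: phi_inj; rewrite phi_map phir.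
pose pL : {poly L0} := map_poly (in_alg L0) p.
pose rs := [seq (z ^+ i)%:A * r | i <- seq.iota 0 d].
have r0 : r != 0 by rewrite -(inj_eq phi_inj) phir rmorph0.
have rsU : uniq rs.
  rewrite map_inj_in_uniq ?iota_uniq // => i j; rewrite !mem_iota !add0n /= => id jd.
  move=> /(mulIf r0)/(fmorph_inj (in_alg L0))/eqP; rewrite (eq_prim_root_expr zd) !modn_small //.
  by move=> /eqP.
have pLE : pL = \prod_(x <- rs) ('X - x%:P).
  rewrite [LHS](@all_roots_prod_XsubC _ _ rs).
  - rewrite lead_coef_map (_ : lead_coef p = 1) ?rmorph1 ?scale1r //.
    by apply/monicP; apply: monicXnsubC.
  - by rewrite size_map_poly size_p size_map size_iota.
  - apply/allP => _ /mapP[i _ ->]; rewrite rootE -(inj_eq phi_inj) phi_map rmorph0.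
    rewrite rmorphM phiA phir; exact: kummer_conjugate_root.
  - by rewrite uniq_rootsE.
have pLover : pL \is a polyOver 1%VS.
  exact: (alg_polyOver 1%AS).
have rin : r \in rs.
  by apply/mapP; exists 0%N; rewrite ?mem_iota ?d0 // expr0 scale1r mul1r.
have splits : splittingFieldFor 1 pL {:L0}.
  exists rs; first by rewrite pLE eqpxx.
  apply/eqP; rewrite eqEsubv subvf /=; apply/subvP => x _.
  have [q ->] := rgen x.
  have rsr : r \in <<1 & rs>>%VS by apply: seqv_sub_adjoin.
  by apply: rpred_horner => //; apply: alg_polyOver.
have LM := FieldExt_isSplittingField.Build k0 L0 (ex_intro2 _ _ pL pLover splits).
pose L : splittingFieldType k0 := HB.pack L0 LM.
have galL : galois 1 {:L}.
  apply/splitting_galoisField; exists pL; split=> //.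
  by rewrite pLE separable_prod_XsubC.
have [q1 q1E] : exists q : {poly k0}, minPoly 1 (r : L) = map_poly (in_alg L0) q.
  have /polyOver1P[q qE] := minPolyOver 1 (r : L); exists q; exact: qE.
have [_ _ nL] := and3P galL.
have [t tG tr] : exists2 t : gal_of {:L}, t \in 'Gal({:L} / 1)%g & t r = z%:A * r.
  apply: (normalField_root_minPoly (sub1v _) nL (memvf _)).
  have := root_minPoly 1%AS (r : L); rewrite q1E !rootE.
  rewrite -!(inj_eq phi_inj) !phi_map !rmorph0 rmorphM phiA phir.
  by move=> /(@kummer_conjugate_root q1 1); rewrite expr1.
exists L, phi, t; split=> //.
- move=> u; have [q ->] := rgen u; rewrite phi_map phir.
  have -> : t (map_poly (in_alg L0) q).[r] = (map_poly (in_alg L0) q).[t r].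
    rewrite -horner_map; congr (_.[_]); apply/polyP => i; rewrite !coef_map /=.
    by rewrite linearZ /= rmorph1.
  rewrite tr phi_map rmorphM phiA phir -sy -horner_map; congr (_.[_]).
  by apply/polyP => i; rewrite !coef_map /= s_iota.
- have tk k : (t ^+ k)%g r = (z ^+ k)%:A * r.
    elim: k => [|k IH]; first by rewrite expg0 gal_id expr0 scale1r mul1r.
    rewrite expgSr galM ?memvf // IH rmorphM /= linearZ /= rmorph1 tr.
    by rewrite mulrA -scalerAl mul1r scalerA exprSr.
  (* The powers of [t] multiply [r] by the powers of [z]; as the Galois group has order d, [t]
     generates it. *)
  have dt : (d %| #[t]%g)%N.
    rewrite (prim_order_dvd zd); have := tk #[t]%g; rewrite expg_order gal_id.
    rewrite -{1}[r]mul1r => /(mulIf r0) z1; apply/eqP; apply: (fmorph_inj (in_alg L0)).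
    by rewrite /= scale1r -z1.
  have cardG : #|'Gal({:L} / 1)%g| = d.
    rewrite -(galois_dim galL) dimv1 divn1 dimvf /dim /= size_p //.
  rewrite /generator eq_sym eqEcard cycle_subG tG cardG /=.
  by rewrite dvdn_leq // order_gt0.
Qed.

End Kummer.

(** * Rational functions and projections *)

Section RationalFunctions.
Variables (K : closedFieldType) (N : nat) (X : set (pspace K N)).
Local Notation poly := {mpoly K[N.+1]}.
Local Notation I := (vanishing_ideal X).
Implicit Types (A B : poly) (phi : ratfun X) (x : pspace K N).

Definition admissible A B := (exists e, A \is e.-homog /\ B \is e.-homog) /\ regular_mod X B.

Lemma vanishing_ideal0 : I 0.
Proof. by move=> v _; rewrite meval0. Qed.

Lemma vanishing_idealM A B : I A -> I (A * B).
Proof. by move=> IA v Xv; rewrite mevalM IA // mul0r. Qed.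

Lemma admissible_neq0 A B : admissible A B -> B != 0.
Proof. by case=> _; apply: regular_mod_neq0. Qed.

Lemma admissible1 : admissible 1 1.
Proof. by split; [exists 0%N; rewrite dhomog1 | move=> G; rewrite mul1r]. Qed.

Lemma admissibleB A B A' B' : admissible A B -> admissible A' B' ->
  admissible (A * B' - A' * B) (B * B').
Proof.
move=> [[e [hA hB]] rB] [[e' [hA' hB']] rB']; split; last exact: regular_modM.
exists (e + e')%N; rewrite (dhomogM hB hB'); split=> //.
by rewrite rpredB ?(dhomogM hA hB') // addnC (dhomogM hA' hB).
Qed.

Lemma admissibleM A B A' B' : admissible A B -> admissible A' B' ->
  admissible (A * A') (B * B').
Proof.
move=> [[e [hA hB]] rB] [[e' [hA' hB']] rB']; split; last exact: regular_modM.
by exists (e + e')%N; rewrite (dhomogM hB hB') (dhomogM hA hA').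
Qed.

(** The default value 0 is taken when the quotient is not a fraction on X; admissible pairs never
    meet it. *)
Definition fraction_elt A B : fraction_ring X :=
  insubd (0 : fraction_ring X) (tofrac A / tofrac B).

Definition rfrac A B : ratfun X := (\pi_(ratfun X) (fraction_elt A B))%qT.

Lemma fraction_eltE A B : admissible A B ->
  fraction_val (fraction_elt A B) = tofrac A / tofrac B.
Proof.
move=> [AB rB]; rewrite [LHS]insubdK //.
by apply/asboolP; exists A, B; split.
Qed.

Lemma rfrac_of_fraction (u : fraction_ring X) A B :
  is_fraction_on X (fraction_val u) A B -> (\pi_(ratfun X) u)%qT = rfrac A B.
Proof.
move=> [AB rB uE]; congr (\pi_(ratfun X) _)%qT; apply: val_inj.
by rewrite [RHS]fraction_eltE.
Qed.

Lemma rfracP phi : exists A B, admissible A B /\ phi = rfrac A B.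
Proof.
rewrite -[phi]reprK; set u := generic_quotient.repr phi.
have /asboolP[A [B AB]] := valP u; exists A, B.
by split; [case: AB | apply: rfrac_of_fraction].
Qed.

Lemma zero_on_fraction_elt (u : fraction_ring X) A B : is_fraction_on X (fraction_val u) A B ->
  (u \in @zero_on K N X) <-> I A.
Proof.
move=> [AB rB uE]; split=> [/asboolP[A' [B' [[_ rB' uE'] IA']]]|IA]; last first.
  by apply/asboolP; exists A, B.
have /eqP := etrans (esym uE) uE'; rewrite eqr_div ?tofrac_eq0 ?(regular_mod_neq0 rB) ?(regular_mod_neq0 rB') //.
rewrite -!tofracM tofrac_eq => /eqP E; apply: (rB'); rewrite mulrC E.
exact: vanishing_idealM.
Qed.

Lemma fraction_eltP A B : admissible A B -> is_fraction_on X (fraction_val (fraction_elt A B)) A B.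
Proof. by move=> AB; split; [case: AB | case: AB | apply: fraction_eltE]. Qed.

Lemma rfracB A B A' B' : admissible A B -> admissible A' B' ->
  rfrac A B - rfrac A' B' = rfrac (A * B' - A' * B) (B * B').
Proof.
move=> AB AB'; rewrite -[LHS]rmorphB; apply: rfrac_of_fraction.
have [? ?] := admissibleB AB AB'; split=> //.
by rewrite fraction_valB !fraction_eltE // tofrac_divB // ?(admissible_neq0 AB) ?(admissible_neq0 AB').
Qed.

Lemma rfracM A B A' B' : admissible A B -> admissible A' B' ->
  rfrac A B * rfrac A' B' = rfrac (A * A') (B * B').
Proof.
move=> AB AB'; rewrite -[LHS]rmorphM; apply: rfrac_of_fraction.
have [? ?] := admissibleM AB AB'; split=> //.
by rewrite fraction_valM !fraction_eltE // tofrac_divM.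
Qed.

Lemma rfrac1 : rfrac 1 1 = 1.
Proof.
rewrite -[RHS](rmorph1 (\pi_(ratfun X))%qT); apply/esym/rfrac_of_fraction.
have [? ?] := admissible1; split=> //.
by rewrite tofrac_div1.
Qed.

Lemma rfrac_eq0 A B : admissible A B -> rfrac A B = 0 <-> I A.
Proof.
move=> AB; rewrite -(zero_on_fraction_elt (fraction_eltP AB)).
rewrite -[0](rmorph0 (\pi_(ratfun X))%qT).
have E := Quotient.idealrBE (@zero_on K N X) (fraction_elt A B) 0.
rewrite subr0 in E; rewrite E; split=> [H|/eqP//]; exact/eqP.
Qed.

Lemma rfrac_eq A B A' B' : admissible A B -> admissible A' B' ->
  rfrac A B = rfrac A' B' <-> I (A * B' - A' * B).
Proof.
move=> AB AB'; rewrite -(rfrac_eq0 (admissibleB AB AB')) -rfracB //.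
by split=> [->|/eqP]; rewrite ?subrr // subr_eq0 => /eqP.
Qed.

Lemma ratfun_valueP phi x c : ratfun_value phi x c <->
  exists A B, [/\ admissible A B, phi = rfrac A B, ev B (rep x) != 0 &
                  c = ev A (rep x) / ev B (rep x)].
Proof.
split=> [[u [A [B [phiE uAB Bx cE]]]]|[A [B [AB phiE Bx cE]]]].
  exists A, B; split=> //; first by case: uAB.
  by rewrite phiE; apply: rfrac_of_fraction.
by exists (fraction_elt A B), A, B; split=> //; apply: fraction_eltP.
Qed.

Lemma cone_rep x : X x -> affine_cone X (rep x).
Proof. by move=> Xx; right; exists x => //; apply: memv_pick. Qed.

(** Cross-multiplied because the value may be computed from another representative, and [B] may
    vanish at [x]. *)
Lemma rfrac_value_eq A B x c : X x -> admissible A B -> ratfun_value (rfrac A B) x c ->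
  ev A (rep x) = c * ev B (rep x).
Proof.
move=> Xx AB /ratfun_valueP[A' [B' [AB' E B'x ->]]].
have /(_ (rep x) (cone_rep Xx)) := (rfrac_eq AB AB').1 E.
rewrite -/(ev _ _) evB !evM => /eqP; rewrite subr_eq0 => /eqP E'.
by rewrite mulrAC -E' mulfK.
Qed.

End RationalFunctions.

Section HyperplaneOfForm.
Variables (K : closedFieldType) (N : nat).

Lemma vspace_hyperplane (U : {vspace 'rV[K]_N.+1}) : \dim U = N ->
  exists2 l : 'cV[K]_N.+1, l != 0 & forall v, (v \in U) = (hform l v == 0).
Proof.
move=> dU; pose B : 'M[K]_(\dim U, N.+1) := \matrix_i (vbasis U)`_i.
have rB : (\rank B <= N)%N by have := rank_leq_row B; rewrite {2}dU.
have : kermx B^T != 0 by rewrite -mxrank_eq0 mxrank_ker mxrank_tr; move: (\rank B) rB => r; clear; lia.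
move=> /rowV0Pn[w /sub_kermxP wB w0]; exists w^T.
  by rewrite -(inj_eq (@trmx_inj _ _ _)) trmxK trmx0.
pose f : 'Hom('rV[K]_N.+1, 'rV[K]_1) := linfun (mulmxr w^T).
have fE v : f v = (hform w^T v)%:M by rewrite lfunE /= mul_hform.
have UF : (U <= lker f)%VS.
  apply/subvP => v /coord_vbasis ->; apply: rpred_sum => i _; apply: rpredZ.
  rewrite memv_ker fE /hform; have := congr1 trmx wB.
  rewrite trmx_mul trmxK trmx0 => /(congr1 (row i)); rewrite row_mul row0.
  by rewrite rowK => ->; rewrite mxE -scalemx1 scale0r.
have [k wk] := rV0Pn _ w0.
suff -> : U = lker f.
  move=> v; rewrite memv_ker fE; apply/eqP/eqP => [E|->]; last by rewrite -scalemx1 scale0r.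
  by have := congr1 (fun A : 'M[K]_1 => A 0 0) E; rewrite !mxE eqxx.
apply/eqP; rewrite eqEdim UF dU /=.
have := limg_ker_dim f fullv; rewrite capfv dimvf /dim /= mul1n => E.
suff : (0 < \dim (f @: fullv))%N.
  by move: E; move: (\dim (lker f)) (\dim (f @: fullv)) => r1 r2; clear; lia.
rewrite lt0n dimv_eq0; apply/eqP => f0; have : f (delta_mx 0 k) \in (f @: fullv)%VS by rewrite memv_img ?memvf.
rewrite f0 memv0 fE => /eqP/(congr1 (fun A : 'M[K]_1 => A 0 0)).
by rewrite !mxE eqxx /hform -rowE !mxE => /eqP; rewrite (negPf wk).
Qed.

End HyperplaneOfForm.

Section PulledBackField.
Variables (K : closedFieldType) (n d : nat) (F : {mpoly K[n.+2]}).
Hypotheses (Fd : F \is d.-homog) (d1 : (1 < d)%N) (Fprime : prime_elt F).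
Variables (p : 'rV[K]_n.+2) (l : 'cV[K]_n.+2).
Hypotheses (pl : p *m l = 1%:M) (Fp : ev F p != 0).
Local Notation X := [set x : pspace K n.+1 | F.@[hcoord x] = 0].
Local Notation pi := (hproj p l).
Local Notation H := [set x : pspace K n.+1 | hform l (rep x) = 0].
Implicit Types (A B G : {mpoly K[n.+2]}).

Let d0 : (0 < d)%N. Proof. exact: ltnW d1. Qed.

Lemma p_neq0 : p != 0.
Proof.
by apply: contraTneq (oner_neq0 K) => p0; rewrite -(hform_p pl) p0 /hform mul0mx mxE eqxx.
Qed.

Lemma hform_pt v : v != 0 -> (hform l (rep (pt v)) == 0) = (hform l v == 0).
Proof. by move=> v0; rewrite /hform -!ev_lin_form (ev_rep_pt (lin_form_homog l)). Qed.

Lemma affine_cone_hyperplane v : affine_cone H v <-> hform l v = 0.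
Proof.
split=> [[->|[x Hx]]|lv]; first by rewrite /hform mul0mx mxE.
  by rewrite line_rep => /vlineP[c ->]; rewrite hformZ Hx mulr0.
have [->|v0] := eqVneq v 0; first by left.
right; exists (pt v); last by rewrite line_pt // memv_line.
by apply/eqP; rewrite /= hform_pt // lv.
Qed.

Lemma vanishing_ideal_hyperplane G : vanishing_ideal H G <-> msub pi G = 0.
Proof.
split=> [IG|G0 v /affine_cone_hyperplane lv].
  by apply: ev_eq0 => v; rewrite ev_msub; apply/IG/affine_cone_hyperplane/hform_hproj.
by have := ev_msub pi G v; rewrite G0 ev0 hproj_id // => /esym.
Qed.

Lemma msubM M A B : msub M (A * B) = msub M A * msub M B :> {mpoly K[n.+2]}.
Proof. by apply: ev_inj => v; rewrite evM !ev_msub evM. Qed.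

Lemma msubB M A B : msub M (A - B) = msub M A - msub M B :> {mpoly K[n.+2]}.
Proof. by apply: ev_inj => v; rewrite evB !ev_msub evB. Qed.

Lemma regular_mod_hyperplane B : regular_mod H B <-> msub pi B != 0.
Proof.
split=> [rB|B0 G /vanishing_ideal_hyperplane].
  apply/eqP => B0; apply: (@vanishing_ideal_not1 K n.+1 H); apply: rB.
  by apply/vanishing_ideal_hyperplane; rewrite mulr1.
rewrite msubM => /eqP; rewrite mulf_eq0 (negPf B0) => /eqP.
by move/vanishing_ideal_hyperplane.
Qed.

Lemma regular_mod_hypersurface B :
  regular_mod X B <-> exists2 v, ev F v = 0 & ev B v != 0.
Proof.
split=> [rB|[v Fv Bv] G].
  apply: contrapT => nB; apply: (@vanishing_ideal_not1 K n.+1 X); apply: rB.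
  apply/(vanishing_idealE Fd d0) => v Fv; rewrite mulr1.
  by apply/eqP; apply: contrapT => /negP Bv; apply: nB; exists v.
move=> /(vanishing_ideal_rdvd Fd d0 Fprime); have [_ _ FP] := Fprime.
move=> /FP[FB|FG]; last exact/(vanishing_ideal_rdvd Fd d0 Fprime).
by move: Bv; rewrite (ev_rdvd FB Fv) eqxx.
Qed.

Lemma section_lift v : exists t, ev F (v *m pi + t *: p) = 0.
Proof. exact: form_root Fd d0 Fp. Qed.

(** As [p] is off X, the projection maps X onto the hyperplane, so a nonzero cone is nonzero
    somewhere on X. *)
Lemma regular_mod_cone B : msub pi B != 0 -> regular_mod X (msub pi B).
Proof.
move=> /ev_neq0[v Bv]; have [t Ft] := section_lift v.
apply/regular_mod_hypersurface; exists (v *m pi + t *: p) => //.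
by move: Bv; rewrite !ev_msub hproj_shift // hproj_idem.
Qed.

Lemma admissible_cone e A B : A \is e.-homog -> B \is e.-homog -> msub pi B != 0 ->
  admissible X (msub pi A) (msub pi B).
Proof.
move=> Ae Be B0; split; last exact: regular_mod_cone.
by exists e; split; apply: msub_homog.
Qed.

Lemma admissible_hyperplane e A B : A \is e.-homog -> B \is e.-homog -> msub pi B != 0 ->
  admissible H A B.
Proof. by move=> Ae Be B0; split; [exists e | apply/regular_mod_hyperplane]. Qed.

Lemma projection_pt x y : projection (pt p) H x y -> rep x *m pi != 0 /\ y = pt (rep x *m pi).
Proof.
move=> [xp Hy]; rewrite line_pt ?p_neq0 // !line_rep => /subvP/(_ _ (memv_line _)).
move=> /memv_addP[_ /vlineP[s ->] [_ /vlineP[t ->] yE]].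
have {}yE : rep y = t *: (rep x *m pi).
  by rewrite -[LHS](hproj_id p Hy) yE mulmxDl -!scalemxAl mul_p_hproj // scaler0 add0r.
have t0 : t != 0 by apply: contraNneq (rep_neq0 y) => t0; rewrite yE t0 scale0r.
split; first by apply: contraNneq (rep_neq0 y) => v0; rewrite yE v0 scaler0.
by rewrite -[LHS]pt_rep yE pt_scale.
Qed.

Lemma pt_projection x : rep x *m pi != 0 -> projection (pt p) H x (pt (rep x *m pi)).
Proof.
move=> v0; split.
- apply: contraNneq v0 => ->; have [c c0 ->] := rep_pt p_neq0.
  by rewrite -scalemxAl mul_p_hproj // scaler0.
- by apply/eqP; rewrite /= hform_pt // hform_hproj.
- rewrite !line_pt ?p_neq0 // line_rep -memvE mul_hproj addrC -scaleNr.
  by rewrite memv_add // ?memvZ // memv_line.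
Qed.

Lemma projection_neq0 x : X x -> rep x *m pi != 0.
Proof.
move=> Xx; apply: contraNneq (rep_neq0 x) => v0.
have xE := hyperplane_split p l (rep x); rewrite v0 add0r in xE.
have : ev F (rep x) = 0 by [].
rewrite xE (ev_homog _ _ Fd) => /eqP; rewrite mulf_eq0 (negPf Fp) orbF expf_eq0 d0 /=.
by move=> /eqP ->; rewrite scale0r.
Qed.

Lemma pulled_back_cone e A B : A \is e.-homog -> B \is e.-homog -> msub pi B != 0 ->
  @pulled_back_field K n X (pt p) H (rfrac X (msub pi A) (msub pi B)).
Proof.
move=> Ae Be B0; exists (rfrac H A B) => x y Xx Hy /projection_pt[v0 ->] c.
move=> /ratfun_valueP[A' [B' [AB' E B'y ->]]].
have [[e' [A'e B'e]] /regular_mod_hyperplane B'0] := AB'.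
apply/ratfun_valueP; exists (msub pi A'), (msub pi B'); split.
- exact: admissible_cone A'e B'e B'0.
- apply/rfrac_eq; [exact: admissible_cone Ae Be B0 | exact: admissible_cone A'e B'e B'0 |].
  have /vanishing_ideal_hyperplane E0 := (rfrac_eq (admissible_hyperplane Ae Be B0) AB').1 E.
  by rewrite -!msubM -msubB E0; apply: vanishing_ideal0.
- by move: B'y; rewrite ev_msub (ev_rep_pt B'e).
- by rewrite !ev_msub (ratio_rep_pt A'e B'e).
Qed.

(** K_p consists of quotients of cones with vertex [p]. A pullback is specified by its values where
    the function on [H] is defined; multiplying the cross difference by the denominator makes it
    vanish on all of X, and this regular factor is then cancelled. *)
Lemma pulled_back_fieldP psi : @pulled_back_field K n X (pt p) H psi ->
  exists e A B, [/\ A \is e.-homog, B \is e.-homog, msub pi B != 0 &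
    psi = rfrac X (msub pi A) (msub pi B)].
Proof.
move=> [phi pb]; have [A [B [AB phiE]]] := rfracP phi.
have [[e [Ae Be]] /regular_mod_hyperplane B0] := AB.
exists e, A, B; split=> //; have [A2 [B2 [AB2 psiE]]] := rfracP psi.
have ABpi := admissible_cone Ae Be B0.
rewrite psiE; apply/(rfrac_eq AB2 ABpi).
have [[e2 [A2e B2e]] _] := AB2; have [_ rB] := ABpi; apply: rB.
apply/(vanishing_ideal_rdvd Fd d0 Fprime).
have hom : msub pi B * (A2 * msub pi B - msub pi A * B2) \is (e + (e2 + e)).-homog.
  apply: dhomogM; first exact: msub_homog.
  apply: rpredB; first by apply: dhomogM => //; apply: msub_homog.
  by rewrite addnC; apply: dhomogM => //; apply: msub_homog.
apply: (vanish_rdvd Fd d0 Fprime isT hom) => x Xx; rewrite evM.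
have [->|Bx] := eqVneq (ev (msub pi B) (rep x)) 0; first by rewrite mul0r.
have v0 := projection_neq0 Xx.
have By : ev B (rep (pt (rep x *m pi))) != 0 by rewrite (ev_rep_pt Be) // -ev_msub.
have Hy : H (pt (rep x *m pi)) by case: (pt_projection v0).
have : ratfun_value psi x (ev (msub pi A) (rep x) / ev (msub pi B) (rep x)).
  apply: (pb x _ Xx Hy (pt_projection v0)); apply/ratfun_valueP; exists A, B; split=> //.
  by rewrite (ratio_rep_pt Ae Be) // !ev_msub.
rewrite psiE => /(rfrac_value_eq Xx AB2) A2E.
by rewrite evB !evM A2E mulrAC divfK // subrr mulr0.
Qed.

(* The functions ('X_i o pi) / ('X_j o pi) are pulled back from H; an action
   fixing them preserves the lines through p. *)
Lemma fixed_pulled_back_parallel (M : 'M[K]_n.+2) g : M \in unitmx ->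
  (forall x, X x -> g x = pt (rep x *m M)) -> (forall x, X x -> X (g x)) ->
  (forall psi, @pulled_back_field K n X (pt p) H psi -> induced_action g psi psi) ->
  forall v, ev F v = 0 -> parallel (v *m (M *m pi)) (v *m pi).
Proof.
move=> MU gM gX fixed v Fv.
have [->|v0] := eqVneq v 0; first by move=> i j; rewrite !mul0mx !mxE !mul0r.
have [x [c c0 xE] Xx] : exists2 x : pspace K n.+1, exists2 c, c != 0 & rep x = c *: v & X x.
  exists (pt v); first exact: rep_pt.
  by apply/eqP; rewrite /= ev_hcoord (ev_rep_pt Fd) // Fv.
have vM : rep x *m M != 0.
  by apply: contraNneq (rep_neq0 x) => E; rewrite -[rep x]mulmx1 -(mulmxV MU) mulmxA E mul0mx.
have [b b0 gE] := rep_pt vM; rewrite -gM // in gE.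
have key i j : (rep (g x) *m pi) 0 j != 0 ->
    (rep (g x) *m pi) 0 i * (rep x *m pi) 0 j = (rep (g x) *m pi) 0 j * (rep x *m pi) 0 i.
  move=> uj; have XE k u : ev (msub pi 'X_k) u = (u *m pi) 0 k by rewrite ev_msub evX.
  have Xj0 : msub pi 'X_j != 0 by apply: contraNneq uj => X0; rewrite -XE X0 ev0.
  have Xi1 := mpolyXi_homog K i; have Xj1 := mpolyXi_homog K j.
  have AB := admissible_cone Xi1 Xj1 Xj0.
  have := fixed _ (pulled_back_cone Xi1 Xj1 Xj0) x (g x) Xx (gX x Xx) erefl.
  move=> /(_ ((rep (g x) *m pi) 0 i / (rep (g x) *m pi) 0 j)) [].
    by apply/ratfun_valueP; exists (msub pi 'X_i), (msub pi 'X_j); split; rewrite // !XE.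
  move=> u [A [B [uE uAB Bx E]]].
  have val : ratfun_value (rfrac X (msub pi 'X_i) (msub pi 'X_j)) x
    ((rep (g x) *m pi) 0 i / (rep (g x) *m pi) 0 j) by exists u, A, B.
  have := rfrac_value_eq Xx AB val; rewrite !XE => ->.
  by rewrite mulrA [RHS]mulrC !mulrA; field.
have par : parallel (rep (g x) *m pi) (rep x *m pi).
  move=> i j; have [uj|] := eqVneq ((rep (g x) *m pi) 0 j) 0; last exact: key.
  have [ui|ui] := eqVneq ((rep (g x) *m pi) 0 i) 0; first by rewrite uj ui !mul0r.
  exact/esym/key.
move=> i j; have := par i j; rewrite gE xE -!scalemxAl !scalerA -mulmxA.
have sc (r : K) (w : 'rV[K]_n.+2) k : (r *: w) 0 k = r * w 0 k by rewrite mxE.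
rewrite !sc => E; apply: (mulfI (mulf_neq0 (mulf_neq0 b0 c0) c0)).
by transitivity (b * c * (v *m (M *m pi)) 0 i * (c * (v *m pi) 0 j));
  [ring | rewrite E; ring].
Qed.

End PulledBackField.

(** By [proportional_maps], M followed by the projection is [a] times the projection, so M = a + phi
    p for a linear form [phi]. If phi(p) = 0, M is a multiple of an elation; being diagonalizable it
    would be scalar. Otherwise M is [a] times the homology with axis [phi = 0] and ratio 1 +
    phi(p)/a. *)
Lemma parallel_homology (K : closedFieldType) n d (p : 'rV[K]_n.+2) (l : 'cV[K]_n.+2)
    (M : 'M[K]_n.+2) c : p *m l = 1%:M -> (0 < n)%N -> (1 < d)%N ->
  d%:R != 0 :> K -> c != 0 -> M ^+ d = c%:M ->
  (forall k a, (0 < k < d)%N -> M ^+ k <> a%:M) ->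
  (forall v, parallel (v *m (M *m hproj p l)) (v *m hproj p l)) ->
  exists a l' om, p *m l' = 1%:M /\ M = a *: homology p l' om.
Proof.
move=> pl n0 d1 dK c0 Md Mk par.
have p0 : p != 0.
  by apply: contraTneq (oner_neq0 K) => p0; rewrite -(hform_p pl) p0 /hform mul0mx mxE eqxx.
have rpi : (1 < \rank (hproj p l))%N.
  have : (n.+2 <= \rank (hproj p l) + \rank (l *m p))%N.
    by rewrite -{1}(mxrank1 K n.+2) -[1%:M](subrK (l *m p)) mxrank_add.
  have : (\rank (l *m p) <= 1)%N by rewrite (leq_trans (mxrankM_maxr _ _)) ?rank_leq_row.
  by move: (\rank _) (\rank _) => r1 r2; move: n0; clear; lia.
have [a Mpi] := proportional_maps par rpi.
pose phi : 'cV[K]_n.+2 := M *m l - a *: l.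
have ME : M = a%:M + phi *m p.
  rewrite -[LHS]mulmx1 -[1%:M](subrK (l *m p)) mulmxDr -/(hproj p l) Mpi.
  rewrite /hproj scalerBr scalemx1 -addrA mulmxA mulmxBl -scalemxAl.
  by rewrite [X in _ + X]addrC.
have [pphi|pphi] := eqVneq ((p *m phi) 0 0) 0.
  have phi0 : phi = 0.
    apply: (eigen_span dK c0 Md) => b; apply/row_matrixP => i; rewrite row_mul row0.
    set v := row i _; have vM : v *m M = b *: v by apply/eigenspaceP; apply: row_sub.
    apply: mx11_eq0; apply/eqP; apply: contrapT => /negP vphi.
    have pv : (v *m phi) 0 0 *: p = (b - a) *: v.
      rewrite scalerBl -vM ME mulmxDr mul_mx_scalar addrC addKr mulmxA.
      by rewrite [v *m phi]mx11_scalar mul_scalar_mx !mxE eqxx mulr1n.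
    have [ba|ba] := eqVneq b a.
      by move/eqP: pv; rewrite ba subrr scale0r scaler_eq0 (negPf vphi) (negPf p0).
    have := congr1 (hform phi) pv; rewrite !hformZ /hform pphi mulr0 => /esym/eqP.
    by rewrite mulf_eq0 subr_eq0 (negPf ba) (negPf vphi).
  case: (Mk 1%N a); first by rewrite d1.
  by rewrite expr1 ME phi0 mul0mx addr0.
have a0 : a != 0.
  have [w w0 wphi] := hyperplane_vector phi (isT : (0 < n.+1)%N).
  apply: contraNneq c0 => a0; rewrite -(eigenvalue_exp_d Md w0 (b := 0)).
    by rewrite expr0n gtn_eqF // ltnW.
  rewrite ME a0 mulmxDr mulmxA mul_hform wphi.
  have z k : 0%:M = 0 :> 'M[K]_k by rewrite -scalemx1 scale0r.
  by rewrite !z mulmx0 mul0mx addr0 scale0r.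
set f := (p *m phi) 0 0 in pphi.
exists a, (f^-1 *: phi), (1 + f / a); split.
  by rewrite -scalemxAr mx11_normalize.
rewrite ME /homology scalerDr scalemx1 -scalemxAl !scalerA; congr (_ + _).
by rewrite (_ : a * _ * _ = 1) ?scale1r //; field; rewrite pphi a0.
Qed.

(** * The function field of X as a Kummer extension of K_p *)

Section RationalFunctionField.
Variables (K : closedFieldType) (n d : nat) (F : {mpoly K[n.+2]}).
Hypotheses (Fd : F \is d.-homog) (d1 : (1 < d)%N) (Fprime : prime_elt F).
Variables (p : 'rV[K]_n.+2) (l : 'cV[K]_n.+2) (om : K).
Hypotheses (pl : p *m l = 1%:M) (Fp : ev F p != 0) (omd : d.-primitive_root om).
Hypothesis FT : forall v, ev F (v *m homology p l om) = ev F v.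
Local Notation X := [set x : pspace K n.+1 | F.@[hcoord x] = 0].
Local Notation pi := (hproj p l).
Local Notation T := (homology p l om).
Local Notation H := [set x : pspace K n.+1 | hform l (rep x) = 0].
Local Notation Kp := (@pulled_back_field K n X (pt p) H).
Implicit Types (A B G : {mpoly K[n.+2]}) (u : ratfun X).

Let d0 : (0 < d)%N. Proof. exact: ltnW d1. Qed.

Lemma form_hypersurface_ideal G : vanishing_ideal X G <-> forall v, ev F v = 0 -> ev G v = 0.
Proof. exact: vanishing_idealE Fd d0 G. Qed.

Lemma admissible_inv A B : admissible X A B -> ~ vanishing_ideal X A -> admissible X B A.
Proof.
move=> [[e [Ae Be]] rB] nA; split; first by exists e.
apply/(regular_mod_hypersurface Fd d1 Fprime); apply: contrapT => H0; apply: nA.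
apply/form_hypersurface_ideal => v Fv; apply/eqP; apply: contrapT => /negP Av.
by apply: H0; exists v.
Qed.

Lemma rfrac_mul_inv A B : admissible X A B -> ~ vanishing_ideal X A ->
  rfrac X B A * rfrac X A B = 1.
Proof.
move=> AB nA; have BA := admissible_inv AB nA.
rewrite (rfracM BA AB) -rfrac1; apply/(rfrac_eq (admissibleM BA AB) (admissible1 X)).
by rewrite mulr1 mul1r mulrC subrr; apply: vanishing_ideal0.
Qed.

Lemma ratfun_field_inv : exists inv : ratfun X -> ratfun X,
  (forall u, u != 0 -> inv u * u = 1) /\ inv 0 = 0.
Proof.
have /choice[inv invE] : forall u, exists v, (u != 0 -> v * u = 1) /\ (u = 0 -> v = 0).
  move=> u; have [u0|u0] := eqVneq u 0; first by exists 0; split=> // /eqP.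
  have [A [B [AB uE]]] := rfracP u; exists (rfrac X B A); split=> [_|u1].
    by rewrite uE; apply: rfrac_mul_inv => // /(rfrac_eq0 AB) u1; rewrite uE u1 eqxx in u0.
  by rewrite u1 eqxx in u0.
by exists inv; split=> [u|]; [case: (invE u) | case: (invE 0) => _; apply].
Qed.

Lemma msub1 (M : 'M[K]_n.+2) : msub M 1 = 1 :> {mpoly K[n.+2]}.
Proof. by apply: ev_inj => v; rewrite ev_msub !ev1. Qed.

Lemma pulled_back1 : Kp 1.
Proof.
rewrite -(rfrac1 X) -(msub1 pi).
by apply: (pulled_back_cone Fd d1 Fprime pl Fp (e := 0)); rewrite ?dhomog1 // msub1 oner_eq0.
Qed.

Lemma pulled_backB u v : Kp u -> Kp v -> Kp (u - v).
Proof.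
move=> /(pulled_back_fieldP Fd d1 Fprime pl Fp)[e [A [B [Ae Be B0 ->]]]].
move=> /(pulled_back_fieldP Fd d1 Fprime pl Fp)[e' [A' [B' [Ae' Be' B0' ->]]]].
have AB := admissible_cone Fd d1 Fprime pl Fp Ae Be B0.
have AB' := admissible_cone Fd d1 Fprime pl Fp Ae' Be' B0'.
rewrite (rfracB AB AB') -!msubM -msubB.
apply: (pulled_back_cone Fd d1 Fprime pl Fp (e := (e + e')%N)).
- by rewrite rpredB ?(dhomogM Ae Be') // addnC (dhomogM Ae' Be).
- exact: dhomogM.
- by rewrite msubM mulf_neq0.
Qed.

(** The inverse is given by its equation because [ratfun X] is only a ring at this stage. *)
Lemma pulled_back_div u v w : Kp u -> Kp v -> w * v = 1 -> Kp (u * w).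
Proof.
move=> /(pulled_back_fieldP Fd d1 Fprime pl Fp)[e [A [B [Ae Be B0 ->]]]].
move=> /(pulled_back_fieldP Fd d1 Fprime pl Fp)[e' [A' [B' [Ae' Be' B0' ->]]]] wv.
have AB := admissible_cone Fd d1 Fprime pl Fp Ae Be B0.
have AB' := admissible_cone Fd d1 Fprime pl Fp Ae' Be' B0'.
have nA' : ~ vanishing_ideal X (msub pi A').
  by move=> /(rfrac_eq0 AB') E0; move/eqP: wv; rewrite E0 mulr0 eq_sym oner_eq0.
have A'0 : msub pi A' != 0.
  by apply/eqP => A'0; apply: nA'; rewrite A'0; apply: vanishing_ideal0.
have BA' := admissible_inv AB' nA'.
have -> : w = rfrac X (msub pi B') (msub pi A').
  have inv := rfrac_mul_inv AB' nA'.
  by rewrite -[w]mulr1 -inv mulrCA wv mulr1.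
rewrite (rfracM AB BA') -!msubM; apply: (pulled_back_cone Fd d1 Fprime pl Fp (e := (e + e')%N)).
- exact: dhomogM.
- exact: dhomogM.
- by rewrite msubM mulf_neq0.
Qed.

Lemma homology_inv (v : 'rV[K]_n.+2) : v *m homology p l om^-1 *m T = v.
Proof.
have om0 : om != 0 by rewrite (prim_root_eq0 omd) -lt0n.
by rewrite (mul_homologyM pl) mulVf // /homology subrr scale0r addr0 mulmx1.
Qed.

Lemma vanishing_ideal_homology G : vanishing_ideal X G -> vanishing_ideal X (msub T G).
Proof.
move=> /form_hypersurface_ideal IG; apply/form_hypersurface_ideal => v Fv.
by rewrite ev_msub IG // FT.
Qed.

Lemma admissible_homology A B : admissible X A B -> admissible X (msub T A) (msub T B).
Proof.
move=> [[e [Ae Be]] /(regular_mod_hypersurface Fd d1 Fprime)[v Fv Bv]]; split.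
  by exists e; split; apply: msub_homog.
apply/(regular_mod_hypersurface Fd d1 Fprime); exists (v *m homology p l om^-1).
  by rewrite -FT homology_inv.
by rewrite ev_msub homology_inv.
Qed.

(** Composition with the homology, defined on a chosen representative; the result does not depend on
    the choice because the ideal of X is stable under [msub T]. *)
Lemma exists_homology_action : exists s : ratfun X -> ratfun X,
  forall A B, admissible X A B -> s (rfrac X A B) = rfrac X (msub T A) (msub T B).
Proof.
have /choice[N NE] : forall u, exists AB : {mpoly K[n.+2]} * {mpoly K[n.+2]},
    admissible X AB.1 AB.2 /\ u = rfrac X AB.1 AB.2.
  by move=> u; have [A [B AB]] := rfracP u; exists (A, B).
exists (fun u => rfrac X (msub T (N u).1) (msub T (N u).2)) => A B AB.
have [AB' E] := NE (rfrac X A B).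
apply/(rfrac_eq (admissible_homology AB') (admissible_homology AB)).
by rewrite -!msubM -msubB; apply/vanishing_ideal_homology/(rfrac_eq AB' AB).
Qed.

Lemma rfrac_expr A B k : admissible X A B ->
  admissible X (A ^+ k) (B ^+ k) /\ rfrac X A B ^+ k = rfrac X (A ^+ k) (B ^+ k).
Proof.
move=> AB; elim: k => [|k [IH E]]; first by rewrite !expr0 rfrac1; split=> //; apply: admissible1.
by rewrite !exprS E (rfracM AB IH); split=> //; apply: admissibleM.
Qed.

Lemma rfrac_subr A A' B : admissible X A B -> admissible X A' B ->
  rfrac X (A - A') B = rfrac X A B - rfrac X A' B.
Proof.
move=> AB AB'; rewrite (rfracB AB AB'); apply/rfrac_eq.
- have [[e [Ae Be]] rB] := AB; have [[e' [Ae' Be']] _] := AB'.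
  split=> //; exists e; split=> //; apply: rpredB => //.
  by rewrite (dhomog_uniq (admissible_neq0 AB) Be Be').
- exact: admissibleB.
- rewrite (_ : _ - _ = 0); first exact: vanishing_ideal0.
  by ring.
Qed.

Lemma exists_linear_cone : exists j, msub pi 'X_j != 0 :> {mpoly K[n.+2]}.
Proof.
have [w w0 lw] := hyperplane_vector l (isT : (0 < n.+1)%N).
have /rV0Pn[j wj] := w0; exists j; apply: contraNneq wj => X0.
by have := ev_msub pi 'X_j w; rewrite X0 ev0 hproj_id // evX => <-.
Qed.

Section Generation.
Variable j : 'I_n.+2.
Hypothesis Xj0 : msub pi 'X_j != 0 :> {mpoly K[n.+2]}.
Local Notation L := (msub pi 'X_j : {mpoly K[n.+2]}).
Local Notation y := (rfrac X (lin_form l) L).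

Let Lh : L \is 1.-homog. Proof. by apply: msub_homog; apply: mpolyXi_homog. Qed.
Let rL : regular_mod X L. Proof. by have := regular_mod_cone Fd d1 Fprime pl Fp Xj0. Qed.

Let adm1 G : G \is 1.-homog -> admissible X G L.
Proof. by move=> G1; split=> //; exists 1%N. Qed.

Let Lexp k : L ^+ k = msub pi ('X_j ^+ k).
Proof. by apply: ev_inj => v; rewrite ev_msub !evXn ev_msub. Qed.

Let Lkh k : L ^+ k \is k.-homog.
Proof. by rewrite -[X in X.-homog]mul1n; apply: dhomogMn. Qed.

Let adm k G : G \is k.-homog -> admissible X G (L ^+ k).
Proof.
move=> Gk; split; first by exists k.
by have [[]] := rfrac_expr k (adm1 Lh).
Qed.

Let Xjh k : 'X_j ^+ k \is [in K[n.+2], k.-homog].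
Proof. by rewrite -[X in X.-homog]mul1n; apply: dhomogMn; apply: mpolyXi_homog. Qed.

Lemma pulled_back_const (b : K) : Kp (rfrac X b%:MP 1).
Proof.
have E : rfrac X b%:MP 1 = rfrac X (msub pi b%:MP) (msub pi 1).
  by congr rfrac; apply: ev_inj => v; rewrite ev_msub ?evC ?ev1.
have bh : b%:MP \is [in K[n.+2], 0.-homog] by apply: homog_ev => c v; rewrite !evC expr0 mul1r.
rewrite E; apply: (pulled_back_cone Fd d1 Fprime pl Fp (e := 0)) => //.
  exact: dhomog1.
by rewrite msub1 oner_eq0.
Qed.

Lemma admissible_const (b : K) : admissible X b%:MP 1.
Proof.
split; last by case: (admissible1 X).
exists 0%N; rewrite dhomog1; split=> //.
by apply: homog_ev => c v; rewrite !evC expr0 mul1r.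
Qed.

Lemma kummer_generator_neq0 : y != 0.
Proof.
apply/eqP => /(rfrac_eq0 (adm1 (lin_form_homog l)))/form_hypersurface_ideal H.
by case/eqP: (lin_form_neq0 pl); apply: (prime_low_degree Fprime Fd (lin_form_homog l) d1).
Qed.

(** By [homology_form], the d-th power of the numerator of [y] coincides on X with the cone -F(v
    pi)/F(p). *)
Lemma kummer_generator_exp : Kp (y ^+ d).
Proof.
have [adm' ->] := rfrac_expr d (adm1 (lin_form_homog l)).
have E : rfrac X (lin_form l ^+ d) (L ^+ d) =
    rfrac X (msub pi (- (ev F p)^-1 *: F)) (msub pi ('X_j ^+ d)).
  rewrite -Lexp; apply/rfrac_eq => //.
    by apply: adm; apply: msub_homog; apply: rpredZ.
  apply/form_hypersurface_ideal => v Fv; rewrite evB !evM evXn ev_lin_form ev_msub evZ.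
  have FM w : ev F (w *m (1 *: T)) = 1 * ev F w by rewrite scale1r mul1r.
  have := homology_form Fd d1 pl omd (oner_neq0 K) FM Fp v.
  rewrite Fv -/(hform l v) => /esym/eqP; rewrite addr_eq0 => /eqP ->.
  by rewrite mulNr mulrN opprK mulKf // subrr.
rewrite E; apply: (pulled_back_cone Fd d1 Fprime pl Fp (e := d)) => //.
  exact: rpredZ.
by rewrite -Lexp expf_neq0.
Qed.

(* It suffices to generate the quotients G / L ^ e, as the norm provides
   denominators that are cones with vertex p. *)
Lemma kummer_generated (S : ratfun X -> Prop) :
  (forall u, Kp u -> S u) -> S y -> (forall u v, S u -> S v -> S (u - v)) ->
  (forall u v, S u -> S v -> S (u * v)) -> forall u, S u.
Proof.
move=> SK Sy SB SM u.
have S0 : S 0 by rewrite -[0](subrr (1 : ratfun X)); apply: (SB); apply/SK/pulled_back1.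
have SD v w : S v -> S w -> S (v + w).
  by move=> Sv Sw; rewrite -[w]opprK -[- w]sub0r; apply: (SB) => //; apply: (SB).
have Sadd e G G' : G \is e.-homog -> G' \is e.-homog ->
    S (rfrac X G (L ^+ e)) -> S (rfrac X G' (L ^+ e)) -> S (rfrac X (G + G') (L ^+ e)).
  move=> Ge Ge' SG SG'; rewrite -[G']opprK rfrac_subr; try by apply: (adm); rewrite ?rpredN.
  by apply: (SB) => //; rewrite -[- G']sub0r rfrac_subr; try apply: (adm); rewrite ?rpred0 //;
    apply: (SB) => //; rewrite (rfrac_eq0 (adm (rpred0 _))).2 //; apply: vanishing_ideal0.
have Sconst e b G : G \is e.-homog -> S (rfrac X G (L ^+ e)) -> S (rfrac X (b *: G) (L ^+ e)).
  move=> Ge SG; rewrite -mul_mpolyC -[L ^+ e]mul1r -(rfracM (admissible_const b) (adm Ge)).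
  by apply: (SM) => //; apply/SK/pulled_back_const.
have Smul e e' G G' : G \is e.-homog -> G' \is e'.-homog -> S (rfrac X G (L ^+ e)) ->
    S (rfrac X G' (L ^+ e')) -> S (rfrac X (G * G') (L ^+ (e + e'))).
  by move=> Ge Ge' SG SG'; rewrite exprD -(rfracM (adm Ge) (adm Ge')); apply: (SM).
have SX i : S (rfrac X 'X_i (L ^+ 1)).
  (* A coordinate is a cone plus a multiple of [l], so its quotient by [L] is an element of K_p plus
     a multiple of [y]. *)
  have -> : 'X_i = msub pi 'X_i + p 0 i *: lin_form l :> {mpoly K[n.+2]}.
    apply: ev_inj => v; rewrite evD ev_msub evZ ev_lin_form -/(hform l v) !evX mul_hproj !mxE.
    by rewrite mulrC subrK.
  apply: (Sadd); [by apply: msub_homog; apply: mpolyXi_homog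
               | by apply: rpredZ; apply: lin_form_homog | | apply: (Sconst)].
  - rewrite expr1; apply: (SK).
    exact: (pulled_back_cone Fd d1 Fprime pl Fp (mpolyXi_homog _ _) (mpolyXi_homog _ _)).
  - exact: lin_form_homog.
  - by rewrite expr1.
have SXm m : S (rfrac X 'X_[m] (L ^+ mdeg m)).
  rewrite mpolyXE_id mdegE.
  have [] : (\prod_(i < n.+2) 'X_i ^+ m i : {mpoly K[n.+2]}) \is (\sum_(i < n.+2) m i)%N.-homog /\
      S (rfrac X (\prod_(i < n.+2) 'X_i ^+ m i) (L ^+ \sum_(i < n.+2) m i)); last by [].
  elim/big_ind2: _ => [|G e G' e' [Ge SG] [Ge' SG']|i _].
  - by rewrite dhomog1 expr0 rfrac1; split=> //; apply/SK/pulled_back1.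
  - by split; [apply: dhomogM | apply: (Smul)].
  - have Xih k : 'X_i ^+ k \is [in K[n.+2], k.-homog].
      by rewrite -[X in X.-homog]mul1n; apply: dhomogMn; apply: mpolyXi_homog.
    split=> //; elim: (m i) => [|k IH].
      by rewrite !expr0 rfrac1; apply/SK/pulled_back1.
    by rewrite exprS -[k.+1]add1n; apply: (Smul) => //; apply: mpolyXi_homog.
have SG e G : G \is e.-homog -> S (rfrac X G (L ^+ e)).
  move=> Ge; rewrite [G]mpolyE big_seq.
  have [] : \sum_(m <- msupp G | m \in msupp G) G@_m *: 'X_[m] \is e.-homog /\
    S (rfrac X (\sum_(m <- msupp G | m \in msupp G) G@_m *: 'X_[m]) (L ^+ e)); last by [].
  elim/big_ind: _ => [|G1 G2 [h1 SG1] [h2 SG2]|m mG].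
  - split; first exact: rpred0.
    by rewrite (rfrac_eq0 (adm (rpred0 _))).2 //; apply: vanishing_ideal0.
  - by split; [apply: rpredD | apply: (Sadd)].
  - have me : mdeg m = e := dhomog_mf Ge mG.
    have mh : 'X_[m] \is [in K[n.+2], e.-homog] by rewrite dhomogX; apply/eqP.
    by split; [apply: rpredZ | apply: (Sconst) => //; rewrite -me].
have [A [B [AB ->]]] := rfracP u.
have [[e [Ae Be]] /(regular_mod_hypersurface Fd d1 Fprime) Breg] := AB.
have FM v : ev F (v *m (1 *: T)) = 1 * ev F v by rewrite scale1r mul1r.
have [R [Rh Rpi RE]] := projection_norm Fd d1 pl omd (oner_neq0 K) FM Fp Be.
have Rreg := projection_norm_neq0 Fd d1 Fprime pl omd (oner_neq0 K) FM Fp Be RE Breg.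
pose B' : {mpoly K[n.+2]} := \prod_(i < d.-1) msub (homology p l (om ^+ i.+1)) B.
have RBB v : ev F v = 0 -> ev R v = ev B v * ev B' v.
  have split (f : nat -> K) : \prod_(i < d) f i = f 0%N * \prod_(i < d.-1) f i.+1.
    by move: d0; case: (d) => // k _; rewrite big_ord_recl.
  move=> Fv; rewrite RE // (split (fun i => ev B (v *m homology p l (om ^+ i)))) ev_prod.
  rewrite expr0 /homology subrr scale0r addr0 mulmx1; congr (_ * _).
  by apply: eq_bigr => i _; rewrite ev_msub.
have B'h : B' \is (d.-1 * e).-homog.
  have Bh (i : 'I_d.-1) : msub (homology p l (om ^+ i.+1)) B \is e.-homog by apply: msub_homog.
  by have := dhomog_prod_fam (enum 'I_d.-1) Bh; rewrite size_enum_ord big_enum.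
have deE : (d * e = e + d.-1 * e)%N by rewrite -mulSn prednK.
have AB'h : A * B' \is (d * e).-homog by rewrite deE; apply: dhomogM.
have admR G : G \is (d * e).-homog -> admissible X G R.
  move=> Gh; split; first by exists (d * e)%N.
  exact/(regular_mod_hypersurface Fd d1 Fprime).
(* On X the norm [R] is [B] times the product [B'] of its other conjugates. The first factor has a
   power of [L] as denominator; the second is a quotient of cones, so it lies in K_p. *)
have -> : rfrac X A B = rfrac X (A * B') (L ^+ (d * e)) * rfrac X (L ^+ (d * e)) R.
  rewrite (rfracM (adm AB'h) (admR _ (Lkh _))).
  apply/(rfrac_eq AB (admissibleM (adm AB'h) (admR _ (Lkh _))))/form_hypersurface_ideal => v Fv.
  by rewrite evB !evM RBB //; ring.
apply: (SM); first exact: SG.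
have R0 : msub pi R != 0.
  by rewrite Rpi; apply/eqP => R0; case: Rreg => v _; rewrite R0 ev0 eqxx.
apply: (SK); rewrite Lexp -[X in rfrac _ _ X]Rpi.
exact: (pulled_back_cone Fd d1 Fprime pl Fp (Xjh _) Rh R0).
Qed.

End Generation.

End RationalFunctionField.

Section GaloisGroup.
Variables (K : closedFieldType) (n d : nat) (F : {mpoly K[n.+2]}).
Hypotheses (Fd : F \is d.-homog) (d1 : (1 < d)%N) (Fprime : prime_elt F).
Variables (p : 'rV[K]_n.+2) (l : 'cV[K]_n.+2) (om a : K).
Hypotheses (pl : p *m l = 1%:M) (Fp : ev F p != 0) (omd : d.-primitive_root om).
Hypothesis FT : forall v, ev F (v *m homology p l om) = ev F v.
Local Notation X := [set x : pspace K n.+1 | F.@[hcoord x] = 0].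
Local Notation pi := (hproj p l).
Local Notation T := (homology p l om).
Local Notation H := [set x : pspace K n.+1 | hform l (rep x) = 0].
Local Notation Kp := (@pulled_back_field K n X (pt p) H).
Variable g : pspace K n.+1 -> pspace K n.+1.
Hypotheses (a0 : a != 0) (gM : forall x, X x -> g x = pt (rep x *m (a *: T))).
Implicit Types A B G : {mpoly K[n.+2]}.

Lemma homology_galois :
  exists (k0 : fieldType) (L : splittingFieldType k0) (phi : {rmorphism L -> ratfun X})
    (t : gal_of {:L}),
    [/\ galois_model Kp phi, forall w, @induced_action K n.+1 X g (phi w) (phi (t w)) &
        generator 'Gal({:L} / 1)%g t].
Proof.
have [s sE] := exists_homology_action Fd d1 Fprime pl omd FT.
have sB (u v : ratfun X) : s (u - v) = s u - s v.
  have [A [B [AB ->]]] := rfracP u; have [A' [B' [AB' ->]]] := rfracP v.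
  rewrite (rfracB AB AB') !sE //; last exact: admissibleB.
  rewrite (rfracB (admissible_homology Fd d1 Fprime pl omd FT AB)
    (admissible_homology Fd d1 Fprime pl omd FT AB')).
  by rewrite -!msubM -msubB.
have sM (u v : ratfun X) : s (u * v) = s u * s v.
  have [A [B [AB ->]]] := rfracP u; have [A' [B' [AB' ->]]] := rfracP v.
  rewrite (rfracM AB AB') !sE //; last exact: admissibleM.
  rewrite (rfracM (admissible_homology Fd d1 Fprime pl omd FT AB)
    (admissible_homology Fd d1 Fprime pl omd FT AB')).
  by rewrite -!msubM.
have s1 : s 1 = 1.
  by rewrite -(rfrac1 X) sE ?msub1 //; apply: admissible1.
have Tpi A : msub T (msub pi A) = msub pi A.
  by apply: ev_inj => v; rewrite !ev_msub mul_homology hproj_shift // hproj_idem.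
have sK (u : ratfun X) : Kp u -> s u = u.
  move=> /(pulled_back_fieldP Fd d1 Fprime pl Fp)[e [A [B [Ae Be B0 ->]]]].
  by rewrite sE ?Tpi //; apply: (admissible_cone Fd d1 Fprime pl Fp Ae Be).
have om0 : om != 0 by rewrite (prim_root_eq0 omd) -lt0n ltnW.
have T0 x : rep x *m T != 0.
  apply: contraNneq (rep_neq0 x) => v0; have := mul_homologyM pl om om^-1 (rep x).
  by rewrite v0 mul0mx divff // /homology subrr scale0r addr0 mulmx1 => <-.
have s_action (u : ratfun X) : @induced_action K n.+1 X g u (s u).
  move=> x y Xx _ -> c /ratfun_valueP[A [B [AB -> Bgx ->]]].
  have [[e [Ae Be]] _] := AB.
  rewrite sE //; apply/ratfun_valueP; exists (msub T A), (msub T B); split=> //.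
  - exact: (admissible_homology Fd d1 Fprime pl omd FT AB).
  - move: Bgx; rewrite ev_msub gM // -scalemxAr pt_scale //.
    by rewrite (ev_rep_pt Be).
  - by rewrite !ev_msub gM // -scalemxAr pt_scale // (ratio_rep_pt Ae Be).
have [j Xj0] := exists_linear_cone p l.
pose y := rfrac X (lin_form l) (msub pi 'X_j).
have admy : admissible X (lin_form l) (msub pi 'X_j).
  split; last exact: (regular_mod_cone Fd d1 Fprime pl Fp Xj0).
  by exists 1%N; split; [apply: lin_form_homog | apply: msub_homog; apply: mpolyXi_homog].
pose z := rfrac X om%:MP 1.
have sy : s y = z * y.
  rewrite sE // (rfracM (admissible_const F _) admy) mul1r Tpi; congr rfrac.
  apply: ev_inj => v; rewrite ev_msub evM evC !ev_lin_form -!/(hform l _) mul_homology.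
  by rewrite hformD !hformZ (hform_hproj pl) (hform_p pl) add0r mulr1 ?[_ * om]mulrC.
have zexp k : z ^+ k = rfrac X (om ^+ k)%:MP 1.
  have [_ ->] := rfrac_expr k (admissible_const F om).
  by rewrite expr1n rmorphXn.
have [inv [invV inv0]] := ratfun_field_inv Fd d1 Fprime.
(* The field structure is packed locally on the function ring, since inverses exist only because F
   is prime. *)
pose EM := GRing.ComNzRing_isField.Build (GRing.ComNzRing.sort (ratfun X)) invV inv0.
pose E : fieldType := HB.pack (GRing.ComNzRing.sort (ratfun X)) EM.
pose P : {pred E} := fun u => `[< Kp u >].
have Pdiv : divring_closed P.
  split=> [|u v /asboolP Ku /asboolP Kv|u v /asboolP Ku /asboolP Kv]; apply/asboolP.
  - exact: (pulled_back1 Fd d1 Fprime pl Fp).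
  - exact: (pulled_backB Fd d1 Fprime pl Fp Ku Kv).
  - have [v0|v0] := eqVneq (v : E) 0.
      rewrite v0 invr0 mulr0 -(subrr (1 : E)).
      have K1 := pulled_back1 Fd d1 Fprime pl Fp.
      exact: (pulled_backB Fd d1 Fprime pl Fp K1 K1).
    apply: (pulled_back_div Fd d1 Fprime pl Fp Ku Kv).
    exact: (@mulVf E).
have [k0 [iota iotaE]] := exists_subfield_type Pdiv.
have Kiota u : Kp u <-> exists c, iota c = u.
  by rewrite -iotaE; split=> [Ku|/asboolP//]; apply/asboolP.
have sEB : zmod_morphism (s : E -> E) := sB.
have sEM : monoid_morphism (s : E -> E) := conj s1 sM.
pose sM1 := GRing.isZmodMorphism.Build E E s sEB.
pose sM2 := GRing.isMonoidMorphism.Build E E s sEM.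
pose sm : {rmorphism E -> E} := HB.pack (s : E -> E) sM1 sM2.
have [z' z'E] := (Kiota z).1 (pulled_back_const Fd d1 Fprime pl Fp _).
have [b bE] := (Kiota (y ^+ d)).1 (kummer_generator_exp Fd d1 Fprime pl Fp omd FT Xj0).
have z'd : d.-primitive_root z'.
  have z'k k : (z' ^+ k == 1) = (om ^+ k == 1).
    rewrite -(inj_eq (fmorph_inj iota)) rmorph1 rmorphXn z'E zexp -(rfrac1 X).
    apply/eqP/eqP => [|->]; last by rewrite mpolyC1.
    have admk := admissible_const F (om ^+ k).
    (* Equality of constants modulo the ideal of X is read at the origin, which belongs to every
       affine cone. *)
    move=> /(rfrac_eq admk (admissible1 X)) /(_ 0 (or_introl erefl)) E0.
    apply/eqP; rewrite -subr_eq0 -E0 !mulr1; apply/eqP.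
    by rewrite -[RHS]/(ev _ 0) evB evC ev1.
  have [|m z'm md] := @prim_order_exists _ d z' (ltnW d1).
    by apply/eqP; rewrite z'k (prim_expr_order omd) eqxx.
  have dm : (d %| m)%N by rewrite (prim_order_dvd omd) -z'k (prim_expr_order z'm) eqxx.
  by rewrite (_ : d = m) //; apply/eqP; rewrite eqn_dvd dm md.
have sy' : sm y = iota z' * y by rewrite z'E -sy.
have gen' (u : E) : exists q, u = (map_poly iota q).[y].
  apply: (kummer_generated Fd d1 Fprime pl Fp omd FT Xj0
    (S := fun u : E => exists q, u = (map_poly iota q).[y])).
  - by move=> v /Kiota[c <-]; exists c%:P; rewrite map_polyC hornerC.
  - by exists 'X; rewrite map_polyX hornerX.
  - by move=> v w [q ->] [r ->]; exists (q - r); rewrite rmorphB hornerD hornerN.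
  - by move=> v w [q ->] [r ->]; exists (q * r); rewrite rmorphM hornerM.
have [L [phi [t [phi_bij phiA galL st gen]]]] :=
  @kummer_model k0 E iota y b z' d sm z'd
    (kummer_generator_neq0 Fd d1 Fprime pl Fp Xj0) (esym bE)
    (fun c => sK _ ((Kiota _).2 (ex_intro _ c erefl))) sy' gen'.
exists k0, L, phi, t; split=> //.
- split=> //; apply/seteqP; split=> u /=.
    by move=> /Kiota[c <-]; exists c => //; rewrite phiA.
  by move=> [c _ <-]; apply/Kiota; exists c; rewrite phiA.
- by move=> w; rewrite -st; apply: s_action.
Qed.

End GaloisGroup.

(** * Outer Galois points and the two implications *)

Lemma form_hyperplane (K : closedFieldType) n (p : 'rV[K]_n.+2) (l : 'cV[K]_n.+2) :
  p *m l = 1%:M -> hyperplane [set x : pspace K n.+1 | hform l (rep x) = 0].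
Proof.
move=> pl; pose f : 'Hom('rV[K]_n.+2, 'rV[K]_1) := linfun (mulmxr l).
have fE v : f v = (hform l v)%:M by rewrite lfunE /= mul_hform.
have f0 v : (f v == 0) = (hform l v == 0).
  rewrite fE; apply/eqP/eqP => [E|->]; last by rewrite -scalemx1 scale0r.
  by have := congr1 (fun A : 'M[K]_1 => A 0 0) E; rewrite !mxE eqxx.
exists (lker f); split; last first.
  by apply/seteqP; split=> x /=; rewrite line_rep -memvE memv_ker f0 => /eqP.
have := limg_ker_dim f fullv; rewrite capfv dimvf /dim /= mul1n.
have -> : (f @: fullv)%VS = fullv.
  apply/eqP; rewrite eqEsubv subvf; apply/subvP => w _.
  have -> : w = f (w 0 0 *: p) by rewrite fE hformZ (hform_p pl) mulr1 -mx11_scalar.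
  exact/memv_img/memvf.
by rewrite dimvf /dim /= mul1n addn1 => -[].
Qed.

Section OuterGaloisPoints.
Variables (K : closedFieldType) (n d : nat) (X : set (pspace K n.+1)).
Variable g : pspace K n.+1 -> pspace K n.+1.
Hypotheses (n2 : (2 <= n)%N) (d4 : (4 <= d)%N) (dK : d%:R != 0 :> K).
Hypotheses (smoothX : smooth_hypersurface d X) (lin_g : linear_automorphism X g).
Hypothesis ord_g : automorphism_order X g d.

Let n0 : (0 < n)%N. Proof. exact: ltnW n2. Qed.
Let d2 : (2 < d)%N. Proof. exact: ltnW d4. Qed.
Let d1 : (1 < d)%N. Proof. exact: ltnW d2. Qed.

Lemma fixed_codim1_galois_point : has_codim (Fix X g) X 1 ->
  exists p, outer_galois_point X p /\ belongs_to_galois_point X g p.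
Proof.
have [F [M [mu [c [[Fd XE Fprime sm] [MU gM FM] [c0 [Md Mk]]]]]]] :=
  linear_automorphism_setup n0 d2 smoothX lin_g ord_g.
move=> [_ ncodim2].
have [Z [irrZ ZFix nchain]] :
    exists Z, [/\ irreducible_closed Z, Z `<=` Fix X g & ~ irreducible_chain Z X 2].
  apply: contrapT => nZ; apply: ncodim2 => Z irrZ ZFix; apply: contrapT => nchain.
  by apply: nZ; exists Z.
have eigZ x : Z x -> F.@[hcoord x] = 0 /\ exists b, rep x *m M = b *: rep x.
  move=> /ZFix[Xx gx]; split; first by move: Xx; rewrite XE.
  have xM : rep x *m M != 0.
    by apply: contraNneq (rep_neq0 x) => E; rewrite -[rep x]mulmx1 -(mulmxV MU) mulmxA E mul0mx.
  have [|b _ bE] := pt_eq xM (rep_neq0 x); last by exists b.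
  by rewrite -gM // gx pt_rep.
subst X.
have [a [p [l [om [pl ME Fp]]]]] :=
  fixed_codim1_homology Fd d2 n2 Fprime sm FM dK c0 Md Mk irrZ eigZ nchain.
subst M.
have [a0 omd] := homology_primitive pl (isT : (0 < n.+1)%N) (ltnW d1) c0 Md Mk.
have FT := homology_invariant Fd pl omd a0 FM Fp.
have [k0 [L [phi [t [gal act gen]]]]] := homology_galois Fd d1 Fprime pl Fp omd FT a0 gM.
have p0 : p != 0 by apply: contraNneq Fp => ->; rewrite (ev_homog0 Fd) // ltnW.
have Hp : ~ [set x : pspace K n.+1 | hform l (rep x) = 0] (pt p).
  have [b b0 bE] := rep_pt p0.
  by rewrite /= bE hformZ (hform_p pl) mulr1 => /eqP; rewrite (negPf b0).
have Hhyp := form_hyperplane pl.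
exists (pt p); split; last by exists [set x | hform l (rep x) = 0]; split=> //; exists k0, L, phi, t.
split; last by move=> /eqP; rewrite ev_hcoord (ev_rep_pt Fd p0) (negPf Fp).
by exists [set x | hform l (rep x) = 0]; split=> //; exists k0, L, phi.
Qed.

Lemma galois_point_fixed_codim1 p0 : ~ X p0 -> belongs_to_galois_point X g p0 ->
  has_codim (Fix X g) X 1.
Proof.
have [F [M [mu [c [[Fd XE Fprime sm] [MU gM FM] [c0 [Md Mk]]]]]]] :=
  linear_automorphism_setup n0 d2 smoothX lin_g ord_g.
move=> nXp [H [[U [dU HE]] Hp [k0 [L [phi [s [[phi_bij KpE galL] act gen]]]]]]].
have gX : forall x, X x -> X (g x) by case: lin_g => -[[]].
have [l0 l00 UE] := vspace_hyperplane dU.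
have l0p : hform l0 (rep p0) != 0.
  by apply: contra_notN Hp; rewrite HE /= line_rep -memvE UE.
(* The coordinates of [p0], normalized by the equation [l0] of the hyperplane of projection, which
   avoids [p0]. *)
pose p := (hform l0 (rep p0))^-1 *: rep p0.
have pl : p *m l0 = 1%:M by rewrite mul_hform hformZ mulVf.
have ptp : pt p = p0 by rewrite pt_scale ?invr_eq0 // pt_rep.
have H0 : H = [set x | hform l0 (rep x) = 0].
  rewrite HE; apply/seteqP; split=> x /=; rewrite line_rep -memvE UE => /eqP //.
have pn0 : p != 0 by rewrite scaler_eq0 invr_eq0 negb_or l0p rep_neq0.
subst X.
have Fp : ev F p != 0.
  by apply: contra_notN nXp; rewrite -(ev_rep_pt Fd pn0) ptp => /eqP.
have fixK (psi : ratfun [set x | F.@[hcoord x] = 0]) :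
    pulled_back_field (pt p) [set x | hform l0 (rep x) = 0] psi ->
    induced_action g psi psi.
  rewrite ptp -H0 KpE => -[b _ <-]; have := act b%:A.
  have /fixed_gal -> // : s \in 'Gal({:L} / 1)%g by move/eqP: gen => ->; apply: cycle_id.
  - exact: sub1v.
  - by rewrite memvZ // mem1v.
have par := fixed_pulled_back_parallel Fd d1 Fprime pl Fp MU gM gX fixK.
have {}par := parallel_on_hypersurface Fprime Fd d2 par.
(* The hyperplane of projection was arbitrary: the axis [l] found here may differ from [l0]. *)
have [a [l [om [pl' ME]]]] := parallel_homology pl n0 d1 dK c0 Md Mk par.
subst M.
have [a0 omd] := homology_primitive pl' (isT : (0 < n.+1)%N) (ltnW d1) c0 Md Mk.
exact: (homology_fixed_codim Fd d1 _ Fprime pl' omd a0 FM Fp gM).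
Qed.

End OuterGaloisPoints.

Theorem theorem1p9 (R : realType) (n d : nat) (X : set (pspace R[i] n.+1))
    (g : pspace R[i] n.+1 -> pspace R[i] n.+1)
    (hn : (2 <= n)%N) (hd : (4 <= d)%N)
    (hX : smooth_hypersurface d X)
    (hg : linear_automorphism X g)
    (hgd : automorphism_order X g d) :
  has_codim (Fix X g) X 1 <->
  exists p : pspace R[i] n.+1,
    outer_galois_point X p /\ belongs_to_galois_point X g p.
Proof.
have dK : d%:R != 0 :> R[i] by rewrite Num.Theory.pnatr_eq0 -lt0n; apply: leq_trans hd.
split=> [|[p [[_ nXp]]]]; first exact: (fixed_codim1_galois_point hn hd dK hX hg hgd).
exact: (galois_point_fixed_codim1 hn hd dK hX hg hgd).
Qed.
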